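(* Suppose the contraction semigroup $\{e^{-tL}:t\ge0\}$ is nuclear, i.e. $$Z_L(\beta):=\mathrm{Tr}(e^{-\beta L})<+\infty\qquad\text{for all }\beta>0,$$ and assume that the partition function $Z_L$ is regularly varying, i.e. for some $\gamma\in\mathbb{R}$ one has $\lim_{\beta\to0^+}\frac{Z_L(s\beta)}{Z_L(\beta)}=s^\gamma$ for all $s>0$. Then for some constant $c>0$ $$N_L(x)\sim c\cdot Z_L(1/x)\qquad x\to+\infty.$$ In particular, under these assumptions, $N_L$ is asymptotically continuous and $\rho(L)$ is a spectral density.
   Context: Let $h$ be a Hilbert space and $(L,D(L))$ a densely defined, nonnegative, unbounded self-adjoint operator on $h$ with spectral measure $E^L$, having discrete spectrum off its kernel: $sp(L)\setminus\{0\}$ is discrete in the sense that $L^{-1}$ (defined as $0$ on $\ker L$ and as the inverse of $L$ on $(\ker L)^\perp$) is compact. Convention: for measurable $f:\mathbb{R}_+\to\mathbb{R}_+$, the operator $f(L)$ is $0$ on $\ker L$ and given by the usual functional calculus on $(\ker L)^\perp$. Write $0<\widetilde\lambda_1<\widetilde\lambda_2<\cdots$ for the distinct nonzero eigenvalues of $L$ (tending to $+\infty$), $m_k=\mathrm{Tr}(E^L(\{\widetilde\lambda_k\}))$, $M_k=\sum_{j=1}^k m_j$. The eigenvalue counting function is $N_L(x)=\mathrm{Tr}(E^L((0,x]))$. $N_L$ is asymptotically continuous if there is a continuous $\varphi:\mathbb{R}_+\to\mathbb{R}_+$ with $N_L(x)\sim\varphi(x)$ as $x\to+\infty$. The spectral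 weight of $L$ is $\rho(L):=N_L(L)^{-1}$, i.e. the operator that is $0$ on $\ker L$ and $1/M_k$ on the eigenspace of $\widetilde\lambda_k$. It lies in the dual Macaev ideal $\mathcal{L}^{(1,\infty)}(h)=\{T \text{ compact}:\sup_{N\ge2}\frac{1}{\log N}\sum_{n=1}^N\mu_n(T)<+\infty\}$, where $\mu_n(T)$, $n\ge 1$, are the singular values of $T$ in decreasing order. $\rho(L)$ is called a spectral density if it is measurable (i.e. $\mathrm{Tr}_\omega(\rho(L))$ does not depend on $\omega$) and $\mathrm{Tr}_\omega(\rho(L))=1$ for all Dixmier ultrafilters $\omega$. A Dixmier ultrafilter is given by a state $\omega$ on $L^\infty(\mathbb{R}_+^* )$ (write $\omega\text{-}\lim_{t\to+\infty}f(t)=\omega(f)$) such that for all $f$ and $s>0$: $\mathrm{ess}\liminf_{t\to+\infty}f\le\omega(f)\le\mathrm{ess}\limsup_{t\to+\infty}f$; $\omega\text{-}\lim f(st)=\omega\text{-}\lim f(t)$; $\omega\text{-}\lim f(t^s)=\omega\text{-}\lim f(t)$; $\omega\text{-}\lim\frac1{\log t}\int_1^tf(u)\frac{du}{u}=\omega\text{-}\lim f(t)$. On $\ell^\infty(\mathbb{N})$ put $\omega\text{-}\lim_{n\to\infty}f(n):=\omega\text{-}\lim_{t\to+\infty}f([t])$, $[t]$ the integer part. The Dixmier trace is $\mathrm{Tr}_\omega(T)=\omega\text{-}\lim_{N\to\infty}\frac1{\log N}\sum_{n=1}^N\mu_n(T)$ for $0\le T\in\mathcal{L}^{(1,\infty)}(h)$,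 extended linearly. *)

(* Defs.v *)
From HB Require Import structures.
From mathcomp Require Import all_boot all_order all_algebra.
From mathcomp Require Import all_classical all_reals all_analysis.
From mathcomp Require Import ess_sup_inf hoelder complex sesquilinear.

Set Implicit Arguments.
Unset Strict Implicit.
Unset Printing Implicit Defensive.

Import Order.TTheory GRing.Theory Num.Theory.
Import numFieldNormedType.Exports.

Local Open Scope classical_set_scope.
Local Open Scope complex_scope.
Local Open Scope ring_scope.

(* A Hilbert space is a complete normed space H over R[i] with a positive
   definite Hermitian form (linear on the left) that induces the norm. *)
Definition hilbert_form (R : realType) (H : completeNormedModType R[i])
    (dot : {dot H for Num.conj}) : Prop :=
  forall x : H, `|x| ^+ 2 = dot x x.

Section Operators.
Context (R : realType) (H : completeNormedModType R[i]).
Variable dot : {dot H for Num.conj}.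

(* An unbounded operator is given by its domain D and a function L on H, of
   which only the values on D are relevant. *)

Definition linear_on (D : set H) (L : H -> H) : Prop :=
  D 0 /\ forall (a : R[i]) (x y : H), D x -> D y ->
    D (a *: x + y) /\ L (a *: x + y) = a *: L x + L y.

(* The graph of the adjoint of L is the graph of L. *)
Definition self_adjoint (D : set H) (L : H -> H) : Prop :=
  forall y z : H,
    (forall x, D x -> dot (L x) y = dot x z) <-> (D y /\ L y = z).

Definition nonneg_op (D : set H) (L : H -> H) : Prop :=
  forall x, D x -> 0 <= dot (L x) x.

Definition unbounded_op (D : set H) (L : H -> H) : Prop :=
  ~ exists M : R, forall x, D x -> `|L x| <= M%:C * `|x|.

Definition compact_op (T : H -> H) : Prop :=
  linear T /\ precompact (T @` [set x | `|x| <= 1]).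

Definition op_ker (D : set H) (L : H -> H) : set H :=
  [set x | D x /\ L x = 0].

Definition orthogonal_of (W : set H) : set H :=
  [set x | forall y, W y -> dot x y = 0].

(* T is 0 on ker L and inverts the restriction of L to the orthogonal of
   ker L. *)
Definition inverse_off_ker (D : set H) (L T : H -> H) : Prop :=
  (forall x, op_ker D L x -> T x = 0) /\
  (forall x, orthogonal_of (op_ker D L) x ->
     [/\ D (T x), orthogonal_of (op_ker D L) (T x) & L (T x) = x]).

Definition discrete_off_ker (D : set H) (L : H -> H) : Prop :=
  exists T : H -> H, inverse_off_ker D L T /\ compact_op T.

Record projection_valued_measure (E : set R -> H -> H) : Prop := {
  pvm_linear : forall A, measurable A -> linear (E A);
  pvm_idem : forall A x, measurable A -> E A (E A x) = E A x;
  pvm_sym : forall A x y, measurable A -> dot (E A x) y = dot x (E A y);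
  pvm0 : forall x, E set0 x = 0;
  pvmT : forall x, E setT x = x;
  pvmI : forall A B x, measurable A -> measurable B ->
    E (A `&` B) x = E A (E B x);
  pvm_sigma_additive : forall (F : nat -> set R) (x : H),
    (forall n, measurable (F n)) -> trivIset setT F ->
    (\sum_(i < n) E (F i) x) @[n --> \oo] --> E (\bigcup_n F n) x }.

(* The measure A |-> <E(A) x, x>, which is real-valued. *)
Definition scalar_measure (E : set R -> H -> H) (x : H) (A : set R) : \bar R :=
  (complex.Re (dot (E A x) x))%:E.

(* L is the integral of the identity of R against E. Quadratic forms determine
   operators because the scalars are complex. *)
Definition spectral_measure_of (D : set H) (L : H -> H)
    (E : set R -> H -> H) : Prop :=
  [/\ projection_valued_measure E,
      (forall x, D x <->
         (\int[scalar_measure E x]_l (l ^+ 2)%:E < +oo)%E) &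
      (forall x, D x ->
         (complex.Re (dot (L x) x))%:E =
         (\int[scalar_measure E x]_l l%:E)%E)].

(* The operator f(L), for L >= 0 with spectral measure E and f bounded and
   measurable, with the convention that f(L) is 0 on ker L: the integral is
   over ]0, +oo[. *)
Definition fun_calculus (E : set R -> H -> H) (f : R -> R) : H -> H :=
  get [set T : H -> H | linear T /\ forall x,
    dot (T x) x =
    (fine (\int[scalar_measure E x]_(l in `]0%R, +oo[) (f l)%:E)%E)%:C].

(* Hilbert bases of the closed subspace W *)
Definition orthonormal_basis (W B : set H) : Prop :=
  [/\ B `<=` W,
      (forall e, B e -> dot e e = 1),
      (forall e e', B e -> B e' -> e <> e' -> dot e e' = 0) &
      (forall x, W x -> (forall e, B e -> dot x e = 0) -> x = 0)].

Lemma orthonormal_basis_exists :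
  hilbert_form dot -> exists B, orthonormal_basis setT B.
Proof.
move=> hd.
pose P (B : set H) := (forall e, B e -> dot e e = 1) /\
  (forall e e', B e -> B e' -> e <> e' -> dot e e' = 0).
have [|B [[B1 B2] Bmax]] := @Zorn_bigcup _ P.
  move=> F FP Ftot; split=> [e [X FX Xe]|e e' [X FX Xe] [Y FY Ye'] ee'].
    by have [+ _] := FP _ FX; apply.
  have [XY|YX] := Ftot _ _ FX FY.
    by have [_ +] := FP _ FY; apply => //; exact: XY.
  by have [_ +] := FP _ FX; apply => //; exact: YX.
exists B; split => // x _ xB; apply: contrapT => /eqP x0.
have nx0 : `|x| != 0 by rewrite normr_eq0.
pose u := `|x|^-1 *: x.
have uu : dot u u = 1.
  by rewrite -hd normrZ normfV normr_id mulVf// expr1n.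
have uB e : B e -> dot u e = 0.
  by move=> Be; rewrite /u linearZl_LR/= xB// mulr0.
have Bu e : B e -> dot e u = 0.
  by move=> Be; rewrite hermC/= uB// rmorph0 mulr0.
apply: (Bmax (B `|` [set u])); last first.
  split=> [e [|->//]|e e' [Be|->] [Be'|->] ee']; first exact: B1.
  - exact: B2.
  - exact: Bu.
  - exact: uB.
  - by case: ee'.
split; first by move=> e Be; left.
move=> BuB; have /uB := BuB u (or_intror erefl); rewrite uu => /eqP.
by rewrite oner_eq0.
Qed.

(* The trace of a nonnegative operator, in a chosen Hilbert basis of H *)
Definition op_trace (T : H -> H) : \bar R :=
  (\esum_(e in get (orthonormal_basis setT)) (complex.Re (dot (T e) e))%:E)%E.

Definition counting_function (E : set R -> H -> H) (x : R) : R :=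
  fine (op_trace (E `]0, x]%classic)).

Definition heat_trace (E : set R -> H -> H) (b : R) : \bar R :=
  op_trace (fun_calculus E (fun l => expR (- (b * l)))).

Definition partition_function (E : set R -> H -> H) (b : R) : R :=
  fine (heat_trace E b).

Definition spectral_weight (E : set R -> H -> H) : H -> H :=
  fun_calculus E (fun l => (counting_function E l)^-1).

(* The kernel of T^* T - s^2 *)
Definition singular_space (T : H -> H) (s : R) : set H :=
  [set x | forall y, dot (T x) (T y) = (s ^+ 2)%:C * dot x y].

(* mu is the decreasing sequence of singular values of the compact operator T,
   repeated according to multiplicity (and ending with zeros if T has finite
   rank). The index starts at 0: mu n is the (n+1)-st singular value. *)
Definition is_singular_values (T : H -> H) (mu : nat -> R) : Prop :=
  [/\ nonincreasing_seq mu, (forall n, 0 <= mu n) &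
      forall s, 0 < s -> exists B,
        orthonormal_basis (singular_space T s) B /\ (B #= [set n | mu n = s])%card].

Definition singular_values (T : H -> H) : nat -> R :=
  get (is_singular_values T).

Definition log_mean_singular (T : H -> H) (N : nat) : R :=
  (ln N%:R)^-1 * \sum_(n < N) singular_values T n.

Definition dual_macaev (T : H -> H) : Prop :=
  compact_op T /\
  exists C : R, forall N, (2 <= N)%N -> log_mean_singular T N <= C.

End Operators.

Section DixmierTrace.
Context (R : realType).
Implicit Types f g : R -> R.

Definition lebesgue_right (a : R) :
    {measure set (measurableTypeR R) -> \bar R} :=
  mrestr lebesgue_measure (measurable_itv `]a, +oo[).

(* Representatives of the elements of L^oo(]0, +oo[); their values on ]-oo, 0]
   are irrelevant. *)
Definition Linfty f : Prop := f \in Lfun (lebesgue_right 0) +oo%E.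

Definition ess_limsup f : \bar R :=
  ereal_inf [set ess_sup (lebesgue_right a) (EFin \o f) | a in `]0, +oo[].

Definition ess_liminf f : \bar R :=
  ereal_sup [set ess_inf (lebesgue_right a) (EFin \o f) | a in `]0, +oo[].

(* (1 / log t) \int_1^t f(u) du/u, with an oriented integral *)
Definition log_average f (t : R) : R :=
  (ln t)^-1 *
  (if 1 <= t then \int[lebesgue_measure]_(u in `[1, t]) (f u / u)
   else - \int[lebesgue_measure]_(u in `[t, 1]) (f u / u)).

Record dixmier_state (omega : (R -> R) -> R) : Prop := {
  dixmier_linear : forall (a : R) f g, Linfty f -> Linfty g ->
    omega (fun t => a * f t + g t) = a * omega f + omega g;
  dixmier_ae : forall f g, Linfty f -> Linfty g ->
    (\forall t \ae lebesgue_right 0, f t = g t) -> omega f = omega g;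
  dixmier_ge0 : forall f, Linfty f ->
    (\forall t \ae lebesgue_right 0, 0 <= f t) -> 0 <= omega f;
  dixmier1 : omega (fun=> 1) = 1;
  dixmier_bounds : forall f, Linfty f ->
    (ess_liminf f <= (omega f)%:E <= ess_limsup f)%E;
  dixmier_dilation : forall f (s : R), Linfty f -> 0 < s ->
    omega (fun t => f (s * t)) = omega f;
  dixmier_power : forall f (s : R), Linfty f -> 0 < s ->
    omega (fun t => f (t `^ s)) = omega f;
  dixmier_log_average : forall f, Linfty f ->
    omega (log_average f) = omega f }.

Definition dixmier_lim_seq (omega : (R -> R) -> R) (u : nat -> R) : R :=
  omega (fun t => u (Num.truncn t)).

(* The Dixmier trace on nonnegative operators of the dual Macaev ideal *)
Definition dixmier_trace (H : completeNormedModType R[i])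
    (dot : {dot H for Num.conj}) (omega : (R -> R) -> R) (T : H -> H) : R :=
  dixmier_lim_seq omega (log_mean_singular dot T).

Definition dixmier_measurable (H : completeNormedModType R[i])
    (dot : {dot H for Num.conj}) (T : H -> H) : Prop :=
  forall omega omega', dixmier_state omega -> dixmier_state omega' ->
    dixmier_trace dot omega T = dixmier_trace dot omega' T.

Definition spectral_density (H : completeNormedModType R[i])
    (dot : {dot H for Num.conj}) (T : H -> H) : Prop :=
  [/\ dual_macaev dot T, dixmier_measurable dot T &
      forall omega, dixmier_state omega -> dixmier_trace dot omega T = 1].

End DixmierTrace.

Section Asymptotics.
Context (R : realType).

Definition asymp_equiv (f g : R -> R) : Prop :=
  (f x / g x) @[x --> +oo] --> (1 : R).

Definition regularly_varying_at0 (Z : R -> R) : Prop :=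
  exists gamma : R, forall s : R, 0 < s ->
    (Z (s * b) / Z b) @[b --> 0^'+] --> s `^ gamma.

Definition asymptotically_continuous (N : R -> R) : Prop :=
  exists phi : R -> R, [/\ {within `[0, +oo[, continuous phi},
    (forall x, 0 <= x -> 0 <= phi x) & asymp_equiv N phi].

End Asymptotics.

(* Main.v *)
(* Finiteness of the heat trace makes every E ]0, x] of finite rank. A spectral
   projection of finite rank has atoms, so the part of H over ]0, +oo[ has an
   orthonormal basis of eigenvectors e_n, with eigenvalues lam_n increasing to
   +oo because L is unbounded, and Z b is the sum of the exp (- b lam_n).

   Tauberian step (after Karamata). For a polynomial P with P(0) = 0, the sum of
   the P(exp (- b lam_n)), divided by Z b, converges as b tends to 0, by regular
   variation. Taking P = 1 - (1 - u^k)^(2^k), which approximates the indicator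
   of u > 1/2, and using regular variation once more to rescale, the limsup and
   the liminf of N(x) / Z(1/x) agree up to factors tending to 1. The limit is
   positive because the eigenvalues above s/b contribute at most
   exp (- s/2) Z(b/2) to Z b.

   Spectral weight. The singular values of rho(L) are the 1 / N(lam_n). By
   construction n < N(lam_n), and by the regular variation of N also
   N(lam_n) <= (1 + eta) n for large n. Hence their partial sums are those of the
   harmonic series up to a factor tending to 1, the logarithmic means converge
   to 1, and every Dixmier state takes the value 1 on a sequence tending to 1. *)
Require Import Defs.
From HB Require Import structures.
From mathcomp Require Import all_boot all_order all_algebra.
From mathcomp Require Import all_classical all_reals all_analysis.
From mathcomp Require Import ess_sup_inf hoelder complex sesquilinear.
From mathcomp Require Import measurable_realfun.
From mathcomp Require Import ring lra.

Set Implicit Arguments.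
Unset Strict Implicit.
Unset Printing Implicit Defensive.

Import Order.TTheory GRing.Theory Num.Theory.
Import numFieldNormedType.Exports.

Local Open Scope classical_set_scope.
Local Open Scope ring_scope.

(** * The Tauberian argument *)

Section RealLimits.
Context {R : realType}.

(** Regular variation is a pointwise statement in [s], without uniformity, so only finitely many
    dilations of [Z] are compared at a time: a polynomial without constant term in [exp (- b lam_n)]
    sums to a combination of the values [Z (i b)]. The limit of that sum, divided by [Z b], is never
    evaluated. It only has to be the same number in a lower bound with threshold just below [ln 2]
    and in an upper bound with threshold just above, [ln 2] being where [exp (- s)] crosses 1/2.

    On the operator side, three objects are defined by choice: [f(L)] through its quadratic form,
    the singular values, and the Hilbert basis in the trace. Each calls for uniqueness or for a
    formula that does not depend on the choice. A witness for [f(L)] comes from the binary digits of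
    [f], each digit contributing one spectral projection; the geometric weights make the series
    converge at every vector, and the same expansion yields eigenvalues and traces. H may be
    non-separable and the kernel of L infinite-dimensional, so eigenvector expansions are confined
    to the range of [E ]0, +oo[]. *)

Lemma cvgr_sum (T : Type) (F : set_system T) {FF : Filter F} (I : Type)
    (r : seq I) (f : I -> T -> R) (l : I -> R) :
  (forall i, f i @ F --> l i) ->
  (\sum_(i <- r) f i x) @[x --> F] --> \sum_(i <- r) l i.
Proof.
move=> fl; elim: r => [|i r IH].
  rewrite big_nil; under eq_fun do rewrite big_nil.
  exact: cvg_cst.
rewrite big_cons; under eq_fun do rewrite big_cons.
by apply: cvgD.
Qed.

Lemma near_cvg_lt (T : Type) (F : set_system T) {FF : Filter F}
    (f g : T -> R) (a b : R) :
  f @ F --> a -> g @ F --> b -> a < b -> \forall x \near F, f x < g x.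
Proof.
move=> fa gb ab; pose e := (b - a) / 2.
have e0 : 0 < e by rewrite divr_gt0// subr_gt0.
move/cvgrPdist_lt/(_ e e0): fa => fa; move/cvgrPdist_lt/(_ e e0): gb.
apply: filterS2 fa => x; rewrite !ltr_norml => /andP[h1 _] /andP[_ h2].
by move: h1 h2; rewrite /e; lra.
Qed.

Lemma near_pinfty_inv (P : set R) :
  (\forall b \near 0^'+, P b) -> \forall x \near +oo, P x^-1.
Proof.
move=> [e /= e0 h]; near=> x.
have x0 : 0 < x by near: x; by apply: nbhs_pinfty_gt; rewrite num_real.
apply: h; rewrite /= ?invr_gt0// distrC subr0 gtr0_norm ?invr_gt0//.
rewrite invf_plt ?posrE//; near: x; by apply: nbhs_pinfty_gt; rewrite num_real.
Unshelve. all: by end_near. Qed.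

Lemma near_pinfty_mul (s : R) (P : set R) : 0 < s ->
  (\forall x \near +oo, P x) -> \forall x \near +oo, P (s * x).
Proof.
move=> s0 [M [Mr h]]; near=> x; apply: h.
rewrite mulrC -ltr_pdivrMr//; near: x; apply: nbhs_pinfty_gt.
by rewrite num_real.
Unshelve. all: by end_near. Qed.

Lemma cvg_geometric0 (c z : R) : 0 <= z < 1 -> (c * z ^+ k) @[k --> \oo] --> 0.
Proof.
move=> /andP[z0 z1]; have /cvg_geometric : `|z| < 1 by rewrite ger0_norm.
by move/(_ c).
Qed.

Lemma powR_near1 (rho eta : R) : 0 < eta ->
  exists2 t : R, 1 < t & t `^ rho <= 1 + eta.
Proof.
move=> e0; have le0 : 0 < ln (1 + eta) by apply: ln_gt0; lra.
have r1 : 0 < `|rho| + 1 by rewrite ltr_wpDl.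
(* The [+ 1] keeps the divisor positive for [rho = 0], and [rho / (|rho| + 1) <= 1] gives the
   bound. *)
exists (expR (ln (1 + eta) / (`|rho| + 1))).
  by rewrite -[ltLHS]expR0 ltr_expR divr_gt0.
rewrite -[leRHS]lnK ?posrE; last lra.
rewrite /powR gt_eqF ?expR_gt0// expRK ler_expR mulrCA ler_piMr//.
  exact: ltW.
by rewrite ler_pdivrMr ?mul1r//; apply: le_trans (ler_norm rho) _; rewrite lerDl.
Qed.

End RealLimits.

(** * Polynomials approximating a step at 1/2 *)

Section StepPolynomial.
Context {R : realType}.

(* On [0, 1] these polynomials converge, as [k] grows, to the indicator of
   u > 1/2, uniformly away from 1/2 and, near 0, relatively to [u]. *)
Definition step_poly (k : nat) : {poly R} :=
  1 - (1 - 'X^(k.+1)) ^+ (2 ^ k.+1).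

Lemma step_polyE k u : (step_poly k).[u] = 1 - (1 - u ^+ k.+1) ^+ (2 ^ k.+1).
Proof. by rewrite /step_poly !(hornerE, hornerXn). Qed.

Lemma bernoulli_ge (v : R) m : 0 <= v <= 1 -> 1 - m%:R * v <= (1 - v) ^+ m.
Proof.
move=> /andP[v0 v1]; elim: m => [|m IH]; first by rewrite mul0r expr0 subr0.
rewrite exprS; have h : (1 - v) * (1 - m%:R * v) <= (1 - v) * (1 - v) ^+ m.
  by apply: ler_wpM2l => //; lra.
apply: le_trans h; rewrite -natr1; have := ler0n R m.
by move=> m0; have := mulr_ge0 m0 (mulr_ge0 v0 v0); lra.
Qed.

(** Multiplying [1 + m v <= (1 + v) ^+ m] by [(1 - v) ^+ m] leaves [(1 - v^2) ^+ m <= 1] on the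
    right. So [(1 - v) ^+ m] is at most [1 / (m v)] when [m v > 0]. *)
Lemma bernoulli_le (v : R) m : 0 <= v <= 1 -> m%:R * v * (1 - v) ^+ m <= 1.
Proof.
move=> /andP[v0 v1].
have h1 : 1 + m%:R * v <= (1 + v) ^+ m.
  elim: m => [|m IH]; first by rewrite mul0r expr0 addr0.
  rewrite exprS; have h : (1 + v) * (1 + m%:R * v) <= (1 + v) * (1 + v) ^+ m.
    by apply: ler_wpM2l => //; lra.
  apply: le_trans h; rewrite -natr1; have := ler0n R m.
  by move=> m0; have := mulr_ge0 m0 (mulr_ge0 v0 v0); lra.
have h2 : 0 <= (1 - v) ^+ m by apply: exprn_ge0; lra.
have h3 : (1 + v) ^+ m * (1 - v) ^+ m <= 1.
  by rewrite -exprMn; apply: exprn_ile1; nra.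
apply: le_trans h3; apply: ler_wpM2r => //; lra.
Qed.

Lemma step_poly_ge0 k u : 0 <= u <= 1 -> 0 <= (step_poly k).[u].
Proof.
move=> /andP[u0 u1]; rewrite step_polyE subr_ge0; apply: exprn_ile1.
  by rewrite subr_ge0 exprn_ile1.
by rewrite lerBlDr lerDl exprn_ge0.
Qed.

Lemma step_poly_le1 k u : 0 <= u <= 1 -> (step_poly k).[u] <= 1.
Proof.
move=> /andP[u0 u1]; rewrite step_polyE lerBlDr lerDl exprn_ge0//.
by rewrite subr_ge0 exprn_ile1.
Qed.

(** Bernoulli bounds the left side by [(2 u) ^+ k.+1]. One factor [u] is kept: summed over
    [u = exp (- b lam_n)] it gives [Z b], whereas a constant bound would not be summable. The
    coefficient tends to 0 when [a < 1/2]. *)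
Lemma step_poly_small k a u : 0 <= u <= a -> a <= 1 ->
  (step_poly k).[u] <= 2 * (2 * a) ^+ k * u.
Proof.
move=> /andP[u0 ua] a1; have uk : 0 <= u ^+ k.+1 <= 1.
  by rewrite exprn_ge0//= exprn_ile1//; lra.
rewrite step_polyE; have := bernoulli_ge (2 ^ k.+1) uk.
have -> : (2 ^ k.+1)%N%:R * u ^+ k.+1 = (2 * u) ^+ k * (2 * u) :> R.
  by rewrite natrX -exprMn exprSr.
have : (2 * u) ^+ k <= (2 * a) ^+ k.
  by apply: lerXn2r; rewrite ?nnegrE; lra.
nra.
Qed.

(** With [m = 2 ^ k.+1] and [v = u ^+ k.+1], [bernoulli_le] bounds the defect from 1 by the inverse
    of [m v = (2 u) ^+ k.+1]. *)
Lemma step_poly_big k b u : b <= u <= 1 -> 0 < b ->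
  1 - ((2 * b) ^+ k.+1)^-1 <= (step_poly k).[u].
Proof.
move=> /andP[bu u1] b0; have uk : 0 <= u ^+ k.+1 <= 1.
  by rewrite exprn_ge0 ?exprn_ile1//; lra.
rewrite step_polyE lerB//; have := bernoulli_le (2 ^ k.+1) uk.
have -> : (2 ^ k.+1)%N%:R * u ^+ k.+1 = (2 * u) ^+ k.+1 :> R.
  by rewrite natrX -exprMn.
have b2 : 0 < (2 * b) ^+ k.+1 by apply: exprn_gt0; lra.
have : (2 * b) ^+ k.+1 <= (2 * u) ^+ k.+1.
  by apply: lerXn2r; rewrite ?nnegrE; lra.
set w := _ ^+ (2 ^ _) => h1 h2; rewrite -[leRHS]mul1r ler_pdivlMr// mulrC.
apply: le_trans h2; apply: ler_wpM2r => //.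
by apply: exprn_ge0; rewrite subr_ge0; case/andP: uk.
Qed.

End StepPolynomial.

(** * Comparison of the counting function with the partition function *)

Section Tauberian.
Context {R : realType} (lam : nat -> R) (N : R -> nat) (Z : R -> R) (gam : R).
Hypothesis lam_gt0 : forall n, 0 < lam n.
Hypothesis lamN : forall n x, (n < N x)%N = (lam n <= x).
Hypothesis HZ : forall b, 0 < b ->
  series (fun n => expR (- (b * lam n))) @ \oo --> Z b.
Hypothesis HR : forall s : R, 0 < s ->
  (Z (s * b) / Z b) @[b --> 0^'+] --> s `^ gam.

Lemma cvg_series_counting (x : R) :
  series (fun n => (lam n <= x)%R%:R : R) @ \oo --> ((N x)%:R : R).
Proof.
(* By [lamN] the indices with [lam n <= x] form the initial segment of length [N x]. *)
have E m : series (fun n => (lam n <= x)%R%:R : R) m = (minn m (N x))%:R.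
  rewrite /series/=; elim: m => [|m IH]; first by rewrite big_geq// min0n.
  rewrite big_nat_recr//= IH -lamN -natrD; congr (_%:R).
  have [h|h] := ltnP m (N x).
    by rewrite (minn_idPl h) addn1.
  by rewrite (minn_idPr _) ?addn0// leqW.
apply: (@cvg_near_cst); near=> m; rewrite E (minn_idPr _)//.
by near: m; exact: nbhs_infty_ge.
Unshelve. all: by end_near. Qed.

(** The i-th power of [exp (- (b lam_n))] is the summand at [i b]. The constant term would diverge;
    [P.[0] = 0] removes it, so that the junk value [Z 0] on the right has coefficient 0. *)
Lemma cvg_series_poly (P : {poly R}) b : P.[0] = 0 -> 0 < b ->
  series (fun n => P.[expR (- (b * lam n))]) @ \oo -->
    \sum_(i < size P) P`_i * Z (i%:R * b).
Proof.
move=> P0 b0.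
have -> : series (fun n => P.[expR (- (b * lam n))]) =
   fun m => \sum_(i < size P)
     P`_i * series (fun n => expR (- (i%:R * b * lam n))) m.
  apply/funext => m; rewrite /series/=.
  under eq_bigr do rewrite horner_coef.
  rewrite exchange_big/=; apply: eq_bigr => i _; rewrite mulr_sumr.
  apply: eq_bigr => n _; congr (_ * _).
  by rewrite -expRM_natl mulrN mulrA.
apply: cvgr_sum => i; case: (posnP i) => [i0|i0].
  rewrite i0 -horner_coef0 P0 !mul0r; under eq_fun do rewrite mul0r.
  exact: cvg_cst.
by apply: cvgMl_tmp; apply: HZ; rewrite mulr_gt0// ltr0n.
Qed.

Lemma cvg_series_le (f g : nat -> R) a b : (forall n, f n <= g n) ->
  series f @ \oo --> a -> series g @ \oo --> b -> a <= b.
Proof.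
move=> fg fa gb; apply: (ler_cvg_to fa gb); apply: nearW => n.
by rewrite /series/=; apply: ler_sum.
Qed.

Lemma cvg_seriesZ (c : R) (f : nat -> R) a :
  series f @ \oo --> a -> series (fun n => c * f n) @ \oo --> c * a.
Proof.
have -> : series (fun n => c * f n) = (fun m => c * series f m).
  by apply/funext => m; rewrite /series/= mulr_sumr.
by move=> fa; apply: cvgMl_tmp.
Qed.

Lemma cvg_series_add (f g : nat -> R) a b :
  series f @ \oo --> a -> series g @ \oo --> b ->
  series (fun n => f n + g n) @ \oo --> a + b.
Proof.
have -> : series (fun n => f n + g n) = (fun m => series f m + series g m).
  by apply/funext => m; rewrite /series/= big_split.
by move=> fa gb; apply: cvgD.
Qed.

Lemma Z_gt0 b : 0 < b -> 0 < Z b.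
Proof.
move=> b0; apply: (lt_le_trans (expR_gt0 (- (b * lam 0)))).
apply: (cvgr_to_ge (HZ b0)); near=> n.
have n0 : (0 < n)%N by near: n; exact: nbhs_infty_gt.
rewrite /series/= big_ltn// lerDl; apply: sumr_ge0 => i _; exact: expR_ge0.
Unshelve. all: by end_near. Qed.

(** For [b > 0] this is the sum over [n] of [step_poly k] at [exp (- (b lam_n))], written through
    values of [Z] so that regular variation applies term by term. *)
Definition step_sum (k : nat) (b : R) : R :=
  \sum_(i < size (step_poly k : {poly R})) (step_poly k)`_i * Z (i%:R * b).

Definition step_lim (k : nat) : R :=
  \sum_(i < size (step_poly k : {poly R})) (step_poly k)`_i * i%:R `^ gam.

Lemma step_poly0 k : (step_poly k : {poly R}).[0] = 0.
Proof. by rewrite step_polyE expr0n/= subr0 expr1n subrr. Qed.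

Lemma cvg_step_sum k b : 0 < b ->
  series (fun n => (step_poly k).[expR (- (b * lam n))]) @ \oo -->
    step_sum k b.
Proof. by move=> b0; apply: cvg_series_poly => //; exact: step_poly0. Qed.

Lemma cvg_step_ratio k :
  (step_sum k b / Z b) @[b --> 0^'+] --> step_lim k.
Proof.
rewrite /step_sum /step_lim; under eq_fun do rewrite mulr_suml.
apply: cvgr_sum => i; under eq_fun do rewrite -mulrA.
have [i0|i0] := posnP i.
  rewrite i0 -horner_coef0 step_poly0 !mul0r; under eq_fun do rewrite mul0r.
  exact: cvg_cst.
by apply: cvgMl_tmp; apply: HR; rewrite ltr0n.
Qed.

Lemma exp01 b n : 0 < b -> 0 <= expR (- (b * lam n)) <= 1.
Proof.
move=> b0; rewrite expR_ge0/= -[leRHS]expR0 ler_expR oppr_le0.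
by rewrite mulr_ge0// ltW.
Qed.

(** The condition [lam n <= s / b] means [exp (- (b lam_n)) >= exp (- s)]. Such terms are at most 1
    each; the others fall under [step_poly_small]. The bound is sharp for large [k] when
    [s > ln 2]. *)
Lemma step_sum_upper k s b : 0 < b -> 0 <= s ->
  step_sum k b <= (N (s / b))%:R + 2 * (2 * expR (- s)) ^+ k * Z b.
Proof.
move=> b0 s0; have := cvg_series_add (@cvg_series_counting (s / b))
  (cvg_seriesZ (c := 2 * (2 * expR (- s)) ^+ k) (HZ b0)).
move=> h; apply: (cvg_series_le _ (@cvg_step_sum k b b0) h) => n {h}.
have /andP[u0 u1] := exp01 n b0; have [h|h] := leP (lam n) (s / b).
  apply: (le_trans (step_poly_le1 k (exp01 n b0))); rewrite lerDl.
  by rewrite !mulr_ge0// exprn_ge0// mulr_ge0// expR_ge0.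
rewrite add0r; apply: step_poly_small; last first.
  by rewrite -[leRHS]expR0 ler_expR oppr_le0.
rewrite u0 ler_expR lerN2 mulrC -ler_pdivrMr//; exact: ltW.
Qed.

Lemma step_sum_lower k s b : 0 < b -> 1 <= 2 * expR (- s) ->
  (1 - ((2 * expR (- s)) ^+ k.+1)^-1) * (N (s / b))%:R <= step_sum k b.
Proof.
move=> b0 s0; set c := 1 - _; have := cvg_seriesZ (c := c) (@cvg_series_counting (s / b)).
move=> h; apply: (cvg_series_le _ h (@cvg_step_sum k b b0)) => n {h}.
have /andP[u0 u1] := exp01 n b0; have [h|h] := leP (lam n) (s / b).
  rewrite mulr1; apply: step_poly_big; last exact: expR_gt0.
  by rewrite u1 andbT ler_expR lerN2 mulrC -ler_pdivlMr.
by rewrite mulr0 step_poly_ge0 ?exp01.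
Qed.

(** [F] is the quotient whose limit is sought. In [NFr], the factor [r s x] below is the price of
    replacing [Z (1 / (s x))] by [Z (1 / x)]. *)
Let F x : R := (N x)%:R / Z x^-1.

Let r s x : R := Z (s^-1 * x^-1) / Z x^-1.

Lemma cvg_at0_pinfty (f : R -> R) (l : R) :
  f b @[b --> 0^'+] --> l -> f x^-1 @[x --> +oo] --> l.
Proof. by move=> fl A /fl; exact: near_pinfty_inv. Qed.

Lemma cvg_r s : 0 < s -> r s x @[x --> +oo] --> s^-1 `^ gam.
Proof.
move=> s0; apply: (@cvg_at0_pinfty (fun b => Z (s^-1 * b) / Z b)).
by apply: HR; rewrite invr_gt0.
Qed.

Lemma NFr s x : 0 < s -> 0 < x -> (N (s * x))%:R / Z x^-1 = F (s * x) * r s x.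
Proof.
move=> s0 x0; rewrite /F /r invfM.
have : 0 < Z (s^-1 * x^-1) by apply: Z_gt0; rewrite mulr_gt0 ?invr_gt0.
have : 0 < Z x^-1 by apply: Z_gt0; rewrite invr_gt0.
by move=> /gt_eqF h1 /gt_eqF h2; field; rewrite ?h1 ?h2 ?gt_eqF.
Qed.

Lemma F_ge0 x : 0 < x -> 0 <= F x.
Proof. by move=> x0; rewrite divr_ge0// ltW// Z_gt0 ?invr_gt0. Qed.

(** Each eigenvalue [lam n <= x] contributes at least [exp (- 1)] to [Z (1 / x)], whence the bound
    [expR 1]. *)
Lemma F_bounded : exists M : R, forall x, 0 < x -> F x <= M.
Proof.
exists (expR 1) => x x0; have xi : 0 < x^-1 by rewrite invr_gt0.
rewrite ler_pdivrMr ?Z_gt0//; have := cvg_seriesZ (c := expR 1) (HZ xi).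
move=> h; apply: (cvg_series_le _ (@cvg_series_counting x) h) => n {h}.
have [h|h] := leP (lam n) x; last by rewrite mulr_ge0 ?expR_ge0.
rewrite -expRD -[leLHS]expR0 ler_expR subr_ge0 mulrC ler_pdivrMr//.
by rewrite mul1r.
Qed.

(* The negated hypothesis says that [p] is at most the limsup of [F]; the limsup
   itself is never named, so that no extended reals are needed. *)
Lemma step_lim_lower k s p : 0 < s -> 1 < 2 * expR (- s) ->
  ~ (\forall x \near +oo, F x <= p) ->
  (1 - ((2 * expR (- s)) ^+ k.+1)^-1) * (p * s^-1 `^ gam) <= step_lim k.
Proof.
move=> s0 s1 np; set c := 1 - _; rewrite leNgt; apply/negP => lt; apply: np.
have c0 : 0 <= c.
  rewrite subr_ge0 invf_le1; last by rewrite exprn_gt0// (lt_trans ltr01).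
  by rewrite exprn_ege1// ltW.
have h1 : c * (p * r s x) @[x --> +oo] --> c * (p * s^-1 `^ gam).
  by apply: cvgMl_tmp; apply: cvgMl_tmp; exact: cvg_r.
have h2 := cvg_at0_pinfty (@cvg_step_ratio k).
have h3 : \forall x \near +oo, 0 < c * (p * r s x) - step_sum k x^-1 / Z x^-1.
  by near=> x; rewrite subr_gt0; near: x; exact: (near_cvg_lt h2 h1 lt).
have h4 : \forall x \near +oo, F (s * x) <= p.
  near=> x; have x0 : 0 < x by near: x; apply: nbhs_pinfty_gt; rewrite num_real.
  have xi : 0 < x^-1 by rewrite invr_gt0.
  have : 0 < c * (p * r s x) - step_sum k x^-1 / Z x^-1 by near: x.
  rewrite subr_gt0 => h5; rewrite leNgt; apply/negP => h6.
  have := step_sum_lower k xi (ltW s1); rewrite -/c => h7.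
  move: h5; apply/negP; rewrite -leNgt; rewrite invrK in h7.
  have : c * (F (s * x) * r s x) <= step_sum k x^-1 / Z x^-1.
    rewrite -NFr// mulrA; apply: ler_wpM2r h7.
    by rewrite invr_ge0 ltW// Z_gt0.
  apply: le_trans; apply: ler_wpM2l => //; apply: ler_wpM2r; last exact: ltW.
  by rewrite /r divr_ge0// ltW// Z_gt0// mulr_gt0// invr_gt0.
have si : 0 < s^-1 by rewrite invr_gt0.
have := near_pinfty_mul si h4; apply: filterS => x.
by rewrite mulrA mulfV ?gt_eqF// mul1r.
Unshelve. all: by end_near. Qed.

(** Contrapositive of an eventual bound: if the inequality failed, the strict inequality between the
    limits would hold near infinity and give [q <= F (s x)] there, hence [q <= F x] after rescaling
    by [s^-1]. *)
Lemma step_lim_upper k s q : 0 < s ->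
  ~ (\forall x \near +oo, q <= F x) ->
  step_lim k <= q * s^-1 `^ gam + 2 * (2 * expR (- s)) ^+ k.
Proof.
move=> s0 np; set c := 2 * _ ^+ k; rewrite leNgt; apply/negP => lt; apply: np.
have h1 : q * r s x + c @[x --> +oo] --> q * s^-1 `^ gam + c.
  by apply: cvgD; [apply: cvgMl_tmp; exact: cvg_r|exact: cvg_cst].
have h2 := cvg_at0_pinfty (@cvg_step_ratio k).
have h3 : \forall x \near +oo, 0 < step_sum k x^-1 / Z x^-1 - (q * r s x + c).
  by near=> x; rewrite subr_gt0; near: x; exact: (near_cvg_lt h1 h2 lt).
have h4 : \forall x \near +oo, q <= F (s * x).
  near=> x; have x0 : 0 < x by near: x; apply: nbhs_pinfty_gt; rewrite num_real.
  have xi : 0 < x^-1 by rewrite invr_gt0.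
  have : 0 < step_sum k x^-1 / Z x^-1 - (q * r s x + c) by near: x.
  rewrite subr_gt0 => h5; rewrite leNgt; apply/negP => h6.
  have := step_sum_upper k xi (ltW s0); rewrite -/c invrK => h7.
  move: h5; apply/negP; rewrite -leNgt ler_pdivrMr ?Z_gt0//.
  apply: (le_trans h7); rewrite mulrDl lerD2r -ler_pdivrMr ?Z_gt0// NFr//.
  apply: ler_wpM2r; last exact: ltW.
  by rewrite /r divr_ge0// ltW// Z_gt0// mulr_gt0// invr_gt0.
have si : 0 < s^-1 by rewrite invr_gt0.
have := near_pinfty_mul si h4; apply: filterS => x.
by rewrite mulrA mulfV ?gt_eqF// mul1r.
Unshelve. all: by end_near. Qed.

(** Both sides are compared with the same [step_lim k]. Since [s < ln 2 < s'] strictly, both error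
    terms are geometric in [k] and vanish in the limit. *)
Lemma scaled_bounds s s' p q : 0 < s -> 1 < 2 * expR (- s) -> 0 < s' ->
  2 * expR (- s') < 1 ->
  ~ (\forall x \near +oo, F x <= p) -> ~ (\forall x \near +oo, q <= F x) ->
  p * s^-1 `^ gam <= q * s'^-1 `^ gam.
Proof.
move=> s0 s1 s'0 s'1 np nq.
set b := 2 * expR (- s) in s1; set a := 2 * expR (- s') in s'1.
have h1 : (1 - (b ^+ k.+1)^-1) * (p * s^-1 `^ gam) @[k --> \oo] -->
    (1 - 0) * (p * s^-1 `^ gam).
  apply: cvgMr_tmp; apply: cvgB; first exact: cvg_cst.
  have -> : (fun k => (b ^+ k.+1)^-1) = (fun k => b^-1 * b^-1 ^+ k).
    by apply/funext => k; rewrite -exprVn exprS.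
  apply: cvg_geometric0; have b0 : 0 < b by apply: lt_trans s1.
  by rewrite invr_ge0 (ltW b0) invf_lt1.
have h2 : q * s'^-1 `^ gam + 2 * a ^+ k @[k --> \oo] --> q * s'^-1 `^ gam + 0.
  apply: cvgD; first exact: cvg_cst.
  by apply: cvg_geometric0; rewrite s'1 andbT mulr_ge0// expR_ge0.
rewrite subr0 mul1r addr0 in h1 h2; apply: (ler_cvg_to h1 h2).
apply: nearW => k; apply: le_trans (step_lim_lower k s0 s1 np) _.
exact: step_lim_upper.
Qed.

(** The points [ln 2 / t] and [ln 2 * t] bracket the threshold [ln 2]; they are used with [t] close
    to 1. *)
Lemma ln2_bounds (t : R) : 1 < t ->
  [/\ 0 < ln 2 / t, 1 < 2 * expR (- (ln 2 / t)), 0 < ln 2 * t &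
     2 * expR (- (ln 2 * t)) < 1].
Proof.
move=> t1; have t0 : 0 < t by apply: lt_trans t1.
have l2 : 0 < ln 2 :> R by apply: ln_gt0; rewrite ltr1n.
have e2 : 2 = expR (ln 2) :> R by rewrite lnK// posrE.
rewrite divr_gt0 ?mulr_gt0//; split => //.
  rewrite {1}e2 -expRD -[ltLHS]expR0 ltr_expR subr_gt0 ltr_pdivrMr//.
  by rewrite ltr_pMr.
by rewrite {1}e2 -expRD -[ltRHS]expR0 ltr_expR subr_lt0 ltr_pMr.
Qed.

Lemma oscillation p q : 0 <= q ->
  ~ (\forall x \near +oo, F x <= p) -> ~ (\forall x \near +oo, q <= F x) ->
  p <= q.
Proof.
move=> q0 np nq; rewrite leNgt; apply/negP => qp.
pose eta := (p - q) / (2 * (q + 1)).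
have e0 : 0 < eta by rewrite divr_gt0 ?subr_gt0// mulr_gt0//; lra.
have [t t1 ht] := powR_near1 (- (gam *+ 2)) e0.
have t0 : 0 < t by apply: lt_trans t1.
have [s0 s1 s'0 s'1] := ln2_bounds t1.
have l2 : 0 < ln 2 :> R by apply: ln_gt0; rewrite ltr1n.
have := scaled_bounds s0 s1 s'0 s'1 np nq.
rewrite invf_div invfM !powRM ?invr_ge0 ?(ltW l2) ?(ltW t0)//.
set A := (ln 2)^-1 `^ gam; have A0 : 0 < A by rewrite powR_gt0 ?invr_gt0.
rewrite [t `^ gam * A]mulrC !mulrA ![_ * A]mulrC -!mulrA ler_pM2l//.
rewrite -[t^-1]powR_inv1 ?(ltW t0)// -powRrM mulN1r => h.
have : p <= q * t `^ (- (gam *+ 2)).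
  have -> : - (gam *+ 2) = - gam - gam by rewrite mulr2n opprD.
  rewrite powRD; last by rewrite (gt_eqF t0) implybT.
  rewrite mulrA [X in _ * X]powRN ler_pdivlMr ?powR_gt0//.
have h2 : q * t `^ (- (gam *+ 2)) <= q * (1 + eta) by apply: ler_wpM2l.
move=> /le_trans/(_ h2); apply/negP; rewrite -ltNge mulrDr mulr1 -ltrBrDl.
rewrite /eta mulrA ltr_pdivrMr; last by lra.
nra.
Qed.

Lemma F_away0 : exists2 q : R, 0 < q & \forall x \near +oo, q <= F x.
Proof.
have [s s0 hs] : exists2 s : R, 0 < s & expR (- (s / 2)) * 2^-1 `^ gam <= 2^-1.
  have A0 : 0 < 2^-1 `^ gam :> R by rewrite powR_gt0.
  (* With [s = 2 ln B] one has [exp (- s / 2) = 1 / B]. The second entry of the maximum gives the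
     required bound; the first makes [s] positive. *)
  pose B : R := Num.max 2 (2 * 2^-1 `^ gam).
  have B1 : 1 < B by rewrite lt_max ltr1n.
  exists (2 * ln B); first by rewrite mulr_gt0// ln_gt0.
  rewrite [2 * ln B]mulrC mulfK// expRN lnK ?posrE ?(lt_trans ltr01)//.
  rewrite mulrC ler_pdivrMr ?(lt_trans ltr01)// mulrC ler_pdivlMr// mulrC.
  by rewrite le_max lexx orbT.
have si : 0 < s^-1 by rewrite invr_gt0.
have half : 0 < 2^-1 :> R by rewrite invr_gt0.
have h1 b : 0 < b -> Z b <= (N (s / b))%:R + expR (- (s / 2)) * Z (2^-1 * b).
  move=> b0; have hb : 0 < 2^-1 * b by rewrite mulr_gt0.
  have := cvg_series_add (@cvg_series_counting (s / b))
    (cvg_seriesZ (c := expR (- (s / 2))) (HZ hb)).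
  move=> h; apply: (cvg_series_le _ (HZ b0) h) => n {h}.
  have [h|h] := leP (lam n) (s / b).
    have /andP[_ u1] := exp01 n b0; apply: (le_trans u1).
    by rewrite lerDl mulr_ge0 ?expR_ge0.
  rewrite add0r -expRD ler_expR; move: h; rewrite ltr_pdivrMr// => h.
  by lra.
(* The large eigenvalues account for a proportion of [Z (1 / x)] whose limit is at most 1/2, hence
   at most 3/4 eventually; the remaining quarter is left to [N (s x)]. *)
have h2 : \forall x \near +oo, 4^-1 <= F (s * x) * r s x.
  have : expR (- (s / 2)) * (Z (2^-1 / x) / Z x^-1) @[x --> +oo] -->
     expR (- (s / 2)) * 2^-1 `^ gam.
    by apply: cvgMl_tmp; exact: (@cvg_at0_pinfty (fun b => Z (2^-1 * b) / Z b)
      _ (HR half)).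
  move=> /cvgrPdist_lt/(_ 4^-1) h; near=> x.
  have x0 : 0 < x by near: x; apply: nbhs_pinfty_gt; rewrite num_real.
  have xi : 0 < x^-1 by rewrite invr_gt0.
  have Zx := Z_gt0 xi.
  have : expR (- (s / 2)) * (Z (2^-1 / x) / Z x^-1) <= 3 / 4.
    have : `|expR (- (s / 2)) * 2^-1 `^ gam -
       expR (- (s / 2)) * (Z (2^-1 / x) / Z x^-1)| < 4^-1.
      by near: x; apply: h; rewrite invr_gt0.
    rewrite ltr_norml => /andP[]; lra.
  rewrite mulrA ler_pdivrMr// => h3; rewrite -NFr// ler_pdivlMr//.
  have := h1 _ xi; rewrite invrK; lra.
have rl : 0 < s^-1 `^ gam by rewrite powR_gt0.
(* The [+ 1] majorizes [r s x] near infinity, where it is close to its limit. *)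
pose q := 4^-1 / (s^-1 `^ gam + 1).
have q0 : 0 < q by rewrite divr_gt0 ?invr_gt0 ?ltr0n// ltr_wpDl// ltW.
exists q => //.
have h3 : \forall x \near +oo, q <= F (s * x).
  have /cvgrPdist_lt/(_ 1 ltr01) h := cvg_r s0.
  near=> x; have x0 : 0 < x by near: x; apply: nbhs_pinfty_gt; rewrite num_real.
  rewrite ler_pdivrMr; last by rewrite ltr_wpDl// ltW.
  have : 4^-1 <= F (s * x) * r s x by near: x.
  move=> /le_trans; apply; apply: ler_wpM2l; first by rewrite F_ge0 ?mulr_gt0.
  have : `|s^-1 `^ gam - r s x| < 1 by near: x.
  rewrite ltr_norml => /andP[]; lra.
have := near_pinfty_mul si h3; apply: filterS => x.
by rewrite mulrA mulfV ?gt_eqF// mul1r.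
Unshelve. all: by end_near. Qed.

(** The limit is the liminf of [F], realized as the supremum of the eventual lower bounds; [F_away0]
    makes it positive and [F_bounded] finite. *)
Lemma tauberian : exists2 c : R, 0 < c & F x @[x --> +oo] --> c.
Proof.
have [q0 q00 hq0] := F_away0; have [M hM] := F_bounded.
pose A := [set q | \forall x \near +oo, q <= F x].
have A0 : A !=set0 by exists q0.
have nx : \forall x \near +oo, 0 < x :> R.
  by apply: nbhs_pinfty_gt; rewrite num_real.
have AM : ubound A M.
  move=> q Aq; have [x [qx x0]] := @filter_ex _ _ _ _ (filterI Aq nx).
  exact: le_trans (hM _ x0).
have hsA : has_sup A by split => //; exists M.
have cq : q0 <= sup A by apply: ub_le_sup => //; exists M.
have c0 : 0 < sup A by exact: lt_le_trans cq.
exists (sup A) => //; apply/cvgrPdist_le => e e0; near=> x.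
rewrite ler_distlC; apply/andP; split; near: x.
  have [q Aq lt] := sup_adherent e0 hsA.
  by apply: filterS Aq => x; exact: le_trans (ltW lt).
(* Were [sup A + e] not an eventual upper bound, [oscillation] could be applied to it and to
   [sup A + e / 2], which is no eventual lower bound, in contradiction with their order. *)
apply: contrapT => np.
have : sup A + e <= sup A + e / 2.
  apply: oscillation => //; first by rewrite addr_ge0 ?ltW// divr_gt0.
  move=> h; have : sup A + e / 2 <= sup A by apply: ub_le_sup => //; exists M.
  by apply/negP; rewrite -ltNge ltrDl divr_gt0.
by apply/negP; rewrite -ltNge ltrD2l; lra.
Unshelve. all: by end_near. Qed.

(** Termwise, [exp (- x) >= 1 - x] bounds the increment by [(b' - b) lam_n exp (- (b lam_n))], and
    [lam exp (- d lam) <= (2 / d) exp (- d lam / 2)] absorbs the factor [lam_n] into the convergent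
    series at [d / 2]. *)
Lemma Z_lipschitz d b b' : 0 < d -> d <= b -> b <= b' ->
  `|Z b - Z b'| <= (b' - b) * (2 / d * Z (d / 2)).
Proof.
move=> d0 db bb'; have b0 : 0 < b by exact: lt_le_trans db.
have b'0 : 0 < b' by exact: lt_le_trans bb'.
have d2 : 0 < d / 2 by rewrite divr_gt0.
have Zb' : Z b' <= Z b.
  apply: (cvg_series_le _ (HZ b'0) (HZ b0)) => n.
  by rewrite ler_expR lerN2 ler_wpM2r// ltW.
rewrite ger0_norm ?subr_ge0// lerBlDl mulrA.
apply: (cvg_series_le _ (HZ b0)
  (cvg_series_add (HZ b'0) (cvg_seriesZ (c := (b' - b) * (2 / d)) (HZ d2)))) => n.
have l0 := lam_gt0 n.
have h1 : expR (- (b * lam n)) * (1 - (b' - b) * lam n) <= expR (- (b' * lam n)).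
  have -> : - (b' * lam n) = - (b * lam n) + (- ((b' - b) * lam n)) by ring.
  by rewrite [leRHS]expRD ler_wpM2l ?expR_ge0// expR_ge1Dx.
have h2 : expR (- (b * lam n)) * lam n <= 2 / d * expR (- (d / 2 * lam n)).
  apply: (@le_trans _ _ (expR (- (d * lam n)) * lam n)).
    by rewrite ler_pM2r// ler_expR lerN2 ler_pM2r.
  have -> : - (d * lam n) = - (d / 2 * lam n) + - (d / 2 * lam n) by lra.
  rewrite expRD -mulrA [leRHS]mulrC ler_wpM2l ?expR_ge0//.
  rewrite expRN [_^-1 * _]mulrC ler_pdivrMr ?expR_gt0// mulrAC ler_pdivlMr//.
  have := expR_ge1Dx (d / 2 * lam n); lra.
have bb : 0 <= b' - b by rewrite subr_ge0.
have := ler_wpM2l bb h2; lra.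
Qed.

Lemma Z_continuous b : 0 < b -> {for b, continuous Z}.
Proof.
move=> b0; have b2 : 0 < b / 2 by rewrite divr_gt0.
pose K := 2 / (b / 2) * Z (b / 2 / 2).
have K0 : 0 <= K.
  by rewrite mulr_ge0 ?divr_ge0// ?ltW// Z_gt0 ?divr_gt0.
apply/cvgrPdist_le => e e0; have K1 : 0 < K + 1 by rewrite ltr_wpDl.
near=> y.
have h1 : `|b - y| < b / 2.
  by near: y; have /cvgrPdist_lt := @cvg_id _ (nbhs b); apply.
have h2 : `|b - y| < e / (K + 1).
  near: y; have /cvgrPdist_lt := @cvg_id _ (nbhs b); apply.
  by rewrite divr_gt0.
have yb : b / 2 <= y by move: h1; rewrite ltr_norml => /andP[]; lra.
have h3 : `|b - y| * K <= e.
  rewrite ltr_pdivlMr// in h2; apply: le_trans (ltW h2).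
  by rewrite ler_wpM2l// lerDl.
apply: le_trans h3; have [hby|hyb] := leP b y.
  have -> : `|b - y| = y - b by rewrite distrC ger0_norm ?subr_ge0.
  by apply: Z_lipschitz => //; lra.
have -> : `|b - y| = b - y by rewrite ger0_norm// subr_ge0 ltW.
by rewrite distrC; apply: Z_lipschitz => //; exact: ltW.
Unshelve. all: by end_near. Qed.

Lemma counting_asymp_continuous (c : R) : 0 < c ->
  (fun x => (N x)%:R / Z x^-1) x @[x --> +oo] --> c ->
  exists phi : R -> R, [/\ continuous phi, (forall x, 0 <= phi x) &
    (N x)%:R / phi x @[x --> +oo] --> (1 : R)].
Proof.
(* The maximum with 1 keeps the argument of [Z] positive and continuous in [x], also at [x = 0]; it
   changes nothing near infinity. *)
move=> c0 h; exists (fun x => c * Z (Num.max x 1)^-1).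
have m0 (x : R) : 0 < Num.max x 1 by rewrite lt_max ltr01 orbT.
have mi0 (x : R) : 0 < (Num.max x 1)^-1 by rewrite invr_gt0.
split.
- move=> x; apply: cvgMl_tmp.
  apply: (@continuous_cvg _ _ _ (nbhs x) _ (fun y => (Num.max y 1)^-1) Z).
    exact: Z_continuous.
  apply: cvgV; first by rewrite gt_eqF.
  by apply: continuous_max; [exact: cvg_id|exact: cvg_cst].
- by move=> x; rewrite mulr_ge0 ?ltW// Z_gt0.
- have h1 : (N x)%:R / Z x^-1 / c @[x --> +oo] --> c / c by apply: cvgMr_tmp.
  rewrite divff ?gt_eqF// in h1; move: h1; apply: cvg_trans; apply: near_eq_cvg; near=> x.
  have x1 : 1 <= x by apply: ltW; near: x; apply: nbhs_pinfty_gt; rewrite num_real.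
  by rewrite max_l// invfM mulrA mulrAC.
Unshelve. all: by end_near. Qed.

(** After division by [Z (1 / x)], the left side tends to [c t ^ (- gam)] and the right side to
    [(1 + eta) c]; choosing [t] for [eta / 2] makes the comparison of the limits strict. *)
Lemma counting_growth (c eta : R) : 0 < c -> 0 < eta ->
  (fun x => (N x)%:R / Z x^-1) x @[x --> +oo] --> c ->
  exists2 t : R, 1 < t &
    \forall x \near +oo, (N (t * x))%:R <= (1 + eta) * (N x)%:R.
Proof.
move=> c0 e0 h; have e2 : 0 < eta / 2 by rewrite divr_gt0.
have [t t1 ht] := powR_near1 (- gam) e2.
have t0 : 0 < t by apply: lt_trans t1.
exists t => //.
have h1 : F (t * x) * r t x @[x --> +oo] --> c * t^-1 `^ gam.
  apply: cvgM; last exact: cvg_r.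
  by move=> A /h /= ; exact: near_pinfty_mul.
have h2 : (1 + eta) * F x @[x --> +oo] --> (1 + eta) * c by apply: cvgMl_tmp.
have lt : c * t^-1 `^ gam < (1 + eta) * c.
  rewrite mulrC ltr_pM2r// -[t^-1]powR_inv1 ?(ltW t0)// -powRrM mulN1r.
  by apply: le_lt_trans ht _; lra.
near=> x.
have x0 : 0 < x by near: x; apply: nbhs_pinfty_gt; rewrite num_real.
have : F (t * x) * r t x < (1 + eta) * F x by near: x; exact: (near_cvg_lt h1 h2).
by rewrite -NFr// mulrA ltr_pM2r ?invr_gt0 ?Z_gt0 ?invr_gt0// => /ltW.
Unshelve. all: by end_near. Qed.

(** On the geometric grid [t ^+ j X], take the last point before the counting function exceeds [n].
    The first exceeding index is positive because [N X <= n]. *)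
Lemma exists_bracket (t X : R) n : 1 < t -> 0 < X -> (N X <= n)%N ->
  exists x, [/\ X <= x, (N x <= n)%N & (n < N (t * x))%N].
Proof.
move=> t1 X0 NX.
have ex : exists j, (n < N (t ^+ j * X))%N.
  pose d := t - 1; have d0 : 0 < d by rewrite subr_gt0.
  have bern j : 1 + j%:R * d <= t ^+ j.
    elim: j => [|j IH]; first by rewrite mul0r addr0 expr0.
    have := ler_wpM2l (ltW (lt_trans ltr01 t1)) IH; rewrite exprS.
    apply: le_trans; rewrite -natr1; have := ler0n R j.
    have -> : t = 1 + d by rewrite /d; lra.
    by move=> j0; have := mulr_ge0 j0 (mulr_ge0 (ltW d0) (ltW d0)); lra.
  have := archi_boundP (ltW (divr_gt0 (lam_gt0 n) (mulr_gt0 d0 X0))).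
  set j := Num.bound _ => hj; exists j; rewrite lamN.
  rewrite ltr_pdivrMr ?mulr_gt0// mulrA in hj; apply: le_trans (ltW hj) _.
  by rewrite ler_pM2r//; apply: le_trans (bern j); rewrite lerDr.
case: (ex_minnP ex) => -[|j] hj jmin {ex}.
  by move: hj; rewrite expr0 mul1r ltnNge NX.
exists (t ^+ j * X); split; last by rewrite mulrA -exprS.
  by rewrite ler_peMl ?(ltW X0)// exprn_ege1// ltW.
by rewrite leqNgt; apply/negP => /jmin; rewrite ltnn.
Qed.

(** Controls multiplicities: for the bracketing [x], [lam n <= t x], so [N (lam n) <= N (t x) <= (1
    + eta) N x <= (1 + eta) n]. *)
Lemma counting_eigen_bounds (c eta : R) : 0 < c -> 0 < eta ->
  (fun x => (N x)%:R / Z x^-1) x @[x --> +oo] --> c ->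
  exists m, forall n, (m <= n)%N -> (N (lam n))%:R <= (1 + eta) * n%:R :> R.
Proof.
move=> c0 e0 h; have [t t1 [M [Mr hM]]] := counting_growth c0 e0 h.
pose X := Num.max (M + 1) 1.
have X0 : 0 < X by rewrite lt_max ltr01 orbT.
exists (N X) => n /(exists_bracket t1 X0)[x [Xx Nx Ntx]].
apply: (@le_trans _ _ (N (t * x))%:R).
  rewrite ler_nat leqNgt; apply/negP => /[!lamN] lt.
  rewrite lamN in Ntx; have := lt_le_trans _ _; move: Ntx lt.
  set k := N (t * x) => Ntx; have := ltnn k; rewrite {2}/k lamN => /negbT.
  rewrite -ltNge => h1 h2; have := lt_le_trans (le_lt_trans Ntx h1) h2.
  by rewrite ltxx.
apply: (@le_trans _ _ ((1 + eta) * (N x)%:R)).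
  apply: hM; apply: lt_le_trans Xx; rewrite lt_max; apply/orP; left; lra.
by rewrite ler_wpM2l ?ler_nat//; lra.
Qed.

End Tauberian.

(** * Logarithmic means of the reciprocals 1 / N(lam_n) *)

Section LogMean.
Context {R : realType}.

Lemma harmonic_upper n : \sum_(i < n.+1) i.+1%:R^-1 <= 1 + ln n.+1%:R :> R.
Proof.
elim: n => [|n IH]; first by rewrite big_ord1 ln1 invr1 addr0.
rewrite big_ord_recr/=; apply: le_trans (lerD IH (lexx _)) _.
rewrite -addrA lerD2l.
have e : n.+1%:R = n.+2%:R * (1 + - n.+2%:R^-1) :> R.
  by rewrite mulrBr mulr1 mulfV// -[n.+2%:R]natr1 addrK.
have i1 : n.+2%:R^-1 < 1 :> R by rewrite invf_lt1// ltr1n.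
rewrite {1}e lnM ?posrE ?ltr0n ?subr_gt0//.
rewrite -addrA gerDl -lerBrDr sub0r; by apply: le_ln1Dx; rewrite ltrN2.
Qed.

Lemma harmonic_lower n : ln n.+1%:R <= \sum_(i < n) i.+1%:R^-1 :> R.
Proof.
elim: n => [|n IH]; first by rewrite big_ord0 ln1.
rewrite big_ord_recr/=; apply: le_trans (lerD IH (lexx _)).
have e : n.+2%:R = n.+1%:R * (1 + n.+1%:R^-1) :> R.
  by rewrite mulrDr mulr1 mulfV// natr1.
have i0 : 0 < n.+1%:R^-1 :> R by rewrite invr_gt0.
rewrite e lnM ?posrE ?ltr0n ?addr_gt0//.
by rewrite lerD2l; apply: le_ln1Dx; apply: lt_trans i0; rewrite oppr_lt0.
Qed.

Lemma ln_natr_cvg : ln n%:R @[n --> \oo] --> (+oo : set_system R).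
Proof.
apply/cvgryPge => A; near=> n.
have n0 : (0 < n)%N by near: n; exact: nbhs_infty_gt.
rewrite -(expRK A) ler_ln ?posrE ?expR_gt0 ?ltr0n//.
near: n; have := archi_boundP (ltW (expR_gt0 A)); set m := Num.bound _ => hm.
exists m => // n /= mn; apply: le_trans (ltW hm) _; by rewrite ler_nat.
Unshelve. all: by end_near. Qed.

Lemma cvg_over_ln (a : R) : a / ln n%:R @[n --> \oo] --> 0.
Proof.
rewrite -(mulr0 a); apply: cvgMl_tmp.
apply/gtr0_cvgV0; last exact: ln_natr_cvg.
near=> n; apply: ln_gt0; rewrite ltr1n; near: n; exact: nbhs_infty_gt.
Unshelve. all: by end_near. Qed.

(** The first hypothesis bounds the sum above by the harmonic one; the second bounds it below by
    [1 / (1 + e)] times the harmonic sum, up to finitely many terms. *)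
Lemma log_mean_cvg1 (p : nat -> nat) :
  (forall n, n < p n)%N ->
  (forall eta : R, 0 < eta -> exists m, forall n, (m <= n)%N ->
     (p n)%:R <= (1 + eta) * n%:R) ->
  (ln n%:R)^-1 * (\sum_(i < n) (p i)%:R^-1) @[n --> \oo] --> (1 : R).
Proof.
move=> pn hp; have p0 i : 0 < (p i)%:R :> R by rewrite ltr0n (leq_ltn_trans _ (pn i)).
have upper n : \sum_(i < n) (p i)%:R^-1 <= 1 + ln n%:R :> R.
  case: n => [|n]; first by rewrite big_ord0 ln0// addr0.
  apply: le_trans (harmonic_upper n); apply: ler_sum => i _.
  by rewrite lef_pV2 ?posrE ?p0 ?ltr0Sn// ler_nat.
apply/cvgrPdist_le => e e0.
have [m hm] := hp _ e0.
pose C : R := (1 + e)^-1 * \sum_(i < m) i.+1%:R^-1.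
have e1 : 0 < 1 + e by lra.
have lower n : (1 + e)^-1 * ln n%:R - C <= \sum_(i < n) (p i)%:R^-1.
  apply: (@le_trans _ _ ((1 + e)^-1 * \sum_(m <= i < n) i.+1%:R^-1)).
    rewrite /C -mulrBr ler_pM2l ?invr_gt0// lerBlDr.
    case: n => [|n].
      rewrite ln0// big_geq// add0r; apply: sumr_ge0 => i _.
      by rewrite invr_ge0.
    apply: (@le_trans _ _ (\sum_(i < n.+1) i.+1%:R^-1)).
      apply: le_trans (harmonic_lower _); rewrite ler_ln ?posrE ?ltr0n//.
      by rewrite ler_nat.
    have [mn|nm] := leqP m n.+1.
      by rewrite -!(big_mkord xpredT (fun i => i.+1%:R^-1)) (big_cat_nat _ mn)//= addrC.
    rewrite big_geq ?(ltnW nm)// add0r -!(big_mkord xpredT (fun i => i.+1%:R^-1)).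
    rewrite [leRHS](big_cat_nat _ (ltnW nm))//= lerDl; apply: sumr_ge0 => i _.
    by rewrite invr_ge0.
  have [mn|nm] := leqP m n; last first.
    rewrite big_geq ?(ltnW nm)// mulr0; apply: sumr_ge0 => i _.
    by rewrite invr_ge0.
  rewrite -[leRHS](big_mkord xpredT (fun i => (p i)%:R^-1)).
  rewrite [leRHS](big_cat_nat _ mn)//= mulr_sumr.
  apply: (@le_trans _ _ (\sum_(m <= i < n) (p i)%:R^-1)); last first.
    by rewrite lerDr; apply: sumr_ge0 => i _; rewrite invr_ge0.
  rewrite big_nat_cond [leRHS]big_nat_cond; apply: ler_sum => i /andP[/andP[mi _] _].
  rewrite -invfM lef_pV2 ?posrE ?mulr_gt0//.
  by apply: le_trans (hm _ mi) _; rewrite ler_pM2l// ler_nat.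
(* The lower limit [1 / (1 + e)] is within [e] of 1, with the margin [e ^+ 2 / (1 + e)] left for
   [C / ln n]. *)
have hC : \forall n \near \oo, C / ln n%:R < e - (1 - (1 + e)^-1) :> R.
  have : 0 < e - (1 - (1 + e)^-1).
    have -> : e - (1 - (1 + e)^-1) = e ^+ 2 * (1 + e)^-1 by field; lra.
    by rewrite mulr_gt0 ?exprn_gt0 ?invr_gt0.
  move=> d0; exact: (near_cvg_lt (@cvg_over_ln C) (@cvg_cst _ _ _ _ _) d0).
have h1 : \forall n \near \oo, 1 / ln n%:R < e :> R.
  exact: (near_cvg_lt (@cvg_over_ln 1) (@cvg_cst _ _ _ _ _) e0).
near=> n.
have l0 : 0 < ln n%:R :> R.
  by apply: ln_gt0; rewrite ltr1n; near: n; exact: nbhs_infty_gt.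
have := upper n; have := lower n; set S := \sum_(i < n) _ => hl hu.
have hl' : (1 + e)^-1 - C / ln n%:R <= (ln n%:R)^-1 * S.
  by rewrite [leRHS]mulrC ler_pdivlMr// mulrBl divfK ?gt_eqF.
have hu' : (ln n%:R)^-1 * S <= 1 / ln n%:R + 1.
  rewrite mulrC ler_pdivrMr// mulrDl divfK ?gt_eqF//; lra.
have : C / ln n%:R < e - (1 - (1 + e)^-1) by near: n.
have : 1 / ln n%:R < e by near: n.
by rewrite ler_distl => *; apply/andP; split; lra.
Unshelve. all: by end_near. Qed.

End LogMean.

Local Open Scope complex_scope.
Local Open Scope ring_scope.

(** * Hermitian forms and orthonormal sets *)

Section ComplexFacts.
Context {R : realType}.
Implicit Types z w : R[i].

Definition sqnormc z : R := complex.Re z ^+ 2 + complex.Im z ^+ 2.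

Lemma cReD z w : complex.Re (z + w) = complex.Re z + complex.Re w.
Proof. by case: z w => ? ? [? ?]. Qed.
Lemma cReN z : complex.Re (- z) = - complex.Re z.
Proof. by case: z. Qed.
Lemma cReB z w : complex.Re (z - w) = complex.Re z - complex.Re w.
Proof. by rewrite cReD cReN. Qed.
Lemma cReM z w : complex.Re (z * w) =
  complex.Re z * complex.Re w - complex.Im z * complex.Im w.
Proof. by case: z w => ? ? [? ?]. Qed.
Lemma cImM z w : complex.Im (z * w) =
  complex.Re z * complex.Im w + complex.Im z * complex.Re w.
Proof. by case: z w => ? ? [? ?]. Qed.
Lemma cRe_conj z : complex.Re (Num.conj z) = complex.Re z.
Proof. by case: z. Qed.
Lemma cIm_conj z : complex.Im (Num.conj z) = - complex.Im z.
Proof. by case: z. Qed.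
Lemma cRe_sum (I : Type) (r : seq I) (f : I -> R[i]) :
  complex.Re (\sum_(i <- r) f i) = \sum_(i <- r) complex.Re (f i).
Proof.
by elim: r => [|i r IH]; rewrite ?big_nil// !big_cons cReD IH.
Qed.

Lemma sqnormc_ge0 z : 0 <= sqnormc z.
Proof. by rewrite addr_ge0 ?sqr_ge0. Qed.
Lemma sqnormc_conj z : sqnormc (Num.conj z) = sqnormc z.
Proof. by rewrite /sqnormc cRe_conj cIm_conj sqrrN. Qed.
Lemma sqnormc_eq0 z : sqnormc z = 0 -> z = 0.
Proof.
case: z => a b; rewrite /sqnormc/= => /eqP.
by rewrite paddr_eq0 ?sqr_ge0// !sqrf_eq0 => /andP[/eqP -> /eqP ->].
Qed.
Lemma sqnormc0 : sqnormc 0 = 0.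
Proof. by rewrite /sqnormc /= !expr0n/= addr0. Qed.
Lemma sqnormcM z w : sqnormc (z * w) = sqnormc z * sqnormc w.
Proof. by rewrite /sqnormc cReM cImM; ring. Qed.
Lemma mul_conj z : z * Num.conj z = (sqnormc z)%:C.
Proof. by case: z => a b; rewrite /sqnormc; simpc; congr (_ +i* _); rewrite /=; ring. Qed.

Lemma sqnormcD_le z w : sqnormc (z + w) <= 2 * sqnormc z + 2 * sqnormc w.
Proof.
case: z w => p q [p' q']; rewrite /sqnormc/=.
by have := sqr_ge0 (p - p'); have := sqr_ge0 (q - q'); nra.
Qed.

End ComplexFacts.

Lemma subrBD (V : zmodType) (x a b : V) : (x - a) - (x - (a + b)) = b.
Proof.
by apply/eqP; rewrite subr_eq opprD addrCA [b + _]addrCA subrr addr0.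
Qed.

Section Hilbert.
Context {R : realType} {H : completeNormedModType R[i]}.
Context {dot : {dot H for Num.conj}}.
Hypothesis hd : hilbert_form dot.
Implicit Types x y z : H.

Local Notation re x y := (complex.Re (dot x y)).

(** The norm of [H] takes values in [R[i]]. Estimates are run with this real number, its square by
    [norm_sq]. *)
Definition sq x : R := re x x.

Lemma dotDl x y z : dot (x + y) z = dot x z + dot y z.
Proof. exact: linearDl. Qed.
Lemma dotDr x y z : dot x (y + z) = dot x y + dot x z.
Proof. exact: linearDr. Qed.
Lemma dotBl x y z : dot (x - y) z = dot x z - dot y z.
Proof. exact: linearBl. Qed.
Lemma dotBr x y z : dot x (y - z) = dot x y - dot x z.
Proof. exact: linearBr. Qed.
Lemma dotZl a x y : dot (a *: x) y = a * dot x y.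
Proof. exact: linearZl_LR. Qed.
Lemma dotZr a x y : dot x (a *: y) = Num.conj a * dot x y.
Proof. exact: linearZr_LR. Qed.
Lemma dot0l x : dot 0 x = 0. Proof. exact: linear0l. Qed.
Lemma dot0r x : dot x 0 = 0. Proof. exact: linear0r. Qed.

Lemma dotC x y : dot x y = Num.conj (dot y x).
Proof. by rewrite hermC/= expr0 mul1r. Qed.

Lemma reC x y : re x y = re y x.
Proof. by rewrite dotC cRe_conj. Qed.

Lemma dotxx x : dot x x = (sq x)%:C.
Proof.
have := dnorm_ge0 dot x; rewrite /sq; case: (dot x x) => a b.
by rewrite lecE/= => /andP[/eqP -> _].
Qed.

Lemma sq_ge0 x : 0 <= sq x.
Proof. by have := dnorm_ge0 dot x; rewrite dotxx lecR. Qed.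

Lemma sq_eq0 x : sq x = 0 -> x = 0.
Proof. by move=> h; apply/eqP; rewrite -(dnorm_eq0 dot) dotxx h. Qed.

Lemma sq0 : sq 0 = 0. Proof. by rewrite /sq linear0l. Qed.

Lemma sqD x y : sq (x + y) = sq x + sq y + 2 * re x y.
Proof.
by rewrite /sq linearDl !linearDr !cReD [re y x]reC; ring.
Qed.

Lemma sqN x : sq (- x) = sq x.
Proof. by rewrite /sq linearNl linearNr opprK. Qed.

Lemma sqB x y : sq (x - y) = sq x + sq y - 2 * re x y.
Proof. by rewrite sqD sqN linearNr cReN mulrN. Qed.

Lemma sqBC x y : sq (x - y) = sq (y - x).
Proof. by rewrite -sqN opprB. Qed.

Lemma sqZ a x : sq (a *: x) = sqnormc a * sq x.
Proof.
rewrite /sq linearZl_LR linearZr_LR/= mulrA mul_conj dotxx cReM/=.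
by rewrite mul0r subr0.
Qed.

Lemma parallelogram x y : sq (x + y) + sq (x - y) = 2 * sq x + 2 * sq y.
Proof. rewrite sqD sqB; ring. Qed.

Lemma sqD_le x y : sq (x + y) <= 2 * sq x + 2 * sq y.
Proof. by rewrite -parallelogram lerDl sq_ge0. Qed.

Lemma sqB_le x y : sq (x - y) <= 2 * sq x + 2 * sq y.
Proof. by rewrite -parallelogram lerDr sq_ge0. Qed.

Lemma dot_CS x y : sqnormc (dot x y) <= sq x * sq y.
Proof.
have [y0|/eqP y0] := pselect (sq y = 0).
  by rewrite (sq_eq0 y0) linear0r sqnormc0 sq0 mulr0.
(* This vector is [sq y] times the component of [x] orthogonal to [y]; the homogeneous form avoids a
   division. *)
have := sq_ge0 ((sq y)%:C *: x - dot x y *: y).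
rewrite sqB !sqZ linearZl_LR linearZr_LR/=.
rewrite [Num.conj _ * _]mulrC mul_conj -rmorphM/=.
have -> : sqnormc (sq y)%:C = sq y ^+ 2 by rewrite /sqnormc/= expr0n addr0.
have yp : 0 < sq y by rewrite lt_def y0 sq_ge0.
move=> h; have : 0 <= sq y * (sq x * sq y - sqnormc (dot x y)) by move: h; nra.
by rewrite pmulr_rge0// subr_ge0.
Qed.

Lemma norm_sq x : `|x| ^+ 2 = (sq x)%:C :> R[i].
Proof. by rewrite hd dotxx. Qed.

Lemma norm_lt x (e : R) : 0 < e -> (`|x| < e%:C :> R[i]) = (sq x < e ^+ 2).
Proof.
move=> e0; have e0' : 0 <= e%:C :> R[i] by rewrite lecR ltW.
by rewrite -[LHS](@ltr_pXn2r _ 2) ?nnegrE ?normr_ge0// norm_sq -rmorphXn/= ltcR.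
Qed.

Lemma norm_le x (e : R) : 0 <= e -> (`|x| <= e%:C :> R[i]) = (sq x <= e ^+ 2).
Proof.
move=> e0; have e0' : 0 <= e%:C :> R[i] by rewrite lecR.
by rewrite -[LHS](@ler_pXn2r _ 2) ?nnegrE ?normr_ge0// norm_sq -rmorphXn/= lecR.
Qed.

Lemma cvg_sq (u : nat -> H) l :
  u @ \oo --> l <-> forall e : R, 0 < e -> \forall n \near \oo, sq (u n - l) < e.
Proof.
split=> [/cvgrPdist_lt ul e e0|h].
  have se : 0 < Num.sqrt e by rewrite sqrtr_gt0.
  have /ul : 0 < (Num.sqrt e)%:C :> R[i] by rewrite ltcR.
  apply: filterS => n; rewrite norm_lt// sqr_sqrtr ?ltW// => ?.
  by rewrite sqBC.
apply/cvgrPdist_lt => e e0.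
have er : e = (complex.Re e)%:C by rewrite RRe_real// gtr0_real.
have e0' : 0 < complex.Re e by move: e0; rewrite er ltcR.
have := h _ (exprn_gt0 2 e0'); apply: filterS => n.
by rewrite er norm_lt// sqBC.
Qed.

Lemma complete_sq (u : nat -> H) :
  (forall e : R, 0 < e -> exists N, forall m n, (N <= m)%N -> (N <= n)%N ->
     sq (u m - u n) < e) ->
  exists l : H, u @ \oo --> l.
Proof.
move=> h; suff /cauchy_cvgP : cauchy (u @ \oo) by move=> ?; exists (lim (u @ \oo)).
apply/cauchy_ballP => e e0.
have er : e = (complex.Re e)%:C by rewrite RRe_real// gtr0_real.
have e0' : 0 < complex.Re e by move: e0; rewrite er ltcR.
have [N hN] := h _ (exprn_gt0 2 e0').
near=> x; near: x; exists (u @` [set n | (N <= n)%N], u @` [set n | (N <= n)%N]).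
  by split; exists N => // n /= Nn; exists n.
move=> [a b] [/= [m Nm <-] [n Nn <-]]; rewrite -ball_normE/= er norm_lt//.
exact: hN.
Unshelve. all: by end_near. Qed.

Definition onset (B : set H) : Prop :=
  (forall e, B e -> dot e e = 1) /\
  (forall e e', B e -> B e' -> e <> e' -> dot e e' = 0).

Definition onproj (s : seq H) x : H := \sum_(e <- s) dot x e *: e.
Definition projsq (s : seq H) x : R := \sum_(e <- s) sqnormc (dot x e).

Lemma dot_sumZl (s : seq H) (a : H -> R[i]) y :
  dot (\sum_(e <- s) a e *: e) y = \sum_(e <- s) a e * dot e y.
Proof.
rewrite linear_sumlz; apply: eq_bigr => e _; exact: linearZl_LR.
Qed.

Section Orthonormal.
Variable B : set H.
Hypothesis onB : onset B.

Lemma dot_sum_notin (s : seq H) (a : H -> R[i]) e :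
  (forall e', e' \in s -> B e') -> B e -> e \notin s ->
  dot (\sum_(e' <- s) a e' *: e') e = 0.
Proof.
move=> sB Be es; rewrite dot_sumZl big_seq big1// => e' e's.
rewrite onB.2 ?mulr0//; first exact: sB.
by move=> ee'; move: es; rewrite -ee' e's.
Qed.

Lemma dot_sum_in (s : seq H) (a : H -> R[i]) e : uniq s ->
  (forall e', e' \in s -> B e') -> e \in s ->
  dot (\sum_(e' <- s) a e' *: e') e = a e.
Proof.
move=> us sB es; rewrite dot_sumZl (bigD1_seq e)//= onB.1; last exact: sB.
rewrite mulr1 big_seq_cond big1 ?addr0// => e' /andP[e's /eqP e'e].
by rewrite onB.2 ?mulr0//; exact: sB.
Qed.

Lemma sq_sumZ (s : seq H) (a : H -> R[i]) : uniq s ->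
  (forall e, e \in s -> B e) ->
  sq (\sum_(e <- s) a e *: e) = \sum_(e <- s) sqnormc (a e).
Proof.
elim: s => [|e s IH]; first by rewrite !big_nil sq0.
move=> /= /andP[es us] sB; have sB' e' : e' \in s -> B e'.
  by move=> e's; apply: sB; rewrite inE e's orbT.
have Be : B e by apply: sB; rewrite inE eqxx.
rewrite !big_cons sqD IH// sqZ /sq (onB.1 _ Be) mulr1.
rewrite linearZl_LR/= dotC dot_sum_notin// rmorph0 mulr0/= mulr0 addr0//.
Qed.

Lemma sq_proj s x : uniq s -> (forall e, e \in s -> B e) ->
  sq (onproj s x) = projsq s x.
Proof. exact: sq_sumZ. Qed.

Lemma sq_residual s x : uniq s -> (forall e, e \in s -> B e) ->
  sq (x - onproj s x) = sq x - projsq s x.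
Proof.
move=> us sB; rewrite sqB sq_proj//.
suff -> : re x (onproj s x) = projsq s x by ring.
rewrite reC /onproj dot_sumZl cRe_sum; apply: eq_bigr => e _.
by rewrite [dot e x]dotC mul_conj.
Qed.

Lemma bessel s x : uniq s -> (forall e, e \in s -> B e) -> projsq s x <= sq x.
Proof. by move=> us sB; rewrite -subr_ge0 -sq_residual// sq_ge0. Qed.

Lemma projsq_ge0 s x : 0 <= projsq s x.
Proof. by apply: sumr_ge0 => e _; exact: sqnormc_ge0. Qed.

(* Residuals of [x] along finite subfamilies form a minimizing, hence Cauchy,
   family; its limit is orthogonal to B. *)
Lemma parseval_approx (W : set H) x (eps : R) :
  (forall (a : R[i]) y z, W y -> W z -> W (a *: y + z)) ->
  (forall (u : nat -> H) l, (forall n, W (u n)) -> u @ \oo --> l -> W l) ->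
  B `<=` W ->
  (forall y, W y -> (forall e, B e -> dot y e = 0) -> y = 0) ->
  W x -> 0 < eps ->
  exists s, [/\ uniq s, forall e, e \in s -> B e & sq x - projsq s x < eps].
Proof.
move=> Wlin Wcl BW Bmax Wx eps0.
have W0 : W 0 by have := Wlin (-1) x x Wx Wx; rewrite scaleN1r addNr.
pose fam := [set s : seq H | uniq s /\ forall e, e \in s -> B e].
pose A := [set projsq s x | s in fam].
have A0 : A !=set0 by exists (projsq [::] x), [::].
have hA : has_ubound A by exists (sq x) => _ [s [us sB] <-]; exact: bessel.
pose m := sup A.
have le_m s : fam s -> projsq s x <= m by move=> fs; apply: ub_le_sup => //; exists s.
have /choice[F hF] : forall n : nat, exists s, fam s /\ m - n.+1%:R^-1 < projsq s x.
  move=> n; have n0 : 0 < n.+1%:R^-1 :> R by rewrite invr_gt0.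
  by have [_ [s fs <-] lt] := sup_adherent n0 (conj A0 hA); exists s.
pose res s := x - onproj s x.
have Wres s : fam s -> W (res s).
  move=> [_ sB]; rewrite /res addrC -scaleN1r; apply: (Wlin) => //.
  elim: s sB => [|e s IH] sB; first by rewrite /onproj big_nil.
  rewrite /onproj big_cons; apply: Wlin; first by apply/BW/sB; rewrite inE eqxx.
  by apply: IH => e' e's; apply: sB; rewrite inE e's orbT.
(* Passing from [s] to a larger family changes the residual by the projection onto the added
   vectors, whose squared norm is the gain in [projsq], at most [m - projsq s x]. *)
have ext s t : fam s -> fam t -> let u := s ++ [seq e <- t | e \notin s] in
    fam u /\ sq (res s - res u) <= m - projsq s x.
  move=> [us sB] [ut tB] u.
  have uu : uniq u.
    rewrite cat_uniq us filter_uniq// andbT; apply/hasPn => e.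
    by rewrite mem_filter => /andP[].
  have uB e : e \in u -> B e.
    by rewrite mem_cat mem_filter => /orP[/sB//|/andP[_ /tB]].
  split=> //; have -> : res s - res u = onproj [seq e <- t | e \notin s] x.
    by rewrite /res /onproj big_cat; exact: subrBD.
  rewrite sq_proj ?filter_uniq//; last first.
    by move=> e; rewrite mem_filter => /andP[_ /tB].
  by have := le_m u (conj uu uB); rewrite /projsq big_cat/= lerBrDl.
(* Both extensions list the same vectors in different orders, so the two residuals are compared
   through a common one. *)
have ext2 s t : fam s -> fam t -> sq (res s - res t) <=
    2 * (m - projsq s x) + 2 * (m - projsq t x).
  move=> fs ft; have [fu h1] := ext s t fs ft; have [fv h2] := ext t s ft fs.
  set u := s ++ _ in fu h1; set v := t ++ _ in fv h2.
  have uv : res u = res v.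
    rewrite /res /onproj; congr (x - _); apply: perm_big.
    apply: uniq_perm; [exact: fu.1|exact: fv.1|move=> e].
    by rewrite !mem_cat !mem_filter; case: (e \in s); case: (e \in t).
  have -> : res s - res t = (res s - res u) - (res t - res v).
    have aux (a b c : H) : a - b = a - c - (b - c) by rewrite opprB subrKA.
    by rewrite uv; exact: aux.
  by apply: le_trans (sqB_le _ _) _; apply: lerD; rewrite ler_pM2l.
have inv_small (e : R) : 0 < e -> exists N, forall n, (N <= n)%N -> n.+1%:R^-1 < e.
  move=> e0; exists (Num.bound e^-1) => n Nn; rewrite invf_plt ?posrE//.
  apply: lt_le_trans (archi_boundP _) _; first by rewrite invr_ge0 ltW.
  by rewrite ler_nat (leq_trans Nn).
have [y rely] : exists y : H, (res \o F) @ \oo --> y.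
  apply: complete_sq => e e0; have [N hN] := inv_small (e / 4) (divr_gt0 e0 (ltr0n _ 4)).
  exists N => p q Np Nq; apply: le_lt_trans (ext2 _ _ (hF p).1 (hF q).1) _.
  have hs k : (N <= k)%N -> m - projsq (F k) x < e / 4.
    by move=> /hN; have := (hF k).2; set u := _^-1; lra.
  have := hs p Np; have := hs q Nq; lra.
have Wy : W y by apply: Wcl rely => n; apply: Wres; exact: (hF n).1.
have y0 : y = 0.
  apply: Bmax => // e Be; apply: sqnormc_eq0; apply/eqP.
  rewrite eq_le sqnormc_ge0 andbT; apply/ler_addgt0Pr => d d0; rewrite add0r.
  have [N hN] := inv_small (d / 4) (divr_gt0 d0 (ltr0n _ 4)).
  have /cvg_sq/(_ (d / 4) (divr_gt0 d0 (ltr0n _ 4))) [M _ hM] := rely.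
  pose n := maxn N M; have := hN n (leq_maxl _ _); have := hM n (leq_maxr _ _).
  rewrite /= => h1 h2; have [[un nB] h3] := hF n.
  (* Either [e] is in the family and the coordinate is 0, or adjoining [e] raises [projsq] by the
     squared coordinate, which cannot carry it above the supremum [m]. *)
  have : sqnormc (dot (res (F n)) e) <= m - projsq (F n) x.
    have [eF|eF] := boolP (e \in F n).
      have -> : dot (res (F n)) e = 0.
        by rewrite /res linearBl/= (dot_sum_in (fun e => dot x e)) ?subrr.
      rewrite sqnormc0 subr_ge0.
      by apply: le_m; exact: (hF n).1.
    have -> : dot (res (F n)) e = dot x e.
      by rewrite /res linearBl/= (dot_sum_notin (fun e => dot x e)) ?subr0.
    rewrite lerBrDl.
    have fe : fam (e :: F n).
      split; first by rewrite /= eF.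
      by move=> e'; rewrite inE => /predU1P[->//|]; exact: nB.
    by have := le_m _ fe; rewrite /projsq big_cons addrC.
  move=> h5; have h4 := dot_CS (y - res (F n)) e.
  rewrite {2}/sq onB.1//= mulr1 sqBC in h4.
  have -> : y = (y - res (F n)) + res (F n) by rewrite subrK.
  have h6 : sqnormc (dot (y - res (F n) + res (F n)) e) <=
      2 * sqnormc (dot (y - res (F n)) e) + 2 * sqnormc (dot (res (F n)) e).
    by rewrite linearDl; exact: sqnormcD_le.
  have h7 : m - projsq (F n) x < d / 4 by move: h2 h3; set v := _^-1; lra.
  have h8 := le_lt_trans h4 h1; have h9 := le_lt_trans h5 h7.
  apply: le_trans h6 _; move: h8 h9; move: (sqnormc _) (sqnormc _) => p q; lra.
have /cvg_sq/(_ eps eps0) [M _ hM] := rely.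
exists (F M); split; [exact: (hF M).1.1|exact: (hF M).1.2|].
rewrite -sq_residual; [|exact: (hF M).1.1|exact: (hF M).1.2].
by have := hM M (leqnn _); rewrite /= y0 subr0.
Qed.

End Orthonormal.

Lemma esum_seq_le (B : set H) (f : H -> R) (M : R) :
  (forall s, uniq s -> (forall e, e \in s -> B e) -> \sum_(e <- s) f e <= M) ->
  (\esum_(e in B) (f e)%:E <= M%:E)%E.
Proof.
move=> h; apply: ge_ereal_sup => _ [A [fA AB] <-].
rewrite fsbig_finite//= sumEFin lee_fin; apply: h.
  exact: finmap.fset_uniq.
by move=> e; rewrite in_fset_set// inE => /AB.
Qed.

Lemma esum_seq_ge (B : set H) (f : H -> R) s : uniq s ->
  (forall e, e \in s -> B e) ->
  ((\sum_(e <- s) f e)%:E <= \esum_(e in B) (f e)%:E)%E.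
Proof.
move=> us sB; apply: ereal_sup_ubound; exists [set` s].
  by split; [exact: finite_seq|move=> e /=; exact: sB].
by rewrite -fsbig_seq// sumEFin.
Qed.

(** Stated for a closed subspace [W], to serve both the whole space with its chosen basis and the
    range of [E ]0, +oo[] with the eigenvectors. *)
Lemma parseval (B W : set H) x : onset B ->
  (forall (a : R[i]) y z, W y -> W z -> W (a *: y + z)) ->
  (forall (u : nat -> H) l, (forall n, W (u n)) -> u @ \oo --> l -> W l) ->
  B `<=` W ->
  (forall y, W y -> (forall e, B e -> dot y e = 0) -> y = 0) ->
  W x -> (\esum_(e in B) (sqnormc (dot x e))%:E = (sq x)%:E)%E.
Proof.
move=> onB Wlin Wcl BW Bmax Wx; apply/eqP; rewrite eq_le; apply/andP; split.
  by apply: esum_seq_le => s us sB; exact: (bessel onB).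
apply/lee_addgt0Pr => eps eps0.
have [s [us sB lt]] := parseval_approx onB Wlin Wcl BW Bmax Wx eps0.
apply: (@le_trans _ _ ((projsq s x)%:E + eps%:E)%E).
  by rewrite -EFinD lee_fin; move: lt; lra.
by apply: leeD2r; exact: esum_seq_ge.
Qed.

End Hilbert.

(** * Spectral measures *)

Section RawMeasure.
Context {R : realType}.

(* [isMeasure] asks for nonnegativity on all sets, whereas a spectral measure
   is only controlled on measurable sets. *)
Record premeasure (m : set R -> \bar R) : Prop := {
  premeasure0 : m set0 = 0%E;
  premeasure_ge0 : forall A, measurable A -> (0 <= m A)%E;
  premeasure_sigma : forall F : nat -> set R, (forall n, measurable (F n)) ->
    trivIset setT F ->
    (fun n => (\sum_(0 <= i < n) m (F i))%E) @ \oo --> m (\bigcup_n F n) }.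

Definition restr_measurable (m : set R -> \bar R) (hm : premeasure m)
  (A : set R) : \bar R := if `[<measurable A>] then m A else 0%E.

Section Instance.
Variables (m : set R -> \bar R) (hm : premeasure m).

Lemma restr_measurableE A : measurable A -> restr_measurable hm A = m A.
Proof. by move=> mA; rewrite /restr_measurable asboolT. Qed.

Let restr0 : restr_measurable hm set0 = 0%E.
Proof. by rewrite restr_measurableE// premeasure0. Qed.

Let restr_ge0 A : (0 <= restr_measurable hm A)%E.
Proof.
by rewrite /restr_measurable; case: asboolP => // mA; exact: premeasure_ge0.
Qed.

Let restr_sigma : semi_sigma_additive (restr_measurable hm).
Proof.
move=> F mF tF mU; rewrite restr_measurableE//.
under eq_fun => n do under eq_bigr => i _ do rewrite restr_measurableE//.
exact: premeasure_sigma.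
Qed.

HB.instance Definition _ := isMeasure.Build _ _ R (restr_measurable hm)
  restr0 restr_ge0 restr_sigma.

End Instance.

Import HBNNSimple.

(** The integral only evaluates the set function on level sets of simple functions, which are
    measurable. Hence [scalar_measure] may be replaced by a genuine measure. *)
Lemma eq_raw_integral (m1 m2 : set R -> \bar R) (D : set R) (f : R -> \bar R) :
  (forall A, measurable A -> m1 A = m2 A) ->
  (\int[m1]_(x in D) f x = \int[m2]_(x in D) f x)%E.
Proof.
move=> m12; rewrite /integral.
have e (h : {nnsfun R >-> R}) : sintegral m1 h = sintegral m2 h.
  apply: eq_fsbigr => r _; congr (_ * _)%E; apply: m12.
  by apply: measurable_sfunP.
by congr (ereal_sup _ - ereal_sup _)%E; apply: eq_imagel => h _; exact: e.
Qed.

End RawMeasure.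

Section Limits.
Context {R : realType} {H : completeNormedModType R[i]}.
Context {dot : {dot H for Num.conj}}.
Hypothesis hd : hilbert_form dot.

Lemma cvg_sqnormc_dot (u : nat -> H) (l y : H) (e : R) :
  u @ \oo --> l -> 0 < e ->
  \forall n \near \oo, sqnormc (dot (u n) y - dot l y) < e.
Proof.
move=> ul e0; have e1 : 0 < e / (sq (dot := dot) y + 1).
  by rewrite divr_gt0// ltr_wpDl// sq_ge0.
have := (cvg_sq hd u l).1 ul _ e1; apply: filterS => n.
rewrite ltr_pdivlMr ?ltr_wpDl ?sq_ge0// => h; apply: le_lt_trans h.
rewrite -linearBl; apply: le_trans (dot_CS _ _) _.
by rewrite ler_wpM2l ?sq_ge0// lerDl.
Qed.

Lemma cvg_Re_dot (u : nat -> H) (l y : H) : u @ \oo --> l ->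
  complex.Re (dot (u n) y) @[n --> \oo] --> complex.Re (dot l y).
Proof.
move=> ul; apply/cvgrPdist_lt => e e0.
have := cvg_sqnormc_dot y ul (exprn_gt0 2 e0); apply: filterS => n h.
rewrite -(@ltr_pXn2r _ 2) ?nnegrE ?normr_ge0 ?(ltW e0)// real_normK ?num_real//.
apply: le_lt_trans h; rewrite /sqnormc cReB -[leLHS]sqrrN opprB.
by rewrite lerDl sqr_ge0.
Qed.

Lemma cvg_Im_dot (u : nat -> H) (l y : H) : u @ \oo --> l ->
  complex.Im (dot (u n) y) @[n --> \oo] --> complex.Im (dot l y).
Proof.
move=> ul; apply/cvgrPdist_lt => e e0.
have := cvg_sqnormc_dot y ul (exprn_gt0 2 e0); apply: filterS => n h.
rewrite -(@ltr_pXn2r _ 2) ?nnegrE ?normr_ge0 ?(ltW e0)// real_normK ?num_real//.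
apply: le_lt_trans h; rewrite /sqnormc -[leLHS]sqrrN opprB.
have -> : complex.Im (dot (u n) y - dot l y) =
   complex.Im (dot (u n) y) - complex.Im (dot l y).
  by case: (dot (u n) y) (dot l y) => ? ? [].
by rewrite lerDr sqr_ge0.
Qed.

Lemma norm_sqrt (x : H) : `|x| = (Num.sqrt (sq (dot := dot) x))%:C :> R[i].
Proof.
apply/eqP; rewrite -(@eqrXn2 _ 2) ?normr_ge0 ?lecR ?sqrtr_ge0//.
by rewrite (norm_sq hd) -rmorphXn/= sqr_sqrtr// sq_ge0.
Qed.

Lemma norm_sum_le (c : nat -> R) (y : nat -> H) (M : R) m n :
  (forall k, 0 <= c k) -> 0 <= M -> (forall k, sq (dot := dot) (y k) <= M) ->
  sq (dot := dot) (\sum_(m <= k < n) (c k)%:C *: y k) <=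
  (\sum_(m <= k < n) c k) ^+ 2 * M.
Proof.
move=> c0 M0 hM.
have -> : (\sum_(m <= k < n) c k) ^+ 2 * M =
   ((\sum_(m <= k < n) c k) * Num.sqrt M) ^+ 2 by rewrite exprMn sqr_sqrtr.
rewrite -norm_le//; last by rewrite mulr_ge0 ?sqrtr_ge0// sumr_ge0.
apply: le_trans (ler_norm_sum _ _ _) _; rewrite mulr_suml rmorph_sum/=.
apply: ler_sum => k _; rewrite normrZ norm_sqrt rmorphM/=.
rewrite ger0_norm ?lecR//; apply: ler_wpM2l; first by rewrite lecR.
by rewrite lecR ler_sqrt.
Qed.

(** Polarization: evaluating at [y + z] makes [dot (S y) z] antisymmetric in [y] and [z]; replacing
    [z] by ['i *: z] makes it symmetric. *)
Lemma quadratic_form_eq0 (S : H -> H) :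
  linear S -> (forall x, dot (S x) x = 0) -> forall x, S x = 0.
Proof.
move=> Slin hS x.
pose f : {linear H -> H} := HB.pack S (GRing.isLinear.Build _ _ _ _ S Slin).
have SD y z : S (y + z) = S y + S z by exact: (linearD f).
have SZ a y : S (a *: y) = a *: S y by exact: (linearZ_LR f).
have h1 y z : dot (S y) z + dot (S z) y = 0.
  have := hS (y + z); rewrite SD dotDl !dotDr !hS add0r addr0.
  by [].
have h2 y z : dot (S z) y = dot (S y) z.
  have := h1 y ('i *: z); rewrite SZ dotZr dotZl.
  have -> : Num.conj ('i : R[i]) = - 'i.
    by apply/eqP; rewrite eq_complex/= oppr0 !eqxx.
  rewrite mulNr => /eqP; rewrite addrC subr_eq0 => /eqP/mulfI; apply.
  by rewrite eq_complex/= oner_eq0 andbF.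
have : dot (S x) (S x) *+ 2 = 0 by rewrite mulr2n -{2}h2 h1.
by move/eqP; rewrite mulrn_eq0/= dnorm_eq0 => /eqP.
Qed.

(** The same polarization, applied to [dot (S x) y - dot x (S y)], which vanishes on the diagonal
    because the quadratic form is real. *)
Lemma symmetric_of_real (S : H -> H) :
  linear S -> (forall x, complex.Im (dot (S x) x) = 0) ->
  forall x y, dot (S x) y = dot x (S y).
Proof.
move=> Slin hS.
pose f : {linear H -> H} := HB.pack S (GRing.isLinear.Build _ _ _ _ S Slin).
have SD y z : S (y + z) = S y + S z by exact: (linearD f).
have SZ a y : S (a *: y) = a *: S y by exact: (linearZ_LR f).
pose b x y := dot (S x) y - dot x (S y).
have b0 x : b x x = 0.
  apply/eqP; rewrite subr_eq0 [dot x (S x)]dotC; have := hS x.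
  by case: (dot (S x) x) => p q /= ->; rewrite eq_complex/= oppr0 !eqxx.
have h1 y z : b y z + b z y = 0.
  have := b0 (y + z); rewrite /b SD !dotDl !dotDr => h.
  have := b0 y; have := b0 z; rewrite /b.
  move=> /eqP; rewrite subr_eq0 => /eqP hz /eqP; rewrite subr_eq0 => /eqP hy.
  by rewrite -h hy hz; ring.
have h2 y z : b y z = b z y.
  have := h1 y ('i *: z); rewrite /b SZ !dotZr !dotZl.
  have -> : Num.conj ('i : R[i]) = - 'i.
    by apply/eqP; rewrite eq_complex/= oppr0 !eqxx.
  have i0 : 'i != 0 :> R[i] by rewrite eq_complex/= oner_eq0 andbF.
  move=> h; apply: (mulfI i0); apply/eqP; rewrite -subr_eq0 -oppr_eq0 -h.
  by apply/eqP; ring.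
move=> x y; apply/eqP; rewrite -subr_eq0 -/(b x y).
by have := h1 x y; rewrite -h2 -mulr2n => /eqP; rewrite mulrn_eq0.
Qed.

End Limits.

Section SpectralMeasure.
Context {R : realType} {H : completeNormedModType R[i]}.
Context {dot : {dot H for Num.conj}}.
Hypothesis hd : hilbert_form dot.
Variable E : set R -> H -> H.
Hypothesis hE : projection_valued_measure dot E.

Local Notation sq := (sq (dot := dot)).

Lemma pvmD A x y : measurable A -> E A (x + y) = E A x + E A y.
Proof. by move=> mA; have := pvm_linear hE mA 1 x y; rewrite !scale1r. Qed.

Lemma pvm_0 A : measurable A -> E A 0 = 0.
Proof.
move=> mA; have := pvmD 0 0 mA; rewrite addr0 => /eqP.
by rewrite -subr_eq0 opprD addrA subrr add0r oppr_eq0 => /eqP.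
Qed.

Lemma pvmZ A a x : measurable A -> E A (a *: x) = a *: E A x.
Proof.
by move=> mA; have := pvm_linear hE mA a x 0; rewrite !addr0 pvm_0// addr0.
Qed.

Lemma pvmN A x : measurable A -> E A (- x) = - E A x.
Proof. by move=> mA; rewrite -scaleN1r pvmZ// scaleN1r. Qed.

Lemma pvmB A x y : measurable A -> E A (x - y) = E A x - E A y.
Proof. by move=> mA; rewrite pvmD// pvmN. Qed.

Lemma pvm_dot A x : measurable A -> dot (E A x) x = (sq (E A x))%:C.
Proof.
by move=> mA; rewrite -dotxx !(pvm_sym hE)// (pvm_idem hE).
Qed.

Lemma pvm_residual A x : measurable A -> sq (x - E A x) = sq x - sq (E A x).
Proof.
move=> mA; rewrite sqB reC pvm_dot//=; ring.
Qed.

Lemma pvm_contract A x : measurable A -> sq (E A x) <= sq x.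
Proof. by move=> mA; rewrite -subr_ge0 -pvm_residual// sq_ge0. Qed.

Lemma pvm_cvg A (u : nat -> H) l : measurable A -> u @ \oo --> l ->
  (fun n => E A (u n)) @ \oo --> E A l.
Proof.
move=> mA /(cvg_sq hd) ul; apply/(cvg_sq hd) => e /ul; apply: filterS => n.
by rewrite -pvmB//; apply: le_lt_trans; exact: pvm_contract.
Qed.

Lemma scalar_measureE x A : measurable A ->
  scalar_measure dot E x A = (sq (E A x))%:E.
Proof. by move=> mA; rewrite /scalar_measure pvm_dot. Qed.

Lemma scalar_premeasure x : premeasure (scalar_measure dot E x).
Proof.
split.
- by rewrite scalar_measureE// (pvm0 hE) sq0.
- by move=> A mA; rewrite scalar_measureE// lee_fin sq_ge0.
- move=> F mF tF.
  have := @pvm_sigma_additive _ _ _ _ hE F x mF tF => /(cvg_Re_dot hd (y := x)) h.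
  under eq_fun do rewrite sumEFin.
  apply: cvg_EFin; first by apply: nearW => n.
  move: h; apply: cvg_trans; apply: near_eq_cvg; apply: nearW => n /=.
  by rewrite linear_sumlz cRe_sum big_mkord.
Qed.

Definition smeasure x := restr_measurable (scalar_premeasure x).

Lemma smeasureE x A : measurable A -> smeasure x A = (sq (E A x))%:E.
Proof. by move=> mA; rewrite /smeasure restr_measurableE// scalar_measureE. Qed.

Lemma smeasure_integral x D f :
  (\int[scalar_measure dot E x]_(l in D) f l =
   \int[smeasure x]_(l in D) f l)%E.
Proof.
by apply: eq_raw_integral => A mA; rewrite /smeasure restr_measurableE.
Qed.

Lemma pvm_sub0 A B x : measurable A -> measurable B -> A `<=` B ->
  E B x = 0 -> E A x = 0.
Proof.
move=> mA mB AB EB; have -> : A = A `&` B by apply/esym/setIidPl.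
by rewrite (pvmI hE)// EB pvm_0.
Qed.

Lemma pvm_bigcup0 (F : nat -> set R) A x : (forall n, measurable (F n)) ->
  measurable A -> A `<=` \bigcup_n F n -> (forall n, E (F n) x = 0) ->
  E A x = 0.
Proof.
move=> mF mA AF F0; apply: (sq_eq0 (dot := dot)).
have : (smeasure x A <= \sum_(0 <= n <oo) smeasure x (F n))%E.
  exact: measure_sigma_subadditive.
rewrite smeasureE// eseries0.
  by rewrite lee_fin => h; apply/eqP; rewrite eq_le h sq_ge0.
by move=> n _ _; rewrite smeasureE// F0 sq0.
Qed.

Lemma pvm_setU A B x : measurable A -> measurable B -> A `&` B = set0 ->
  sq (E (A `|` B) x) = sq (E A x) + sq (E B x).
Proof.
move=> mA mB AB; have : smeasure x (A `|` B) = (smeasure x A + smeasure x B)%E.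
  exact: measureU.
rewrite !smeasureE//; last exact: measurableU.
by rewrite -EFinD => -[].
Qed.

Lemma pvm_setU0 A B x : measurable A -> measurable B ->
  E A x = 0 -> E B x = 0 -> E (A `|` B) x = 0.
Proof.
move=> mA mB A0 B0; have -> : A `|` B = A `|` (B `\` A).
  by rewrite setDE setUIr setUv setIT.
apply: (sq_eq0 (dot := dot)); rewrite pvm_setU//; last by rewrite setDE setICA setICr setI0.
  rewrite A0 (pvm_sub0 _ mB _ B0)//; first by rewrite sq0 addr0.
  exact: measurableD.
exact: measurableD.
Qed.

Lemma pvm_disjoint A B x y : measurable A -> measurable B -> A `&` B = set0 ->
  dot (E A x) (E B y) = 0.
Proof. by move=> mA mB AB; rewrite (pvm_sym hE)// -(pvmI hE)// AB (pvm0 hE) dot0r. Qed.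

End SpectralMeasure.

(** * Bounded functional calculus *)

Section Digits.
Context {R : realType} (g : R -> R).
Hypothesis g01 : forall l, 0 <= g l <= 1.
Hypothesis mg : measurable_fun setT g.

(* Greedy binary expansion of [g l]: [digit_rem k l] is what remains after [k]
   digits, and [digit_set k] is where the next digit is 1. *)
Definition digit_weight (k : nat) : R := 2^-1 ^+ k.+1.

Fixpoint digit_rem (k : nat) (l : R) : R :=
  if k is k'.+1 then digit_rem k' l -
    (if digit_weight k' <= digit_rem k' l then digit_weight k' else 0)
  else g l.

Definition digit_set (k : nat) : set R :=
  [set l | digit_weight k <= digit_rem k l].

Lemma digit_weight_ge0 k : 0 <= digit_weight k.
Proof. by rewrite exprn_ge0// invr_ge0. Qed.

(** The invariant of the greedy expansion: before the k-th digit the remainder is at most twice the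
    weight of that digit. *)
Lemma digit_rem01 k l : 0 <= digit_rem k l <= 2^-1 ^+ k.
Proof.
elim: k => [|k IH]; first by rewrite expr0 g01.
rewrite /=; move: IH; set r := digit_rem k l => /andP[r0 r1].
have -> : 2^-1 ^+ k.+1 = digit_weight k by [].
have e : 2^-1 ^+ k = 2 * digit_weight k.
  by rewrite /digit_weight exprS mulrA mulfV// mul1r.
rewrite e in r1; have := digit_weight_ge0 k; set w := digit_weight k in r1 *.
by move=> w0; case: (leP w r) => h; apply/andP; split; lra.
Qed.

Lemma digit_remS k l :
  digit_rem k.+1 l = digit_rem k l - digit_weight k * \1_(digit_set k) l.
Proof.
rewrite /= indicE /digit_set; case: ifPn => h; first by rewrite mem_set ?mulr1.
by rewrite memNset ?mulr0//=; exact/negP.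
Qed.

Lemma digit_sum n l :
  \sum_(0 <= k < n) digit_weight k * \1_(digit_set k) l = g l - digit_rem n l.
Proof.
elim: n => [|n IH]; first by rewrite big_geq// subrr.
by rewrite big_nat_recr//= IH -/(digit_rem n.+1 l) digit_remS; ring.
Qed.

(** Remainders never exceed [g], so where [g] is 0 they stay below every weight and no digit is
    1. *)
Lemma digit_set_sub (D : set R) k :
  (forall l, ~ D l -> g l = 0) -> digit_set k `<=` D.
Proof.
move=> gD l kl; apply: contrapT => /gD g0; move: kl; rewrite /digit_set/=.
have h n : digit_rem n l <= g l.
  elim: n => [//|n IH]; rewrite digit_remS; apply: le_trans IH.
  by rewrite lerBlDr lerDl mulr_ge0 ?digit_weight_ge0// indicE.
apply/negP; rewrite -ltNge; apply: le_lt_trans (h k) _.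
by rewrite g0 exprn_gt0// invr_gt0.
Qed.

Lemma measurable_digit k :
  measurable_fun setT (digit_rem k) /\ measurable (digit_set k).
Proof.
have mset j : measurable_fun setT (digit_rem j) -> measurable (digit_set j).
  move=> mj; have -> : digit_set j = digit_rem j @^-1` `[digit_weight j, +oo[.
    by apply/seteqP; split=> l; rewrite /digit_set/= in_itv/= andbT.
  by rewrite -[X in measurable X]setTI; apply: mj => //; exact: measurable_itv.
suff h : measurable_fun setT (digit_rem k) by split => //; exact: mset.
elim: k => [//|k IH].
have -> : digit_rem k.+1 =
    digit_rem k \- (fun l => digit_weight k * \1_(digit_set k) l).
  by apply/funext => l; rewrite digit_remS.
apply: measurable_funB => //; apply: measurable_funM => //.
exact: measurable_indic (mset k IH).
Qed.

Lemma cvg_digit_sum l :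
  \sum_(0 <= k < n) digit_weight k * \1_(digit_set k) l @[n --> \oo] --> g l.
Proof.
under eq_fun do rewrite digit_sum.
suff h0 : digit_rem n l @[n --> \oo] --> 0.
  have : g l - digit_rem n l @[n --> \oo] --> g l - 0.
    by apply: cvgB => //; exact: cvg_cst.
  by rewrite subr0.
have h : 1 * 2^-1 ^+ n @[n --> \oo] --> (0 : R).
  by apply: cvg_geometric0; lra.
apply: (squeeze_cvgr _ (@cvg_cst _ _ _ _ _) h).
by apply: nearW => n; rewrite mul1r digit_rem01.
Qed.

Lemma digit_weight_sum m n : \sum_(m <= k < n) digit_weight k <= 2^-1 ^+ m.
Proof.
have [nm|mn] := leqP n m; first by rewrite big_geq// exprn_ge0// invr_ge0.
suff : \sum_(m <= k < n) digit_weight k = 2^-1 ^+ m - 2^-1 ^+ n.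
  by move=> ->; rewrite lerBlDr lerDl exprn_ge0// invr_ge0.
pose F k : R := - 2^-1 ^+ k.
transitivity (\sum_(m <= k < n) (F k.+1 - F k)).
  by apply: eq_bigr => k _; rewrite /digit_weight /F exprS; lra.
by rewrite telescope_sumr ?(ltnW mn)// /F opprK addrC.
Qed.

End Digits.

Section FunctionalCalculus.
Context {R : realType} {H : completeNormedModType R[i]}.
Context {dot : {dot H for Num.conj}}.
Hypothesis hd : hilbert_form dot.
Variable E : set R -> H -> H.
Hypothesis hE : projection_valued_measure dot E.

Local Notation sq := (sq (dot := dot)).

(* [T] is the sum of the [w k * E (A k)], where [f] is the sum of the
   [w k * \1_(A k)] on the positive half-line. *)
Record digit_calculus (f : R -> R) (T : H -> H) (A : nat -> set R) : Prop := {
  dcalc_linear : linear T;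
  dcalc_measurable : forall k, measurable (A k);
  dcalc_pos : forall k, A k `<=` `]0, +oo[;
  dcalc_cvg : forall x, (fun n => \sum_(0 <= k < n)
    (digit_weight k)%:C *: E (A k) x) @ \oo --> T x;
  dcalc_sum : forall l, 0 < l ->
    \sum_(0 <= k < n) digit_weight k * \1_(A k) l @[n --> \oo] --> f l;
  dcalc_form : forall x, dot (T x) x =
    (fine (\int[scalar_measure dot E x]_(l in `]0%R, +oo[) (f l)%:E)%E)%:C;
  dcalc_int : forall x, (complex.Re (dot (T x) x))%:E =
    (\int[scalar_measure dot E x]_(l in `]0%R, +oo[) (f l)%:E)%E }.

(** Projections are contractions, so the partial sums differ by a geometric tail and converge at
    every vector. The quadratic form is the integral of [f] by termwise integration of its
    nonnegative digit series. *)
Lemma digit_calculus_exists (f : R -> R) : measurable_fun setT f ->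
  (forall l, 0 < l -> 0 <= f l <= 1) -> exists T A, digit_calculus f T A.
Proof.
move=> mf f01; pose D : set R := `]0, +oo[%classic.
have Dl l : D l <-> 0 < l by rewrite /D/= in_itv/= andbT.
(* Cutting [f] off outside []0, +oo[] implements the convention on the kernel and makes the bounds
   by 0 and 1 hold everywhere. *)
pose g : R -> R := f \* \1_D.
have gD l : 0 < l -> g l = f l.
  by move=> l0; rewrite /g/= indicE mem_set ?mulr1//; exact/Dl.
have gnD l : ~ D l -> g l = 0.
  by move=> l0; rewrite /g/= indicE memNset ?mulr0.
have g01 l : 0 <= g l <= 1.
  have [/[dup]/Dl l0 _|l0] := pselect (D l); first by rewrite gD// f01.
  by rewrite gnD// lexx ler01.
have mD : measurable D by exact: measurable_itv.
have mg : measurable_fun setT g.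
  by apply: measurable_funM => //; exact: measurable_indic.
pose A := digit_set g.
have mA k : measurable (A k) by exact: (measurable_digit mg k).2.
pose s n x := \sum_(0 <= k < n) (digit_weight k)%:C *: E (A k) x.
have sdiff m n x : (m <= n)%N -> sq (s m x - s n x) <= 2^-1 ^+ m * sq x.
  move=> mn; have e : s n x = s m x + \sum_(m <= k < n) (digit_weight k)%:C *: E (A k) x.
    by rewrite /s (@big_cat_nat _ _ _ m 0 n).
  rewrite sqBC e; set a := s m x; set b := \sum_(_ <= k < _) _.
  have -> : a + b - a = b by rewrite addrAC subrr add0r.
  rewrite /b.
  apply: le_trans (norm_sum_le hd _ _ (@digit_weight_ge0 R) (sq_ge0 x)
    (fun k => pvm_contract hE x (mA k))) _.
  apply: ler_wpM2r; first exact: sq_ge0.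
  have w0 : 0 <= \sum_(m <= k < n) digit_weight k :> R.
    by apply: sumr_ge0 => k _; exact: digit_weight_ge0.
  have w1 := digit_weight_sum (R := R) m n.
  have h1 : 2^-1 ^+ m <= 1 :> R by rewrite exprn_ile1//; lra.
  by rewrite expr2; nra.
have /choice[T hT] : forall x : H, exists y : H, (fun n => s n x) @ \oo --> y.
  move=> x; apply: (complete_sq hd) => e e0.
  have h : sq x * 2^-1 ^+ n @[n --> \oo] --> 0.
    by apply: cvg_geometric0; lra.
  move/cvgrPdist_lt/(_ e e0) : h => [N _ hN].
  have hs n : (N <= n)%N -> 2^-1 ^+ n * sq x < e.
    move=> /hN/=; rewrite sub0r normrN ger0_norm 1?mulrC//.
    by rewrite mulr_ge0 ?sq_ge0// exprn_ge0// invr_ge0.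
  exists N => m n Nm Nn; have [mn|nm] := leqP m n.
    by apply: le_lt_trans (sdiff _ _ _ mn) _; exact: hs.
  by rewrite sqBC; apply: le_lt_trans (sdiff _ _ _ (ltnW nm)) _; exact: hs.
have dots n x : dot (s n x) x =
    (\sum_(0 <= k < n) digit_weight k * sq (E (A k) x))%:C.
  rewrite /s linear_sumlz rmorph_sum/=; apply: eq_bigr => k _.
  by rewrite dotZl (pvm_dot hE)// -rmorphM.
have re_cvg x : (\sum_(0 <= k < n) digit_weight k * sq (E (A k) x))
    @[n --> \oo] --> complex.Re (dot (T x) x).
  have := cvg_Re_dot hd (hT x) (y := x); apply: cvg_trans.
  by apply: near_eq_cvg; apply: nearW => n; rewrite dots.
have int x : (complex.Re (dot (T x) x))%:E =
    (\int[scalar_measure dot E x]_(l in D) (f l)%:E)%E.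
  rewrite (smeasure_integral hd hE) integral_mkcond/=.
  transitivity (\int[smeasure hd hE x]_l
      (\sum_(0 <= k <oo) (digit_weight k * \1_(A k) l)%:E))%E.
    have hm k : measurable_fun setT
        (fun l : R => (digit_weight k * \1_(A k) l : R)%:E).
      by apply/measurable_EFinP; apply: measurable_funM.
    have h0 k l : setT l -> (0 <= (digit_weight k * \1_(A k) l : R)%:E)%E.
      by move=> _; rewrite lee_fin mulr_ge0 ?digit_weight_ge0// indicE.
    rewrite (integral_nneseries _ _ hm h0)//.
    apply/esym/cvg_lim => //.
    rewrite (_ : (fun n => _) = (fun n =>
       (\sum_(0 <= k < n) digit_weight k * sq (E (A k) x))%:E)).
      by apply: cvg_EFin; [exact: nearW|exact: re_cvg].
    apply/funext => n; rewrite -sumEFin; apply: eq_bigr => k _.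
    under eq_integral do rewrite EFinM.
    rewrite ge0_integralZl_EFin//; last 2 first.
    - by apply/measurable_EFinP; exact: measurable_indic.
    - exact: digit_weight_ge0.
    rewrite integral_indic// setIT EFinM; congr (_ * _)%E.
    exact: (smeasureE hd hE).
  apply: eq_integral => l _.
  have -> : (((fun l0 => (f l0)%:E) \_ D) l = (g l)%:E)%E.
    rewrite /patch; have [lD|lD] := pselect (D l).
      by rewrite mem_set// gD//; exact/Dl.
    by rewrite memNset// gnD.
  apply/cvg_lim => //; under eq_fun do rewrite sumEFin.
  apply: cvg_EFin; first exact: nearW.
  exact: cvg_digit_sum.
exists T, A; split => //.
- move=> a x y; have h : (fun n => s n (a *: x + y)) @ \oo --> a *: T x + T y.
    have -> : (fun n => s n (a *: x + y)) = (fun n => a *: s n x + s n y).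
      apply/funext => n; rewrite /s scaler_sumr -big_split/=.
      apply: eq_bigr => k _; rewrite (pvmD hE)// (pvmZ hE)// scalerDr.
      by rewrite !scalerA mulrC.
    by apply: cvgD => //; apply: cvgZl_tmp.
  exact: (cvg_unique (@norm_hausdorff _ _) (hT _) h).
- by move=> k; apply: digit_set_sub => l; exact: gnD.
- by move=> l l0; rewrite -gD//; exact: cvg_digit_sum.
(* The real part is the integral just computed; the imaginary part is a limit of zeros. *)
- move=> x; rewrite -int/=; apply/eqP; rewrite eq_complex/= eqxx/=.
  apply/eqP; have := cvg_Im_dot hd (hT x) (y := x).
  under eq_fun do rewrite dots/=.
  move=> h; rewrite -(cvg_lim (@Rhausdorff R) h).
  by apply: cvg_lim => //; exact: cvg_cst.
Qed.

(** [fun_calculus] chooses some operator with the prescribed quadratic form; by [quadratic_form_eq0]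
    there is only one. *)
Lemma fun_calculusE f T A : digit_calculus f T A -> fun_calculus dot E f = T.
Proof.
move=> h; have ex : exists T, linear T /\ forall x, dot (T x) x =
    (fine (\int[scalar_measure dot E x]_(l in `]0%R, +oo[) (f l)%:E)%E)%:C.
  by exists T; split; [exact: dcalc_linear h|exact: dcalc_form h].
have [Tlin Tform] : linear (fun_calculus dot E f) /\ forall x,
    dot (fun_calculus dot E f x) x =
    (fine (\int[scalar_measure dot E x]_(l in `]0%R, +oo[) (f l)%:E)%E)%:C.
  exact: (@getPex _ [set T : H -> H | linear T /\ forall x,
    dot (T x) x =
    (fine (\int[scalar_measure dot E x]_(l in `]0%R, +oo[) (f l)%:E)%E)%:C] ex).
apply/funext => x; apply/eqP; rewrite -subr_eq0; apply/eqP.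
apply: (@quadratic_form_eq0 _ _ dot (fun x => fun_calculus dot E f x - T x)).
  move=> a y z; rewrite Tlin (dcalc_linear h) scalerBr opprD.
  by rewrite addrACA.
by move=> y; rewrite dotBl Tform (dcalc_form h) subrr.
Qed.

Lemma dcalc_sym f T A x y : digit_calculus f T A -> dot (T x) y = dot x (T y).
Proof.
move=> h; apply: symmetric_of_real; first exact: dcalc_linear h.
by move=> z; rewrite (dcalc_form h).
Qed.

Lemma dcalc_scale f T A x : digit_calculus f T A ->
  forall (c : R), (forall k, E (A k) x = (\1_(A k) c)%:C *: x) -> 0 < c ->
  T x = (f c)%:C *: x.
Proof.
move=> h c hx c0.
suff hs : (fun n => \sum_(0 <= k < n) (digit_weight k)%:C *: E (A k) x) @ \oo
    --> (f c)%:C *: x.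
  exact: (cvg_unique (@norm_hausdorff _ _) (@dcalc_cvg _ _ _ h x) hs).
apply/(cvg_sq hd) => e e0.
have e1 : 0 < e / (sq x + 1) by rewrite divr_gt0// ltr_wpDl// sq_ge0.
have se : 0 < Num.sqrt (e / (sq x + 1)) by rewrite sqrtr_gt0.
have /cvgrPdist_lt/(_ _ se) := dcalc_sum h c0; apply: filterS => n hn.
have -> : \sum_(0 <= k < n) (digit_weight k)%:C *: E (A k) x - (f c)%:C *: x =
   (\sum_(0 <= k < n) digit_weight k * \1_(A k) c - f c)%:C *: x.
  rewrite rmorphB rmorph_sum/= scalerBl scaler_suml; congr (_ - _).
  by apply: eq_bigr => k _; rewrite hx scalerA -rmorphM.
rewrite sqZ /sqnormc/= expr0n/= addr0 -sqrrN opprB.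
rewrite -(@ltr_pXn2r _ 2) ?nnegrE ?sqrtr_ge0// in hn.
rewrite real_normK ?num_real// sqr_sqrtr ?ltW// in hn.
rewrite ltr_pdivlMr ?ltr_wpDl ?sq_ge0// in hn; apply: le_lt_trans hn.
by rewrite ler_wpM2l ?sqr_ge0// lerDl.
Qed.

Lemma dcalc_zero f T A x : digit_calculus f T A ->
  E `]0, +oo[%classic x = 0 -> T x = 0.
Proof.
move=> h hx.
suff hs : (fun n => \sum_(0 <= k < n) (digit_weight k)%:C *: E (A k) x) @ \oo
    --> (0 : H).
  exact: (cvg_unique (@norm_hausdorff _ _) (@dcalc_cvg _ _ _ h x) hs).
have -> : (fun n => \sum_(0 <= k < n) (digit_weight k)%:C *: E (A k) x) =
    (fun=> 0).
  apply/funext => n; rewrite big1// => k _.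
  rewrite (pvm_sub0 hE (dcalc_measurable h k) _ (dcalc_pos h (k := k)) hx) ?scaler0//.
exact: cvg_cst.
Qed.

End FunctionalCalculus.

(** * Traces and eigenvectors *)

Section Trace.
Context {R : realType} {H : completeNormedModType R[i]}.
Context {dot : {dot H for Num.conj}}.
Hypothesis hd : hilbert_form dot.

Local Notation sq := (sq (dot := dot)).

Lemma trace_parseval x :
  (\esum_(b in get (orthonormal_basis dot setT)) (sqnormc (dot b x))%:E =
   (sq x)%:E)%E.
Proof.
have [_ B1 B2 B3] := getPex (orthonormal_basis_exists hd).
under eq_esum do rewrite dotC sqnormc_conj.
by apply: (parseval hd (W := setT)) => // y _ h; exact: B3.
Qed.

Lemma trace_scale_fin (S T : H -> H) (c : R) : (op_trace dot T < +oo)%E ->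
  (forall x, 0 <= complex.Re (dot (T x) x)) ->
  (forall x, complex.Re (dot (S x) x) <= c * complex.Re (dot (T x) x)) ->
  (op_trace dot S < +oo)%E.
Proof.
(* A natural number above [|c|] turns scaling into a sum of finitely many copies of the same
   trace. *)
move=> Tfin T0 ST; pose m := Num.bound `|c|.
have cm : c <= m%:R.
  by apply: le_trans (ler_norm _) _; apply: ltW; exact: archi_boundP.
apply: (@le_lt_trans _ _ (\sum_(i < m) op_trace dot T)%E); last first.
  by apply: lte_sum_pinfty.
rewrite /op_trace -esum_sum; last by move=> b i _ _; rewrite lee_fin.
apply: le_esum => b _; rewrite sumEFin lee_fin sumr_const card_ord -mulr_natl.
by apply: le_trans (ST b) _; rewrite ler_wpM2r.
Qed.

Variable E : set R -> H -> H.
Hypothesis hE : projection_valued_measure dot E.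

(** The sum over the basis of the squared coordinates of each [v i] is 1. Since [E A] fixes [v i],
    these are coordinates of [E A b], and Bessel bounds their sum over [i] by the diagonal term at
    [b]. *)
Lemma trace_ge A (v : nat -> H) n : measurable A ->
  (forall i, (i < n)%N -> E A (v i) = v i) ->
  (forall i j, (i < n)%N -> (j < n)%N -> dot (v i) (v j) = (i == j)%:R) ->
  (n%:R%:E <= op_trace dot (E A))%E.
Proof.
move=> mA vA von.
have -> : n%:R%:E = (\sum_(i < n)
    \esum_(b in get (orthonormal_basis dot setT)) (sqnormc (dot b (v i)))%:E)%E.
  rewrite (eq_bigr (fun=> 1%E)) => [|i _].
    by rewrite sumEFin sumr_const card_ord.
  by rewrite trace_parseval /sq von// eqxx.
rewrite -esum_sum; last by move=> b i _ _; rewrite lee_fin sqnormc_ge0.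
apply: le_esum => b _; rewrite sumEFin lee_fin (pvm_dot hE)//=.
pose B := [set v i | i in [set i | (i < n)%N]].
have vinj i j : (i < n)%N -> (j < n)%N -> v i = v j -> i = j.
  move=> hi hj vij; apply/eqP; have := von i j hi hj; rewrite -vij von// eqxx.
  by case: (i == j) => // /eqP; rewrite oner_eq0.
have onB : onset (dot := dot) B.
  split=> [_ [i hi <-]|_ _ [i hi <-] [j hj <-] vij]; first by rewrite von// eqxx.
  by rewrite von//; case: eqP => // ij; move: vij; rewrite ij.
pose s := [seq v i | i <- iota 0 n].
have us : uniq s.
  rewrite map_inj_in_uniq ?iota_uniq// => i j.
  by rewrite !mem_iota add0n => hi hj; exact: vinj.
have := bessel onB (E A b) us; rewrite /projsq big_map -{1}(subn0 n) => h.
rewrite -(big_mkord xpredT (fun i => sqnormc (dot b (v i)))) /=.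
apply: le_trans (h _); last first.
  by rewrite /s => e /mapP[j]; rewrite mem_iota => /andP[_ hi] ->; exists j.
rewrite big_nat [leRHS]big_nat; apply: ler_sum => i /andP[_ hi].
by rewrite (pvm_sym hE)// vA.
Qed.

End Trace.

Section Eigen.
Context {R : realType} {H : completeNormedModType R[i]}.
Context {dot : {dot H for Num.conj}}.
Hypothesis hd : hilbert_form dot.
Variable E : set R -> H -> H.
Hypothesis hE : projection_valued_measure dot E.
Hypothesis hfin : forall x, 0 < x ->
  (op_trace dot (E `]0%R, x]%classic) < +oo)%E.

Local Notation sq := (sq (dot := dot)).

Lemma unit_vector x : x <> 0 -> exists c : R[i], dot (c *: x) (c *: x) = 1.
Proof.
move=> x0; have sx : 0 < sq x.
  by rewrite lt_def sq_ge0 andbT; apply/eqP => /sq_eq0.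
exists (Num.sqrt (sq x))^-1%:C; rewrite dotxx sqZ /sqnormc/= expr0n/= addr0.
by rewrite exprVn sqr_sqrtr ?ltW// mulVf// gt_eqF.
Qed.

(** If no [t] splits [A], then for each [t] one side is null. At the supremum [a] of those [t] whose
    left side is null, the parts of [A] below and above [a] are null, and so is [{a}]: no mass would
    be left. *)
Lemma split_nonatomic (A : set R) (x : R) (z : H) :
  measurable A -> A `<=` `]0, x] -> E A z <> 0 ->
  (forall a, 0 < a -> E [set a] z = 0) ->
  exists t, E (A `&` `]-oo, t]) z <> 0 /\ E (A `&` `]t, +oo[) z <> 0.
Proof.
move=> mA Ax Az noatom; apply: contrapT => no.
have mI (i : interval R) : measurable (A `&` [set` i]).
  by apply: measurableI => //; exact: measurable_itv.
have dich t : E (A `&` `]-oo, t]) z = 0 \/ E (A `&` `]t, +oo[) z = 0.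
  have [|h1] := pselect (E (A `&` `]-oo, t]) z = 0); first by left.
  have [|h2] := pselect (E (A `&` `]t, +oo[) z = 0); first by right.
  by exfalso; apply: no; exists t.
pose S := [set t : R | E (A `&` `]-oo, t]) z = 0].
have S0 : S 0.
  rewrite /S/= (_ : _ `&` _ = set0) ?(pvm0 hE)//.
  apply/seteqP; split=> // l [/Ax/=]; rewrite !in_itv/= => /andP[l0 _] l1.
  by have := lt_le_trans l0 l1; rewrite ltxx.
have Sx : ubound S x.
  move=> t St; rewrite leNgt; apply/negP => xt; apply: Az.
  rewrite (_ : A = A `&` `]-oo, t])//; apply/esym/setIidPl => l /Ax/=.
  by rewrite !in_itv/= => /andP[_ /le_trans]; apply; exact: ltW.
have hS : has_sup S by split; [exists 0|exists x].
pose a := sup S.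
have inv0 n : 0 < n.+1%:R^-1 :> R by rewrite invr_gt0.
have inv_lt (e : R) : 0 < e -> exists n, n.+1%:R^-1 < e.
  move=> e0; exists (Num.bound e^-1); rewrite invf_plt ?posrE//.
  apply: lt_le_trans (archi_boundP _) _; first by rewrite invr_ge0 ltW.
  by rewrite ler_nat.
have low : E (A `&` `]-oo, a[) z = 0.
  apply: (pvm_bigcup0 hd hE (F := fun n => A `&` `]-oo, a - n.+1%:R^-1])) => //.
    move=> l [Al]; rewrite /= in_itv/= => la.
    have [n hn] := inv_lt (a - l) ltac:(by rewrite subr_gt0).
    exists n => //; split=> //=; rewrite in_itv/=; move: hn; set u := _^-1; lra.
  move=> n; have [t St ht] := sup_adherent (inv0 n) hS.
  apply: (pvm_sub0 hE _ _ _ St) => // l [Al]; split=> //.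
  by move: b; rewrite /= !in_itv/= => /le_trans; apply; exact: ltW.
have high : E (A `&` `]a, +oo[) z = 0.
  apply: (pvm_bigcup0 hd hE (F := fun n => A `&` `]a + n.+1%:R^-1, +oo[)) => //.
    move=> l [Al]; rewrite /= in_itv/= andbT => la.
    have [n hn] := inv_lt (l - a) ltac:(by rewrite subr_gt0).
    exists n => //; split=> //=; rewrite in_itv/= andbT; move: hn; set u := _^-1; lra.
  move=> n; have [h|//] := dich (a + n.+1%:R^-1).
  have : a + n.+1%:R^-1 <= a by apply: ub_le_sup => //; exists x.
  by rewrite gerDl leNgt inv0.
have mid : E (A `&` [set a]) z = 0.
  have m1 : measurable (A `&` [set a]) by apply: measurableI.
  have [a0|a0] := ltP 0 a.
    by apply: (pvm_sub0 hE m1 _ _ (noatom a a0)) => // l [].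
  rewrite (_ : _ `&` _ = set0) ?(pvm0 hE)//; apply/seteqP; split=> // l [/Ax/=].
  rewrite in_itv/= => /andP[l0 _] la; move: a0; rewrite -la => /(lt_le_trans l0).
  by rewrite ltxx.
apply: Az; have := pvm_setU0 hd hE (mI _) (measurableU _ _ _ _) low
  (pvm_setU0 hd hE _ (mI _) mid high).
have m1 : measurable (A `&` [set a]) by apply: measurableI.
move=> /(_ m1 (mI _) m1); rewrite -!setIUr (_ : A `&` _ = A)//.
apply/setIidPl => l _ /=; rewrite !in_itv/= andbT.
by case: (ltgtP l a) => h; [left|right; right|right; left].
Qed.

Lemma split_family (x : R) (z : H) n : (forall a, 0 < a -> E [set a] z = 0) ->
  forall A : set R, measurable A -> A `<=` `]0, x] -> E A z <> 0 ->
  exists F : nat -> set R,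
    (forall i, (i < n)%N -> [/\ measurable (F i), F i `<=` A & E (F i) z <> 0]) /\
    (forall i j, (i < j < n)%N -> F i `&` F j = set0).
Proof.
move=> noatom; elim: n => [|n IH] A mA Ax Az.
  by exists (fun=> set0); split=> // i j; rewrite ltn0 andbF.
have [t [h1 h2]] := split_nonatomic mA Ax Az noatom.
have mI (i : interval R) : measurable (A `&` [set` i]).
  by apply: measurableI => //; exact: measurable_itv.
have [|F [hF dF]] := IH _ (mI `]-oo, t]) _ h1.
  by move=> l [/Ax].
exists (fun i => if (i < n)%N then F i else A `&` `]t, +oo[); split.
- move=> i; rewrite ltnS leq_eqVlt => /predU1P[->|hi].
    by rewrite ltnn; split => // l [].
  by rewrite hi; have [? h ?] := hF i hi; split => // l /h[].
- move=> i j /andP[ij]; rewrite ltnS leq_eqVlt => /predU1P[jn|hj].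
    rewrite jn in ij *; rewrite ij ltnn; have [_ h _] := hF i ij.
    apply/seteqP; split=> // l [/h[_ /=] + [_ /=]].
    by rewrite !in_itv/= andbT => /le_lt_trans/[apply]; rewrite ltxx.
  by rewrite (ltn_trans ij hj) hj dF// ij hj.
Qed.

(* Without atoms, z would split into arbitrarily many orthogonal nonzero pieces
   in the range of E ]0, x], contradicting the finite trace. *)
Lemma exists_atom (x : R) (z : H) : 0 < x -> E `]0, x]%classic z <> 0 ->
  exists2 a, 0 < a & E [set a] z <> 0.
Proof.
move=> x0 Ez; apply: contrapT => no.
have noatom a : 0 < a -> E [set a] z = 0.
  by move=> a0; apply: contrapT => h; apply: no; exists a.
have mx : measurable `]0, x]%classic by exact: measurable_itv.
have := hfin x0; case Etr : (op_trace _ _) => [tr||]//; last first.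
  have : (0 <= op_trace dot (E `]0%R, x]%classic))%E.
    by apply: esum_ge0 => b _; rewrite lee_fin (pvm_dot hE)//= sq_ge0.
  by rewrite Etr.
move=> _; pose n := (Num.bound `|tr|).
have [F [hF dF]] := split_family n noatom mx (fun l => id) Ez.
have /choice[c hc] : forall i : nat, exists c : R[i], (i < n)%N ->
    dot (c *: E (F i) z) (c *: E (F i) z) = 1.
  move=> i; have [hi|hi] := boolP (i < n)%N; last first.
    by exists 0.
  by have [_ _ /unit_vector[c hc]] := hF i hi; exists c.
have : (n%:R%:E <= op_trace dot (E `]0%R, x]%classic))%E.
  apply: (trace_ge hd hE (v := fun i => c i *: E (F i) z)) => //.
    move=> i hi; have [mi si _] := hF i hi; rewrite (pvmZ hE)// -(pvmI hE)//.
    by congr (_ *: E _ _); exact/setIidPr.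
  have dis i j : (i < j < n)%N -> dot (E (F i) z) (E (F j) z) = 0.
    move=> /[dup] /andP[ij hj] /dF; apply: (pvm_disjoint hE).
      by have [] := hF i (ltn_trans ij hj).
    by have [] := hF j hj.
  move=> i j hi hj; case: (ltngtP i j) => [ij|ji|<-]; last exact: hc.
    by rewrite dotZl dotZr dis ?ij// !mulr0.
  by rewrite dotZl dotZr dotC dis ?ji// rmorph0 !mulr0.
rewrite Etr lee_fin leNgt => /negP; apply.
by apply: le_lt_trans (ler_norm _) _; exact: archi_boundP.
Qed.

(** A maximal orthonormal family of eigenvectors exists by Zorn; a nonzero vector of the range
    orthogonal to it would have an atom, and thereby provide a further eigenvector. *)
Lemma eigen_family : exists (B : set H) (lam : H -> R),
  [/\ onset (dot := dot) B,
      forall e, B e -> 0 < lam e /\ E [set lam e] e = e &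
      forall z, E `]0, +oo[%classic z = z -> (forall e, B e -> dot z e = 0) ->
        z = 0].
Proof.
pose P (B : set H) := onset (dot := dot) B /\
  forall e, B e -> exists l, 0 < l /\ E [set l] e = e.
have [|B [[onB Bl] Bmax]] := @Zorn_bigcup _ P.
  move=> F FP Ftot; split; first split.
  - by move=> e [X FX Xe]; have [[+ _] _] := FP _ FX; apply.
  - move=> e e' [X FX Xe] [Y FY Ye'] ee'; have [XY|YX] := Ftot _ _ FX FY.
      by have [[_ +] _] := FP _ FY; apply => //; exact: XY.
    by have [[_ +] _] := FP _ FX; apply => //; exact: YX.
  - by move=> e [X FX Xe]; have [_ +] := FP _ FX; apply.
have /choice[lam hlam] : forall e, exists l, B e -> 0 < l /\ E [set l] e = e.
  move=> e; have [Be|nBe] := pselect (B e); last by exists 0.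
  by have [l hl] := Bl e Be; exists l.
exists B, lam; split => // z Ez zB; apply: contrapT => z0.
have [n En] : exists n, E `]0, n.+1%:R]%classic z <> 0.
  apply: contrapT => no; apply: z0; rewrite -Ez.
  apply: (pvm_bigcup0 hd hE (F := fun n => `]0, n.+1%:R]%classic)).
  - by move=> n; exact: measurable_itv.
  - exact: measurable_itv.
  - move=> l /=; rewrite in_itv/= andbT => l0; exists (Num.bound l) => //=.
    rewrite in_itv/= l0/= ltW// (lt_le_trans (archi_boundP (ltW l0)))//.
    by rewrite ler_nat.
  - by move=> n; apply: contrapT => h; apply: no; exists n.
(* The new member is [E [set a] z], normalized. It is orthogonal to [B] because [E [set a]] maps
   each eigenvector of the family to itself or to 0. *)
have [a a0 Ea] := exists_atom (ltr0Sn _ n) En.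
have [c hc] := unit_vector Ea; pose u := c *: E [set a] z.
have ma : measurable [set a] by [].
have Eu : E [set a] u = u by rewrite /u (pvmZ hE)// (pvm_idem hE).
have zaB e : B e -> dot (E [set a] z) e = 0.
  move=> Be; have [l0 El] := hlam e Be; rewrite (pvm_sym hE)//.
  have [->|al] := eqVneq a (lam e); first by rewrite El zB.
  rewrite -El -(pvmI hE)// (_ : _ `&` _ = set0) ?(pvm0 hE) ?dot0r//.
  by apply/seteqP; split=> // l [/= -> ale]; move: al; rewrite ale eqxx.
have uB e : B e -> dot u e = 0 by move=> Be; rewrite /u dotZl zaB// mulr0.
have nBu : ~ B u by move=> /uB; rewrite hc => /eqP; rewrite oner_eq0.
apply: (Bmax (B `|` [set u])); first by split=> [e Be|/(_ u (or_intror erefl))//]; left.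
split; last first.
  by move=> e [/Bl//|->]; exists a.
split=> [e [/onB.1//|->//]|e e' [Be|->] [Be'|->] ee'].
- exact: onB.2.
- by rewrite dotC uB// rmorph0.
- exact: uB.
- by case: ee'.
Qed.

Lemma eigen_apply (lam : R) (e : H) (A : set R) : measurable A ->
  E [set lam] e = e -> E A e = (\1_A lam)%:C *: e.
Proof.
move=> mA Ee; rewrite -{1}Ee -(pvmI hE)// indicE.
have [lA|lA] := pselect (A lam).
  rewrite mem_set// scale1r (_ : _ `&` _ = [set lam])//.
  by apply/seteqP; split=> [l []|l /= ->].
rewrite memNset// scale0r (_ : _ `&` _ = set0) ?(pvm0 hE)//.
by apply/seteqP; split=> // l [Al ll]; apply: lA; rewrite -ll.
Qed.

End Eigen.

(** * Listing a set with finite sublevels in increasing order *)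

Section Enumeration.
Context {R : realType} {T : choiceType}.
Variables (B : set T) (lam : T -> R).
Hypothesis infB : forall s : seq T, exists2 e, B e & e \notin s.
Hypothesis finB : forall x, exists K, forall s : seq T, uniq s ->
  (forall e, e \in s -> B e /\ lam e <= x) -> (size s <= K)%N.

Lemma sublevel_list x : exists s : seq T,
  uniq s /\ forall e, e \in s <-> B e /\ lam e <= x.
Proof.
have [K hK] := finB x.
pose P n := `[< exists s : seq T, [/\ uniq s, size s = n &
  forall e, e \in s -> B e /\ lam e <= x] >].
have exP : exists n, P n by exists 0; apply/asboolP; exists [::].
have PK n : P n -> (n <= K)%N.
  by move=> /asboolP[s [us <- hs]]; exact: hK.
case: (ex_maxnP exP PK) => n /asboolP[s [us sn hs]] nmax.
exists s; split=> // e; split=> [|[Be ex]]; first exact: hs.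
apply: contrapT => /negP es.
have : (n.+1 <= n)%N; last by rewrite ltnn.
apply: nmax; apply/asboolP; exists (e :: s); split; rewrite /= ?es ?sn//.
by move=> e'; rewrite inE => /predU1P[->//|/hs].
Qed.

Lemma seq_argmin (M : seq T) e0 : e0 \in M ->
  exists2 e, e \in M & forall b, b \in M -> lam e <= lam b.
Proof.
elim: M e0 => // a [|a' M] IH e0 _.
  by exists a; rewrite ?mem_head// => b; rewrite inE => /eqP ->.
have [e eM emin] := IH a' (mem_head _ _).
have [ae|ea] := leP (lam a) (lam e).
  exists a; rewrite ?mem_head// => b; rewrite inE => /predU1P[->//|/emin].
  exact: le_trans.
exists e; first by rewrite inE eM orbT.
by move=> b; rewrite inE => /predU1P[->|/emin//]; exact: ltW.
Qed.

Lemma next_least (s : seq T) : exists e, [/\ B e, e \notin s &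
  forall b, B b -> b \notin s -> lam e <= lam b].
Proof.
have [e0 Be0 e0s] := infB s.
have [L [uL hL]] := sublevel_list (lam e0).
pose M := [seq e <- L | e \notin s].
have e0M : e0 \in M by rewrite mem_filter e0s; apply/hL.
have [e eM emin] := seq_argmin e0M.
move: (eM); rewrite mem_filter => /andP[es /hL[Be _]].
exists e; split=> // b Bb bs; have [bl|lb] := leP (lam b) (lam e0).
  by apply: emin; rewrite mem_filter bs; apply/hL.
exact: le_trans (emin _ e0M) (ltW lb).
Qed.

(** Each term has the least value outside the terms already chosen, which form the list [pre n]. The
    counting function is the length of the sublevel list. *)
Lemma sorted_enumeration : exists e : nat -> T,
  [/\ injective e, forall b, B b <-> exists n, e n = b,
      forall m n, (m <= n)%N -> lam (e m) <= lam (e n) &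
      exists N : R -> nat, forall n x, (n < N x)%N = (lam (e n) <= x)].
Proof.
have /choice[nx hnx] := next_least.
pose fix pre n := if n is n'.+1 then rcons (pre n') (nx (pre n')) else [::].
pose e n := nx (pre n).
have Be n : B (e n) by have [] := hnx (pre n).
have enot n : e n \notin pre n by have [] := hnx (pre n).
have emin n b : B b -> b \notin pre n -> lam (e n) <= lam b.
  by have [_ _] := hnx (pre n); apply.
have preE n : pre n = [seq e i | i <- iota 0 n].
  elim: n => [//|n IH]; rewrite -addn1 iotaD map_cat add0n -IH addn1 /=.
  by rewrite cats1.
have mempre m n : (m < n)%N -> e m \in pre n.
  by move=> mn; rewrite preE; apply/mapP; exists m; rewrite // mem_iota.
have einj : injective e.
  move=> m n emn; apply/eqP; rewrite eqn_leq leqNgt [X in _ && X]leqNgt.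
  apply/andP; split; apply/negP => /mempre; last by rewrite emn (negbTE (enot n)).
  by rewrite -emn (negbTE (enot m)).
have upre n : uniq (pre n) by rewrite preE map_inj_uniq ?iota_uniq.
have spre n : size (pre n) = n by rewrite preE size_map size_iota.
have emono m n : (m <= n)%N -> lam (e m) <= lam (e n).
  move=> mn; apply: emin => //; apply/negP; rewrite preE => /mapP[j].
  by rewrite mem_iota add0n => /andP[_ im] /einj ni; move: im; rewrite -ni ltnNge mn.
have memB b : B b -> exists n, e n = b.
  (* An element never chosen would have a value at least that of every chosen one, giving [K.+1]
     elements in a sublevel that holds at most [K]. *)
  move=> Bb; have [K hK] := finB (lam b); apply: contrapT => no.
  have bpre n : b \notin pre n.
    by rewrite preE; apply/negP => /mapP[j _ be]; apply: no; exists j.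
  have := hK (pre K.+1) (upre _); rewrite spre ltnn => h.
  suff : false by []. apply: h => a; rewrite preE => /mapP[j _ ->].
  by split => //; exact: emin.
exists e; split => //; first by move=> b; split=> [/memB//|[n <-]].
have /choice[L hL] := sublevel_list.
exists (fun x => size (L x)) => n x; have [uL mL] := hL x.
apply/idP/idP => [nL|ex]; last first.
  rewrite -(spre n.+1); apply: uniq_leq_size => // a; rewrite preE => /mapP[j].
  rewrite mem_iota add0n ltnS => /andP[_ iN] ->; apply/mL; split => //.
  exact: le_trans (emono _ _ iN) ex.
rewrite leNgt; apply/negP => xe; move: nL; apply/negP; rewrite -leqNgt.
rewrite -(spre n); apply: uniq_leq_size => // a /mL[Ba ax].
apply: contrapT => /negP an; have := emin _ _ Ba an.
by rewrite leNgt (le_lt_trans ax xe).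
Qed.

End Enumeration.

Section EigenBasis.
Context {R : realType} {H : completeNormedModType R[i]}.
Context {dot : {dot H for Num.conj}}.
Hypothesis hd : hilbert_form dot.
Variable E : set R -> H -> H.
Hypothesis hE : projection_valued_measure dot E.

Local Notation sq := (sq (dot := dot)).

(* [N] counts the eigenvalues in ]0, x], listed as [lam] with multiplicities. *)
Record eigenbasis (e : nat -> H) (lam : nat -> R) (N : R -> nat) : Prop := {
  eb_on : forall i j, dot (e i) (e j) = (i == j)%:R;
  eb_gt0 : forall n, 0 < lam n;
  eb_count : forall n x, (n < N x)%N = (lam n <= x);
  eb_eigen : forall n, E [set lam n] (e n) = e n;
  eb_complete : forall z, E `]0, +oo[%classic z = z ->
    (forall n, dot z (e n) = 0) -> z = 0 }.

(** A finite list of eigenvectors has eigenvalues at most some [X], and the range of [E ]X, +oo[] is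
    orthogonal to it; so the family is infinite. Its sublevels are finite because [trace_ge] bounds
    their size by a trace. *)
Lemma eigenbasis_exists :
  (forall x, 0 < x -> (op_trace dot (E `]0%R, x]%classic) < +oo)%E) ->
  (forall X : R, 0 < X -> exists y, E `]X, +oo[%classic y <> 0) ->
  exists e lam N, eigenbasis e lam N.
Proof.
move=> hfin hinf; have [B [lam [onB Blam Bmax]]] := eigen_family hd hE hfin.
have mI (i : interval R) : measurable [set` i] by exact: measurable_itv.
have infB (s : seq H) : exists2 e, B e & e \notin s.
  apply: contrapT => no.
  have [X X0 hX] : exists2 X, 0 < X & forall e, e \in s -> lam e <= X.
    elim: (s) => [|a t [X X0 hX]]; first by exists 1.
    exists (Num.max X (lam a)); first by rewrite lt_max X0.
    by move=> e; rewrite inE le_max => /predU1P[->|/hX ->//]; rewrite lexx orbT.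
  have [y hy] := hinf X X0; apply: hy; apply: Bmax.
    rewrite -(pvmI hE)//; congr (E _ y); apply/setIidPr => l /=.
    by rewrite !in_itv/= !andbT; exact: lt_trans.
  move=> e Be; rewrite (pvm_sym hE)//.
  have [_ Ee] := Blam e Be; rewrite (eigen_apply hE (mI _) Ee) indicE.
  rewrite memNset ?scale0r ?dot0r//= in_itv/= andbT => Xe.
  have : lam e <= X by apply: hX; apply: contrapT => /negP es; apply: no; exists e.
  by rewrite leNgt Xe.
have finB x : exists K, forall s : seq H, uniq s ->
    (forall e, e \in s -> B e /\ lam e <= x) -> (size s <= K)%N.
  pose x' := Num.max x 1; have x'0 : 0 < x' by rewrite lt_max ltr01 orbT.
  have : (0 <= op_trace dot (E `]0%R, x']%classic))%E.
    by apply: esum_ge0 => b _; rewrite lee_fin (pvm_dot hE)//= sq_ge0.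
  have := hfin _ x'0; case Etr : (op_trace _ _) => [tr||]// _ _.
  exists (Num.bound `|tr|) => s us sB.
  have : ((size s)%:R%:E <= op_trace dot (E `]0%R, x']%classic))%E.
    apply: (trace_ge hd hE (v := nth 0 s)) => //.
      move=> i hi; have [Be ex] := sB _ (mem_nth 0 hi); have [l0 Ee] := Blam _ Be.
      rewrite (eigen_apply hE (mI _) Ee) indicE mem_set ?scale1r//= in_itv/= l0.
      by rewrite le_max ex.
    move=> i j hi hj; have [Bi _] := sB _ (mem_nth 0 hi).
    have [Bj _] := sB _ (mem_nth 0 hj); case: eqP => [->|ij]; first exact: onB.1.
    by rewrite onB.2// => /eqP; rewrite nth_uniq// => /eqP.
  rewrite Etr lee_fin -(ler_nat R) => /le_trans; apply.
  by apply: le_trans (ler_norm _) _; apply: ltW; exact: archi_boundP.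
have [e [einj erange emono [N hN]]] := sorted_enumeration infB finB.
have Be n : B (e n) by apply/erange; exists n.
exists e, (lam \o e), N; split => //.
- move=> i j; case: eqP => [->|ij]; first exact: onB.1.
  by apply: onB.2 => // /einj.
- by move=> n; have [] := Blam _ (Be n).
- by move=> n; have [] := Blam _ (Be n).
- by move=> z Ez hz; apply: Bmax => // b /erange[n <-].
Qed.

Section WithBasis.
Variables (e : nat -> H) (lam : nat -> R) (N : R -> nat).
Hypothesis heb : eigenbasis e lam N.

Lemma eb_inj : injective e.
Proof.
move=> i j eij; have := eb_on heb i j; rewrite -eij (eb_on heb) eqxx.
by case: eqP => // _ /eqP; rewrite oner_eq0.
Qed.

Lemma eb_mono m n : (m <= n)%N -> lam m <= lam n.
Proof.
move=> mn; rewrite -(eb_count heb); apply: leq_ltn_trans mn _.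
by rewrite (eb_count heb).
Qed.

Lemma eb_apply A n : measurable A -> E A (e n) = (\1_A (lam n))%:C *: e n.
Proof. by move=> mA; apply: (eigen_apply hE) => //; exact: eb_eigen heb n. Qed.

Lemma pvm_parseval (A : set R) x : measurable A -> A `<=` `]0, +oo[ ->
  (\sum_(0 <= n <oo) (\1_A (lam n) * sqnormc (dot x (e n)))%:E =
   (sq (E A x))%:E)%E.
Proof.
move=> mA A0; have m0 : measurable (`]0, +oo[%classic : set R).
  exact: measurable_itv.
have EA : E `]0, +oo[%classic (E A x) = E A x.
  by rewrite -(pvmI hE)//; congr (E _ x); exact/setIidPr.
have onB : onset (dot := dot) (range e).
  split=> [_ [n _ <-]|_ _ [m _ <-] [n _ <-] mn]; first by rewrite (eb_on heb) eqxx.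
  by rewrite (eb_on heb); case: eqP => // h; move: mn; rewrite h.
rewrite -(parseval hd (B := range e) (W := [set z | E `]0, +oo[%classic z = z])
  onB)//; last first.
- move=> z /= Ez hz; apply: (eb_complete heb) => // n; apply: hz.
  by exists n.
- move=> _ [n _ <-] /=; rewrite eb_apply// indicE mem_set ?scale1r//=.
  by rewrite in_itv/= (eb_gt0 heb).
- move=> u l /= hu ul; have := pvm_cvg hd hE m0 ul.
  under eq_fun do rewrite hu.
  by move=> h; exact: (cvg_unique (@norm_hausdorff _ _) h ul).
- by move=> a y z /= Ey Ez; rewrite (pvmD hE)// (pvmZ hE)// Ey Ez.
rewrite nneseries_esumT; last first.
  by move=> n; rewrite lee_fin mulr_ge0 ?sqnormc_ge0// indicE.
rewrite esum_image; last by move=> m n _ _; exact: eb_inj.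
apply: eq_esum => n _; rewrite (pvm_sym hE)// eb_apply// dotZr sqnormcM.
congr (_ * _)%:E; rewrite sqnormc_conj /sqnormc/= expr0n/= addr0 indicE.
by case: (_ \in _); rewrite ?expr1n ?expr0n.
Qed.

Lemma esum_swap (T1 T2 : choiceType) (I : set T1) (J : set T2)
    (a : T1 -> T2 -> \bar R) : (forall i j, 0 <= a i j)%E ->
  (\esum_(i in I) \esum_(j in J) a i j = \esum_(j in J) \esum_(i in I) a i j)%E.
Proof.
move=> a0; rewrite !esum_esum//.
rewrite (reindex_esum (J `*`` (fun=> I)) (I `*`` (fun=> J))
  (fun p : T2 * T1 => (p.2, p.1)))//.
split=> [[j i] [/= ? ?]//|[j i] [j' i'] _ _ [-> ->]//|[i j] [/= Ii Jj]].
by exists (j, i).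
Qed.

(** Exchanging the two nonnegative sums leaves, for each [n], the Parseval sum of the vector [e n]
    scaled by the square root of [w n]. The chosen Hilbert basis disappears. *)
Lemma trace_formula (T : H -> H) (w : nat -> R) : (forall n, 0 <= w n) ->
  (forall b, (complex.Re (dot (T b) b))%:E =
     \sum_(0 <= n <oo) (w n * sqnormc (dot b (e n)))%:E)%E ->
  (op_trace dot T = \sum_(0 <= n <oo) (w n)%:E)%E.
Proof.
move=> w0 hT; have h0 b n : (0 <= (w n * sqnormc (dot b (e n)))%:E)%E.
  by rewrite lee_fin mulr_ge0 ?sqnormc_ge0.
rewrite /op_trace; under eq_esum do rewrite hT nneseries_esumT//.
rewrite esum_swap// nneseries_esumT//; apply: eq_esum => n _.
have -> : w n = sq ((Num.sqrt (w n))%:C *: e n).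
  rewrite sqZ /sq (eb_on heb) eqxx mulr1 /sqnormc/= expr0n/= addr0.
  by rewrite sqr_sqrtr.
rewrite -(trace_parseval hd); apply: eq_esum => b _.
rewrite dotZr sqnormcM sqnormc_conj; congr (_ * _)%:E.
rewrite sqZ /sq (eb_on heb) eqxx mulr1 //.
Qed.

Lemma counting_functionE x : counting_function dot E x = (N x)%:R.
Proof.
have mx : measurable (`]0, x]%classic : set R) by exact: measurable_itv.
rewrite /counting_function (trace_formula (w := fun n => \1_(`]0, x]) (lam n))).
- have h := @cvg_series_counting _ _ _ (eb_count heb) x.
  have -> : (\sum_(0 <= n <oo) (\1_(`]0%R, x]) (lam n))%:E =
      (N x)%:R%:E :> \bar R)%E.
    under eq_eseriesr => n _.
      rewrite indicE mem_setE in_itv/= (eb_gt0 heb)/=.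
      over.
    apply/cvg_lim => //; under eq_fun do rewrite sumEFin.
    by apply: cvg_EFin; [exact: nearW|exact: h].
  by [].
- by move=> n; rewrite indicE.
- move=> b; rewrite pvm_parseval// ?(pvm_dot hE)//.
  by move=> l /=; rewrite !in_itv/= andbT => /andP[].
Qed.

Lemma dcalc_eigen f T A n : digit_calculus (dot := dot) E f T A ->
  T (e n) = (f (lam n))%:C *: e n.
Proof.
move=> h; apply: (dcalc_scale hd h) => [k|]; last exact: eb_gt0 heb n.
by apply: eb_apply; exact: dcalc_measurable h k.
Qed.

(** A double series over digits and eigenvalues: [pvm_parseval] expands each digit projection, and
    after the exchange the digits sum to [f (lam n)]. *)
Lemma dcalc_expansion f T A x : digit_calculus (dot := dot) E f T A ->
  ((complex.Re (dot (T x) x))%:E =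
   \sum_(0 <= n <oo) (f (lam n) * sqnormc (dot x (e n)))%:E)%E.
Proof.
move=> h; have mA := dcalc_measurable h.
transitivity (\sum_(0 <= k <oo) (digit_weight k * sq (E (A k) x))%:E)%E.
  apply/esym/cvg_lim => //; under eq_fun do rewrite sumEFin.
  apply: cvg_EFin; first exact: nearW.
  have := cvg_Re_dot hd (dcalc_cvg h (x := x)) (y := x).
  apply: cvg_trans; apply: near_eq_cvg; apply: nearW => n.
  rewrite linear_sumlz cRe_sum; apply: eq_bigr => k _.
  transitivity (complex.Re ((digit_weight k)%:C * dot (E (A k) x) x)).
    by congr (complex.Re _); exact: dotZl.
  by rewrite (pvm_dot hE)//= mul0r subr0.
transitivity (\sum_(0 <= k <oo) \sum_(0 <= n <oo)
    (digit_weight k * \1_(A k) (lam n) * sqnormc (dot x (e n)))%:E)%E.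
  apply: eq_eseriesr => k _; rewrite EFinM -pvm_parseval//; last first.
    exact: (dcalc_pos h (k := k)).
  rewrite -nneseriesZl//; last first.
    by move=> n _; rewrite lee_fin mulr_ge0 ?sqnormc_ge0// indicE.
  by apply: eq_eseriesr => n _; rewrite -EFinM mulrA.
have nn k n : (0 <= (digit_weight k * \1_(A k) (lam n) *
    sqnormc (dot x (e n)))%:E)%E.
  by rewrite lee_fin !mulr_ge0 ?digit_weight_ge0 ?sqnormc_ge0// indicE.
rewrite nneseries_interchange//; apply: eq_eseriesr => n _.
under eq_eseriesr do rewrite mulrC EFinM.
rewrite nneseriesZl; last first.
  by move=> k _; rewrite lee_fin mulr_ge0 ?digit_weight_ge0// indicE.
rewrite mulrC EFinM; congr (_ * _)%E; apply/cvg_lim => //.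
under eq_fun do rewrite sumEFin.
by apply: cvg_EFin; [exact: nearW|exact: (dcalc_sum h (eb_gt0 heb n))].
Qed.

Lemma trace_dcalc f T A : digit_calculus (dot := dot) E f T A ->
  (forall l, 0 < l -> 0 <= f l) ->
  (op_trace dot T = \sum_(0 <= n <oo) (f (lam n))%:E)%E.
Proof.
move=> h f0; apply: trace_formula => [n|b].
  by apply: f0; exact: eb_gt0 heb n.
exact: dcalc_expansion h.
Qed.

End WithBasis.

End EigenBasis.

(** * The operator and its spectrum *)

Section Operator.
Context {R : realType} {H : completeNormedModType R[i]}.
Context {dot : {dot H for Num.conj}}.
Hypothesis hd : hilbert_form dot.
Variable E : set R -> H -> H.
Hypothesis hE : projection_valued_measure dot E.

Local Notation sq := (sq (dot := dot)).

(** The integrand may be altered on a null set; this trades an unbounded integrand for a truncated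
    one and [scalar_measure] for a measure. *)
Lemma integral_support (A : set R) (f g : R -> R) y : measurable A ->
  E (~` A) y = 0 -> measurable_fun setT f -> measurable_fun setT g ->
  (forall l, A l -> f l = g l) ->
  (\int[scalar_measure dot E y]_l (f l)%:E =
   \int[smeasure hd hE y]_l (g l)%:E)%E.
Proof.
move=> mA Ey mf mg fg; rewrite (smeasure_integral hd hE).
apply: ae_eq_integral => //.
- exact/measurable_EFinP.
- exact/measurable_EFinP.
exists (~` A); split; first exact: measurableC.
  rewrite [LHS](smeasureE hd hE) ?Ey ?sq0//; exact: measurableC.
move=> l /= h Al; apply: h => _; congr EFin; exact: fg.
Qed.

Lemma smeasureT y : smeasure hd hE y setT = (sq y)%:E.
Proof. by rewrite smeasureE// (pvmT hE). Qed.

Lemma integral_smeasure_le (g : R -> R) (c : R) y :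
  measurable_fun setT g -> (forall l, 0 <= g l <= c) ->
  (\int[smeasure hd hE y]_l (g l)%:E <= (c * sq y)%:E)%E.
Proof.
move=> mg g0; apply: (@le_trans _ _ (\int[smeasure hd hE y]_l c%:E)%E).
  apply: ge0_le_integral => //.
  - by move=> l _; rewrite lee_fin; case/andP: (g0 l).
  - exact/measurable_EFinP.
  - by move=> l _; rewrite lee_fin; case/andP: (g0 l).
rewrite integral_cst// EFinM lee_wpmul2l//; last by rewrite -smeasureT.
by case/andP: (g0 0) => h1 /(le_trans h1); rewrite lee_fin.
Qed.

Lemma integral_smeasure_ge (g : R -> R) (c : R) y : 0 <= c ->
  measurable_fun setT g -> (forall l, c <= g l) ->
  ((c * sq y)%:E <= \int[smeasure hd hE y]_l (g l)%:E)%E.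
Proof.
move=> c0 mg g0; apply: (@le_trans _ _ (\int[smeasure hd hE y]_l c%:E)%E).
  by rewrite integral_cst// EFinM -smeasureT.
apply: ge0_le_integral => //; first exact/measurable_EFinP.
by move=> l _; rewrite lee_fin.
Qed.

Lemma heat_trace_finite x : (heat_trace dot E 1 < +oo)%E -> 0 < x ->
  (op_trace dot (E `]0%R, x]%classic) < +oo)%E.
Proof.
move=> fin x0; pose f (l : R) := expR (- (1 * l)).
have mf : measurable_fun setT f.
  apply: measurableT_comp => //; apply: measurableT_comp => //.
have f01 l : 0 < l -> 0 <= f l <= 1.
  by move=> l0; rewrite /f mul1r expR_ge0/= -[leRHS]expR0 ler_expR oppr_le0 ltW.
have [T [A hT]] := digit_calculus_exists hd hE mf f01.
have mx : measurable (`]0, x]%classic : set R) by exact: measurable_itv.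
rewrite /heat_trace (fun_calculusE hT) in fin.
have T0 y : 0 <= complex.Re (dot (T y) y).
  rewrite -lee_fin (dcalc_int hT) (smeasure_integral hd hE).
  by apply: integral_ge0 => l _; rewrite lee_fin expR_ge0.
(* On []0, x]] the indicator is at most [exp x exp (- l)]. *)
apply: (trace_scale_fin (T := T) (c := expR x)) => // y.
rewrite (pvm_dot hE)//= -ler_pdivrMl ?expR_gt0// -lee_fin (dcalc_int hT).
rewrite (smeasure_integral hd hE).
apply: (@le_trans _ _ (\int[smeasure hd hE y]_(l in `]0%R, x]) (f l)%:E)%E).
  apply: (@le_trans _ _ (\int[smeasure hd hE y]_(l in `]0%R, x]) (expR (- x))%:E)%E).
    rewrite integral_cst// EFinM expRN; apply: lee_wpmul2l.
      by rewrite lee_fin invr_ge0 expR_ge0.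
    by rewrite -(smeasureE hd hE).
  apply: ge0_le_integral => //.
  - by apply: measurable_funTS; exact/measurable_EFinP.
  - move=> l /=; rewrite in_itv/= => /andP[_ lx].
    by rewrite lee_fin ler_expR mul1r lerN2.
apply: ge0_subset_integral => //.
- by apply: measurable_funTS; exact/measurable_EFinP.
- by move=> l _; rewrite lee_fin expR_ge0.
- by move=> l /=; rewrite !in_itv/= andbT => /andP[].
Qed.

Variables (D : set H) (L : H -> H).
Hypothesis Llin : linear_on D L.
Hypothesis Lsa : self_adjoint dot D L.
Hypothesis Lpos : nonneg_op dot D L.
Hypothesis LE : spectral_measure_of dot D L E.

Let minr_measurable (c : R) (f : R -> R) : measurable_fun setT f ->
  measurable_fun setT (fun l => Num.min (f l) c).
Proof. by move=> mf; apply: measurable_minr. Qed.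

Lemma domain_bounded (A : set R) (M : R) y : measurable A -> 0 <= M ->
  (forall l, A l -> `|l| <= M) -> E (~` A) y = 0 -> D y.
Proof.
move=> mA M0 AM Ey; have [_ DE _] := LE; apply/DE.
have mf : measurable_fun setT (fun l : R => l ^+ 2) by exact: exprn_measurable.
rewrite (integral_support mA Ey mf (minr_measurable (M ^+ 2) mf)); last first.
  move=> l /AM h; rewrite min_l//= -(real_normK (num_real l)).
  by apply: lerXn2r; rewrite ?nnegrE.
apply: le_lt_trans (integral_smeasure_le (c := M ^+ 2) _ _ _) (ltry _).
  exact: minr_measurable.
by move=> l; rewrite le_min !sqr_ge0 ge_min lexx orbT.
Qed.

(** The compact intervals [F n] exhaust the negative half-line. A vector [z] in the range of
    [E (F n)] lies in the domain and satisfies [<L z, z> <= - c |z|^2], so positivity forces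
    [z = 0]. *)
Lemma pvm_negative y : E `]-oo, 0[%classic y = 0.
Proof.
pose F n : set R := `[- n.+1%:R, - n.+1%:R^-1]%classic.
have mF n : measurable (F n) by exact: measurable_itv.
apply: (pvm_bigcup0 hd hE (F := F)) => //.
  move=> l /=; rewrite in_itv/= => l0.
  pose n := maxn (Num.bound (- l)) (Num.bound (- l)^-1).
  have nl : 0 < - l by rewrite oppr_gt0.
  exists n => //=; rewrite /F/= in_itv/=; apply/andP; split.
    rewrite lerNl; apply/ltW/(lt_le_trans (archi_boundP (ltW nl))).
    by rewrite ler_nat leqW// leq_maxl.
  rewrite lerNr invf_ple ?posrE//; apply/ltW.
  have := archi_boundP (ltW (etrans (invr_gt0 _) nl)).
  by move/lt_le_trans; apply; rewrite ler_nat leqW// leq_maxr.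
move=> n; set z := E (F n) y; pose c : R := n.+1%:R^-1.
have c0 : 0 < c by rewrite invr_gt0.
have Ez : E (~` F n) z = 0.
  rewrite /z -(pvmI hE)//; last exact: measurableC.
  by rewrite setICl (pvm0 hE).
have c1 : c <= n.+1%:R by apply: (@le_trans _ _ 1); rewrite ?invf_le1// ler1n.
have Dz : D z.
  apply: (domain_bounded (mF n) (M := n.+1%:R)) => // l.
  rewrite /F/= in_itv/= => /andP[h1 h2]; rewrite ler_norml h1/=.
  by apply: le_trans h2 _; rewrite lerNl; apply: le_trans (ltW c0); rewrite oppr_le0.
have [_ _ /(_ z Dz)] := LE.
have mid : measurable_fun setT (fun l : R => l) by exact: measurable_id.
(* The truncation at [- c] makes the opposite of the integrand at least [c > 0] on the whole line,
   so that only integrals of nonnegative functions occur. *)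
rewrite (integral_support (mF n) Ez mid (minr_measurable (- c) mid)); last first.
  by move=> l; rewrite /F/= in_itv/= => /andP[_ h]; rewrite min_l.
pose h (l : R) := - Num.min l (- c).
rewrite (eq_integral (fun l => (- (h l)%:E)%E)); last first.
  by move=> l _; rewrite /h EFinN oppeK.
have hc l : c <= h l by rewrite /h lerNr ge_min lexx orbT.
have mh : measurable_fun setT h.
  by apply: measurableT_comp => //; exact: minr_measurable.
rewrite integral_ge0N; last by move=> l _; rewrite lee_fin (le_trans (ltW c0)).
have := integral_smeasure_ge z (ltW c0) mh hc.
move=> h1 h2; have : ((c * sq z)%:E <= - (complex.Re (dot (L z) z))%:E)%E.
  by rewrite h2 oppeK.
rewrite -EFinN lee_fin => h3; apply: (sq_eq0 (dot := dot)).
have := Lpos Dz; rewrite lecE/= => /andP[_ h4].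
apply/eqP; rewrite eq_le sq_ge0 andbT -(pmulr_rle0 _ c0).
by apply: le_trans h3 _; rewrite oppr_le0.
Qed.

(** Were [E ]X, +oo[] zero, the spectral measure would live on [[0, X]], the domain would be
    everything and the form would be at most [X |y|^2]; [L] would then have norm at most [X]. *)
Lemma spectrum_unbounded : unbounded_op D L ->
  forall X : R, 0 < X -> exists y, E `]X, +oo[%classic y <> 0.
Proof.
move=> unb X X0; apply: contrapT => no.
have EX y : E `]X, +oo[%classic y = 0.
  by apply: contrapT => h; apply: no; exists y.
have mI (i : interval R) : measurable [set` i] by exact: measurable_itv.
have EC y : E (~` `[0, X]%classic) y = 0.
  rewrite setCitv/=; apply: (pvm_setU0 hd hE) => //; exact: pvm_negative.
have Dy y : D y.
  apply: (domain_bounded (mI `[0, X]) (M := X)) => //; first exact: ltW.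
  by move=> l; rewrite /= in_itv/= => /andP[l0 lX]; rewrite ger0_norm.
have q y : complex.Re (dot (L y) y) <= X * sq y.
  have [_ _ /(_ y (Dy y))] := LE.
  have mid : measurable_fun setT (fun l : R => l) by exact: measurable_id.
  have mg : measurable_fun setT (fun l : R => Num.min (Num.max l 0) X).
    by apply: minr_measurable; apply: measurable_maxr.
  rewrite (integral_support (mI `[0, X]) (EC y) mid mg); last first.
    move=> l; rewrite /= in_itv/= => /andP[l0 lX].
    by rewrite max_l// min_l.
  rewrite -lee_fin => ->; apply: integral_smeasure_le => // l.
  by rewrite le_min le_max lexx orbT ltW//= ge_min lexx orbT.
have Lsym y w : dot (L y) w = dot y (L w).
  exact: (Lsa w (L w)).2 (conj (Dy w) erefl) y (Dy y).
apply: unb; exists X => y _.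
have LB (t : R) w : L (y - t%:C *: w) = L y - t%:C *: L w.
  have [_ Ll] := Llin; have [_ h] := Ll (- t%:C) w y (Dy w) (Dy y).
  by rewrite addrC -scaleNr h scaleNr addrC.
pose w := L y.
(* Passage from the form to the norm: positivity at [y - X^-1 L y], with the form bound at
   [w = L y], gives [X^-1 |L y|^2 <= <L y, y>], at most [X |y|^2]. *)
have h : 0 <= complex.Re (dot (L (y - (X^-1)%:C *: w)) (y - (X^-1)%:C *: w)).
  by have := Lpos (Dy (y - (X^-1)%:C *: w)); rewrite lecE => /andP[].
have e : complex.Re (dot (L (y - (X^-1)%:C *: w)) (y - (X^-1)%:C *: w)) =
   complex.Re (dot (L y) y) - 2 * X^-1 * sq w +
     X^-1 ^+ 2 * complex.Re (dot (L w) w).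
  rewrite LB dotBl !dotBr !dotZl !dotZr [dot (L w) y]Lsym -/w.
  have -> : Num.conj (X^-1)%:C = (X^-1)%:C.
    by apply/eqP; rewrite eq_complex/= oppr0 !eqxx.
  rewrite dotxx !cReB !cReM/= !mul0r !subr0; ring.
rewrite e in h; have h1 := q y; have h2 := q w.
have h3 : X^-1 ^+ 2 * complex.Re (dot (L w) w) <= X^-1 * sq w.
  have : X^-1 ^+ 2 * complex.Re (dot (L w) w) <= X^-1 ^+ 2 * (X * sq w).
    by rewrite ler_wpM2l// sqr_ge0.
  have -> : X^-1 ^+ 2 * (X * sq w) = X^-1 * sq w by field; rewrite gt_eqF.
  by [].
have h4 : X^-1 * sq w <= X * sq y by lra.
rewrite mulrC ler_pdivrMr// in h4.
have Xy : X%:C * `|y| = (X * Num.sqrt (sq y))%:C :> R[i].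
  by rewrite (norm_sqrt hd) -rmorphM.
rewrite Xy (norm_le hd); last by rewrite mulr_ge0 ?sqrtr_ge0// ltW.
by rewrite exprMn sqr_sqrtr ?sq_ge0// expr2; apply: le_trans h4 _; rewrite mulrAC.
Qed.

End Operator.

(** * Compactness and singular values *)

Section Compactness.
Context {R : realType} {H : completeNormedModType R[i]}.
Context {dot : {dot H for Num.conj}}.
Hypothesis hd : hilbert_form dot.

Local Notation sq := (sq (dot := dot)).

Lemma subr4 (V : zmodType) (y1 z1 y z : V) :
  (y1 - z1) - ((y - z) + ((y1 - y) - (z1 - z))) = 0.
Proof.
have -> : (y1 - y) - (z1 - z) = (y1 - z1) - (y - z).
  by rewrite !opprB addrACA [- y + _]addrC addrACA.
by rewrite [X in _ - X]addrC subrK subrr.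
Qed.

(** The limit is the supremum of the levels that [g] exceeds on a member of [F]; for a higher level,
    the ultrafilter contains the complement. *)
Lemma ultra_bounded_limit (T : Type) (F : set_system T) (g : T -> R) (b : R) :
  UltraFilter F -> F [set y | `|g y| <= b] ->
  exists a, forall eps, 0 < eps -> F [set y | `|g y - a| < eps].
Proof.
move=> UF Fb; pose S := [set t : R | F [set y | t <= g y]].
have S0 : S (- b).
  by apply: filterS Fb => y /=; rewrite ler_norml => /andP[].
have Sb : ubound S b.
  move=> t St; have [y [/= ty]] := filter_ex (filterI St Fb).
  by rewrite ler_norml => /andP[_]; exact: le_trans.
have hS : has_sup S by split; [exists (- b)|exists b].
exists (sup S) => eps e0; have e2 : 0 < eps / 2 by rewrite divr_gt0.
have [t St lt] := sup_adherent e0 hS.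
have nS : ~ S (sup S + eps / 2).
  move=> h; have : sup S + eps / 2 <= sup S by apply: ub_le_sup => //; exists b.
  by rewrite gerDl leNgt e2.
have [//|Fc] := in_ultra_setVsetC [set y | sup S + eps / 2 <= g y] UF.
apply: filterS (filterI St Fc) => y [/= h1 /negP]; rewrite -ltNge => h2.
by rewrite ltr_norml; apply/andP; split; lra.
Qed.

(* Along an ultrafilter each of the bounded coordinates converges, so that the
   ultrafilter is Cauchy. *)
Lemma compact_of_coordinates (C : set H) (e : nat -> H) (b : R) :
  closed C -> (forall y n, C y -> sqnormc (dot y (e n)) <= b ^+ 2) -> 0 <= b ->
  (forall eps, 0 < eps -> exists M, exists2 del, 0 < del & forall y z,
    C y -> C z -> (forall n, (n < M)%N -> sqnormc (dot (y - z) (e n)) <= del) ->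
    sq (y - z) < eps) ->
  compact C.
Proof.
move=> cC Cb b0 key; rewrite compact_ultra => F UF FC.
have bnd z : sqnormc z <= b ^+ 2 ->
    `|complex.Re z| <= b /\ `|complex.Im z| <= b :> R.
  rewrite /sqnormc => h; split; rewrite -(@ler_pXn2r _ 2) ?nnegrE ?normr_ge0//;
    rewrite real_normK ?num_real//; apply: le_trans h.
    by rewrite lerDl sqr_ge0.
  by rewrite lerDr sqr_ge0.
have /choice[a ha] : forall n, exists a : R, forall eps : R, 0 < eps ->
    F [set y | `|complex.Re (dot y (e n)) - a| < eps].
  move=> n; apply: (@ultra_bounded_limit _ _ _ b) => //.
  by apply: filterS FC => y /(Cb y n)/bnd[].
have /choice[c hc] : forall n, exists a : R, forall eps : R, 0 < eps ->
    F [set y | `|complex.Im (dot y (e n)) - a| < eps].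
  move=> n; apply: (@ultra_bounded_limit _ _ _ b) => //.
  by apply: filterS FC => y /(Cb y n)/bnd[].
have cauF : cauchy F.
  apply/cauchy_ballP => eps e0.
  have er : eps = (complex.Re eps)%:C by rewrite RRe_real// gtr0_real.
  have e0' : 0 < complex.Re eps by move: e0; rewrite er ltcR.
  have [M [del d0 hM]] := key _ (exprn_gt0 2 e0').
  (* Two points of [G M] differ by less than [2 eta] in each real and imaginary part, hence by at
     most [8 eta ^+ 2] in squared modulus, below [del = 16 eta ^+ 2]. *)
  pose eta := Num.sqrt del / 4.
  have eta0 : 0 < eta by rewrite divr_gt0// sqrtr_gt0.
  pose G m := [set y | C y /\ forall n, (n < m)%N ->
    `|complex.Re (dot y (e n)) - a n| < eta /\
    `|complex.Im (dot y (e n)) - c n| < eta].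
  have FG m : F (G m).
    elim: m => [|m IH]; first by apply: filterS FC => y Cy; split.
    apply: filterS (filterI IH (filterI (ha m _ eta0) (hc m _ eta0))).
    move=> y [[Cy hy] [h1 h2]]; split=> // n; rewrite ltnS leq_eqVlt.
    by move=> /predU1P[->//|/hy].
  near=> x; near: x; exists (G M, G M); first by split; exact: FG.
  move=> [y z] [/= [Cy hy] [Cz hz]]; rewrite -ball_normE/= er (norm_lt hd)//.
  apply: hM => // n nM; have [y1 y2] := hy n nM; have [z1 z2] := hz n nM.
  rewrite dotBl; move: y1 y2 z1 z2; case: (dot y (e n)) => p q.
  case: (dot z (e n)) => p' q' /= y1 y2 z1 z2; rewrite /sqnormc/=.
  have h4 : (4 * eta) ^+ 2 = del.
    by rewrite /eta mulrC divfK// sqr_sqrtr// ltW.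
  have h1 : `|p - p'| < 2 * eta.
    have -> : p - p' = (p - a n) - (p' - a n) by ring.
    by apply: le_lt_trans (ler_normB _ _) _; lra.
  have h2 : `|q - q'| < 2 * eta.
    have -> : q - q' = (q - c n) - (q' - c n) by ring.
    by apply: le_lt_trans (ler_normB _ _) _; lra.
  have sqb (r : R) : `|r| < 2 * eta -> r ^+ 2 <= (2 * eta) ^+ 2.
    move=> h; rewrite -(real_normK (num_real r)).
    by apply: lerXn2r; rewrite ?nnegrE// ?ltW// mulr_gt0.
  have := sqb _ h1; have := sqb _ h2; rewrite -h4; have := sqr_ge0 eta; nra.
have /cvg_ex[p Fp] : cvg F by exact: cauchy_cvg.
exists p; split=> //; apply: cC => A /Fp FA; exact: (filter_ex (filterI FC FA)).
Unshelve. all: by end_near. Qed.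

Lemma closure_approx (K : set H) y (eps : R) : closure K y -> 0 < eps ->
  exists2 k, K k & sq (k - y) < eps.
Proof.
move=> Ky e0; have se : 0 < Num.sqrt eps by rewrite sqrtr_gt0.
have : nbhs y (ball y (Num.sqrt eps)%:C) by apply: nbhsx_ballx; rewrite ltcR.
move=> /Ky[k [Kk]]; rewrite -ball_normE/= (norm_lt hd)// sqr_sqrtr ?ltW// => h.
by exists k => //; rewrite sqBC.
Qed.

Lemma precompact_of_coordinates (K : set H) (e : nat -> H) (b : R) :
  (forall n, sq (e n) = 1) -> (forall y, K y -> sq y <= b) ->
  (forall eps, 0 < eps -> exists M, exists2 del, 0 < del & forall y z,
    K y -> K z -> (forall n, (n < M)%N -> sqnormc (dot (y - z) (e n)) <= del) ->
    sq (y - z) < eps) ->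
  precompact K.
Proof.
move=> e1 Kb key; rewrite precompactE.
(* A point of the closure is within 1 of [K], so its squared norm is at most [2 b + 2]; [b' >= 1]
   lets [b' ^+ 2] dominate this. *)
pose b' := 2 * `|b| + 2; have b'1 : 1 <= b' by have := normr_ge0 b; rewrite /b'; lra.
have b'0 : 0 <= b' by apply: le_trans b'1.
have CS1 y n : sqnormc (dot y (e n)) <= sq y.
  by rewrite -[leRHS]mulr1 -(e1 n); exact: dot_CS.
apply: (@compact_of_coordinates _ e b') => //; first exact: closed_closure.
  move=> y n /closure_approx/(_ ltr01)[k Kk ky].
  apply: le_trans (CS1 _ _) _; apply: (@le_trans _ _ b'); last first.
    by rewrite expr2 ler_peMr.
  have -> : y = k - (k - y) by rewrite subKr.
  apply: le_trans (sqB_le _ _) _; have := Kb _ Kk; have := ler_norm b.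
  rewrite /b'; lra.
move=> eps e0; have e4 : 0 < eps / 4 by rewrite divr_gt0.
have [M [del d0 hM]] := key _ e4.
exists M, (del / 4); first by rewrite divr_gt0.
move=> y z Cy Cz hyz.
(* Moving both points into [K] perturbs the difference by at most [4 eta] in squared norm. Since
   squared sums double, the coordinates stay within [del] and the distance within [eps]. *)
pose eta := Num.min (eps / 16) (del / 16).
have eta0 : 0 < eta by rewrite lt_min !divr_gt0.
have [ee ed] : eta <= eps / 16 /\ eta <= del / 16.
  by split; rewrite ge_min lexx ?orbT.
have [y1 Ky1 hy1] := closure_approx Cy eta0.
have [z1 Kz1 hz1] := closure_approx Cz eta0.
have small : sq ((y1 - y) - (z1 - z)) <= 4 * eta.
  by apply: le_trans (sqB_le _ _) _; lra.
have e2 : y1 - z1 = (y - z) + ((y1 - y) - (z1 - z)).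
  by apply/eqP; rewrite -subr_eq0; apply/eqP; exact: subr4.
have h : sq (y1 - z1) < eps / 4.
  apply: hM => // n nM; rewrite e2 dotDl; apply: le_trans (sqnormcD_le _ _) _.
  have := hyz n nM; have := CS1 (y1 - y - (z1 - z)) n; lra.
have -> : y - z = (y1 - z1) - ((y1 - y) - (z1 - z)).
  by rewrite e2 addrK.
by apply: le_lt_trans (sqB_le _ _) _; lra.
Qed.

End Compactness.

Section SequenceUniqueness.
Context {R : realType}.

Lemma card_lt_contra (T U : choiceType) (X Y : set T) (Z : set U) (x : T) :
  finite_set X -> (X #= Z)%card -> (Y #= Z)%card -> X `<=` Y -> Y x -> ~ X x ->
  False.
Proof.
move=> /finite_setP[n Xn] XZ YZ XY Yx nXx.
have Yn : (Y #= `I_n)%card.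
  by apply: card_eq_trans YZ _; apply: card_eq_trans Xn; exact: card_esym.
have fX : finite_set X by apply/finite_setP; exists n.
have fY : finite_set Y by apply/finite_setP; exists n.
have := card_fset_set Xn; have := card_fset_set Yn => hY hX.
have memX t : t \in (finmap.enum_fset (fset_set X)) <-> X t.
  by rewrite in_fset_set//; split=> [|?]; rewrite inE.
have memY t : t \in (finmap.enum_fset (fset_set Y)) <-> Y t.
  by rewrite in_fset_set//; split=> [|?]; rewrite inE.
have : (size (x :: finmap.enum_fset (fset_set X)) <= size (finmap.enum_fset (fset_set Y)))%N.
  apply: uniq_leq_size.
    by rewrite /= finmap.fset_uniq andbT; apply/negP => /memX.
  by move=> t; rewrite inE => /predU1P[->|/memX/XY]; move=> *; apply/memY.
by rewrite /= hX hY ltnn.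
Qed.

(** At the first difference, say [a n < b n], put [s = b n > 0]. By monotonicity every index with
    [a m = s] precedes [n], hence has [b m = s] too; the extra index [n] prevents the level sets
    from being equipotent, that of [a] being finite. *)
Lemma monotone_seq_eq (mu nu : nat -> R) :
  nonincreasing_seq mu -> nonincreasing_seq nu ->
  (forall n, 0 <= mu n) -> (forall n, 0 <= nu n) ->
  (forall s, 0 < s -> ([set n | mu n = s] #= [set n | nu n = s])%card) ->
  mu = nu.
Proof.
have half (a b : nat -> R) n : nonincreasing_seq a -> (forall n, 0 <= a n) ->
    (forall s, 0 < s -> ([set n | a n = s] #= [set n | b n = s])%card) ->
    (forall m, (m < n)%N -> a m = b m) -> ~ (a n < b n).
  move=> amono a0 ab IH lt; have s0 : 0 < b n by apply: le_lt_trans lt.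
  have alt m : a m = b n -> (m < n)%N.
    by move=> am; rewrite ltnNge; apply/negP => /amono; rewrite am leNgt lt.
  apply: (@card_lt_contra _ _ [set m | a m = b n] [set m | b m = b n]
    [set m | b m = b n] n) => //.
  - by apply: (sub_finite_set _ (finite_II n)) => m /= /alt.
  - exact: ab.
  - by move=> m /= /[dup] /alt/IH ->.
  - by move=> /= h; move: lt; rewrite h ltxx.
move=> mumono numono mu0 nu0 mn; apply/funext => n.
elim/ltn_ind: n => n IH; apply: contrapT => /eqP; rewrite neq_lt => /orP[].
  exact: half.
apply: half => //.
  by move=> s s0; apply: card_esym; exact: mn.
by move=> m /IH.
Qed.

End SequenceUniqueness.

Section OrthonormalBases.
Context {R : realType} {H : completeNormedModType R[i]}.
Context {dot : {dot H for Num.conj}}.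
Hypothesis hd : hilbert_form dot.

Local Notation sq := (sq (dot := dot)).

(* Double counting of the squared coordinates of [t] in the basis [s]. *)
Lemma basis_size_le (W B : set H) (s : seq H) :
  (forall (a : R[i]) y z, W y -> W z -> W (a *: y + z)) ->
  onset (dot := dot) B -> B `<=` W -> uniq s -> onset (dot := dot) [set` s] ->
  (forall b, b \in s -> W b) ->
  (forall y, W y -> (forall b, b \in s -> dot y b = 0) -> y = 0) ->
  forall t, uniq t -> (forall b, b \in t -> B b) -> (size t <= size s)%N.
Proof.
move=> Wlin onB BW us ons sW smax t ut tB.
have expand y : W y -> sq y = projsq (dot := dot) s y.
  move=> Wy; suff : sq (y - onproj (dot := dot) s y) = 0.
    by rewrite (sq_residual ons)// => /eqP; rewrite subr_eq0 => /eqP.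
  rewrite (_ : y - _ = 0) ?sq0//; apply: smax.
    have W0 : W 0 by have := Wlin (-1) y y Wy Wy; rewrite scaleN1r addNr.
    have Wp : forall r, (forall b, b \in r -> W b) -> W (onproj (dot := dot) r y).
      elim=> [|b r IH] rW; first by rewrite /onproj big_nil.
      rewrite /onproj big_cons; apply: (Wlin); first by apply: rW; rewrite mem_head.
      by apply: IH => c cr; apply: rW; rewrite inE cr orbT.
    by rewrite addrC -scaleN1r; apply: (Wlin) => //; exact: Wp.
  move=> b bs; rewrite dotBl (dot_sum_in ons (fun e => dot y e))// subrr//.
rewrite -(ler_nat R).
have -> : (size t)%:R = \sum_(b <- t) \sum_(c <- s) sqnormc (dot b c) :> R.
  rewrite -sum1_size natr_sum big_seq [RHS]big_seq; apply: eq_bigr => b bt.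
  rewrite -[RHS]/(projsq (dot := dot) s b) -expand; last by apply/BW/tB.
  by rewrite /sq onB.1//; exact: tB.
rewrite exchange_big/= -[in leRHS]sum1_size natr_sum big_seq [leRHS]big_seq.
apply: ler_sum => c cs.
have -> : \sum_(b <- t) sqnormc (dot b c) = projsq (dot := dot) t c.
  by apply: eq_bigr => b _; rewrite dotC sqnormc_conj.
apply: le_trans (bessel onB c ut tB) _.
by rewrite /sq ons.1//=.
Qed.

(** Bounds the finite sublists of each basis by the size of the other; the finiteness of [B] is part
    of the conclusion of this counting. *)
Lemma basis_card_eq (W B B' : set H) :
  (forall (a : R[i]) y z, W y -> W z -> W (a *: y + z)) ->
  orthonormal_basis dot W B -> orthonormal_basis dot W B' -> finite_set B' ->
  (B #= B')%card.
Proof.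
move=> Wlin [BW B1 B2 Bmax] [B'W B'1 B'2 B'max] finB'.
have onB : onset (dot := dot) B by [].
have onB' : onset (dot := dot) B' by [].
have half (X Y : set H) : onset (dot := dot) X -> onset (dot := dot) Y ->
    X `<=` W -> Y `<=` W -> finite_set Y ->
    (forall x, W x -> (forall b, Y b -> dot x b = 0) -> x = 0) ->
    forall t, uniq t -> (forall b, b \in t -> X b) ->
      (size t <= size (finmap.enum_fset (fset_set Y)))%N.
  move=> onX onY XW YW fY Ymax.
  have memY b : b \in (finmap.enum_fset (fset_set Y)) <-> Y b.
    by rewrite in_fset_set//; split=> [|?]; rewrite inE.
  apply: (basis_size_le Wlin onX XW) => //.
  - exact: finmap.fset_uniq.
  - split=> [b /= /memY|b c /= /memY Yb /memY Yc]; first exact: onY.1.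
    exact: onY.2.
  - by move=> b /memY; exact: YW.
  - by move=> y Wy h; apply: Ymax => // b /memY; exact: h.
have h1 := half B B' onB onB' BW B'W finB' B'max.
have finB : finite_set B.
  apply: contrapT => infB.
  have [X XB] := infinite_set_fset (size (finmap.enum_fset (fset_set B'))).+1 infB.
  have := h1 (finmap.enum_fset X) (finmap.fset_uniq X) (fun b bX => XB b bX).
  by move=> /leq_ltn_trans/[apply]; rewrite ltnn.
have h2 := half B' B onB' onB B'W BW finB Bmax.
have hs : size (finmap.enum_fset (fset_set B)) = size (finmap.enum_fset (fset_set B')).
  apply/eqP; rewrite eqn_leq h1 ?h2 ?finmap.fset_uniq// => b.
    by rewrite in_fset_set// inE.
  by rewrite in_fset_set// inE.
have cardI (Y : set H) : finite_set Y ->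
    (Y #= `I_(size (finmap.enum_fset (fset_set Y))))%card.
  by move=> /finite_setP[n Yn]; rewrite (card_fset_set Yn).
apply: card_eq_trans (cardI _ finB) _; rewrite hs; apply: card_esym.
exact: cardI.
Qed.

End OrthonormalBases.

(** * Compactness and singular values of f(L) when f(lam_n) decreases to 0 *)

Section DiagonalOperator.
Context {R : realType} {H : completeNormedModType R[i]}.
Context {dot : {dot H for Num.conj}}.
Hypothesis hd : hilbert_form dot.
Variable E : set R -> H -> H.
Hypothesis hE : projection_valued_measure dot E.
Variables (e : nat -> H) (lam : nat -> R) (N : R -> nat).
Hypothesis heb : eigenbasis (dot := dot) E e lam N.
Variables (f : R -> R) (T : H -> H) (A : nat -> set R).
Hypothesis hT : digit_calculus (dot := dot) E f T A.

Local Notation sq := (sq (dot := dot)).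
Let mu n := f (lam n).

Hypothesis mu0 : forall n, 0 < mu n.
Hypothesis mu_mono : forall m n, (m <= n)%N -> mu n <= mu m.
Hypothesis mu_cvg0 : forall eps, 0 < eps -> exists n, mu n < eps.

Let m0 : measurable (`]0, +oo[%classic : set R).
Proof. exact: measurable_itv. Qed.

Lemma eb_onset : onset (dot := dot) (range e).
Proof.
split=> [_ [n _ <-]|_ _ [m _ <-] [n _ <-] mn]; first by rewrite (eb_on heb) eqxx.
by rewrite (eb_on heb); case: eqP => // h; move: mn; rewrite h.
Qed.

Lemma dcalc_range x : E `]0, +oo[%classic (T x) = T x.
Proof.
have h := pvm_cvg hd hE m0 (dcalc_cvg hT (x := x)).
have h' : (fun n => E `]0, +oo[%classic
    (\sum_(0 <= k < n) (digit_weight k)%:C *: E (A k) x)) =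
    (fun n => \sum_(0 <= k < n) (digit_weight k)%:C *: E (A k) x).
  apply/funext => n; have mA := dcalc_measurable hT.
  elim: n => [|n IH]; first by rewrite big_geq// (pvm_0 hE).
  rewrite big_nat_recr//= (pvmD hE)// IH (pvmZ hE)// -(pvmI hE)//.
  congr (_ + _ *: E _ x); apply/setIidPr; exact: (dcalc_pos hT (k := n)).
rewrite h' in h; exact: (cvg_unique (@norm_hausdorff _ _) h (dcalc_cvg hT (x := x))).
Qed.

Lemma dcalc_coord x n : dot (T x) (e n) = (mu n)%:C * dot x (e n).
Proof.
rewrite (dcalc_sym _ _ hT) (dcalc_eigen hd hE heb n hT) dotZr; congr (_ * _).
by apply/eqP; rewrite eq_complex/= oppr0 !eqxx.
Qed.

Lemma sq_dcalc x :
  ((sq (T x))%:E = \sum_(0 <= n <oo) (mu n ^+ 2 * sqnormc (dot x (e n)))%:E)%E.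
Proof.
rewrite -[in LHS]dcalc_range -(pvm_parseval hd hE heb)//.
apply: eq_eseriesr => n _; rewrite indicE mem_set/=; last first.
  by rewrite in_itv/= (eb_gt0 heb).
by rewrite mul1r dcalc_coord sqnormcM /sqnormc/= expr0n/= addr0.
Qed.

Lemma dcalc_tail M x : (forall n, (n < M)%N -> dot x (e n) = 0) ->
  sq (T x) <= mu M ^+ 2 * sq x.
Proof.
move=> xM; rewrite -lee_fin sq_dcalc EFinM.
apply: (@le_trans _ _ ((mu M ^+ 2)%:E * (sq (E `]0%R, +oo[%classic x))%:E)%E).
  rewrite -(pvm_parseval hd hE heb)// -nneseriesZl; last first.
    by move=> n _; rewrite lee_fin mulr_ge0 ?sqnormc_ge0// indicE.
  apply: lee_nneseries => n _; first by rewrite lee_fin mulr_ge0 ?sqr_ge0 ?sqnormc_ge0.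
  rewrite -EFinM lee_fin indicE mem_set/=; last by rewrite in_itv/= (eb_gt0 heb).
  rewrite mul1r; have [nM|Mn] := ltnP n M.
    by rewrite xM// sqnormc0 !mulr0.
  apply: ler_wpM2r; first exact: sqnormc_ge0.
  by apply: lerXn2r; rewrite ?nnegrE ?(ltW (mu0 _))// mu_mono.
rewrite -!EFinM lee_fin; apply: ler_wpM2l; first exact: sqr_ge0.
exact: (pvm_contract hE).
Qed.

(** On differences [w] of points of the ball, split off the span of the first [M] eigenvectors: the
    rest is shrunk by [mu M], and the image of the span is seen by the first [M] coordinates of
    [T w]. *)
Lemma dcalc_compact : compact_op T.
Proof.
have Tlin := dcalc_linear hT; split=> //.
pose g : {linear H -> H} := HB.pack T (GRing.isLinear.Build _ _ _ _ T Tlin).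
have TB y z : T (y - z) = T y - T z by exact: (linearB g).
have Tsum (s : seq H) (a : H -> R[i]) :
    T (\sum_(b <- s) a b *: b) = \sum_(b <- s) a b *: T b.
  transitivity (\sum_(b <- s) T (a b *: b)); first exact: (linear_sum g).
  by apply: eq_bigr => b _; exact: (linearZ_LR g).
have ball1 x : `|x| <= 1 -> sq x <= 1.
  move=> x1; have : `|x| <= 1%:C :> R[i] by [].
  by rewrite (norm_le hd)// expr1n.
apply: (precompact_of_coordinates hd (e := e) (b := mu 0 ^+ 2)).
- by move=> n; rewrite /sq (eb_on heb) eqxx.
- move=> _ [x /= /ball1 x1 <-]; apply: le_trans (dcalc_tail (M := 0) _) _ => //.
  by rewrite ler_piMr// sqr_ge0.
move=> eps e0.
(* As [mu M < 1], its square is below [eps / 32] as well; with [sq w2 <= 4] this gives [eps / 8] for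
   the tail. The [M] coordinates add at most [eps / 4], [M.+1] avoiding a division by 0, and
   doubling leaves [3 eps / 4]. *)
have [M hM] := mu_cvg0 (eps := Num.min 1 (eps / 32)) ltac:(by rewrite lt_min ltr01 divr_gt0).
have [hM1 hM2] : mu M < 1 /\ mu M < eps / 32 by move: hM; rewrite lt_min => /andP.
exists M, (eps / (4 * M.+1%:R)); first by rewrite divr_gt0// mulr_gt0.
move=> _ _ [x /= /ball1 x1 <-] [x' /= /ball1 x'1 <-] hxx.
rewrite -TB in hxx *; set w := x - x' in hxx *.
have w4 : sq w <= 4 by apply: le_trans (sqB_le _ _) _; lra.
pose s := [seq e n | n <- iota 0 M].
have us : uniq s by rewrite map_inj_uniq ?iota_uniq//; exact: (eb_inj heb).
have sr b : b \in s -> range e b by move=> /mapP[n _ ->]; exists n.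
pose w1 := onproj (dot := dot) s w; pose w2 := w - w1.
have w2s n : (n < M)%N -> dot w2 (e n) = 0.
  move=> nM; have ns : e n \in s by apply/mapP; exists n; rewrite // mem_iota.
  by rewrite /w2 dotBl (dot_sum_in eb_onset (fun b => dot w b))// subrr.
have sw2 : sq w2 <= 4.
  by rewrite /w2 (sq_residual eb_onset)//; have := projsq_ge0 (dot := dot) s w; lra.
have Tw2 : sq (T w2) <= eps / 8.
  apply: le_trans (dcalc_tail w2s) _.
  have h : mu M ^+ 2 <= eps / 32.
    by rewrite expr2; have := mu0 M; nra.
  have := sq_ge0 (dot := dot) w2; have := sqr_ge0 (mu M); nra.
have Tw1 : T w1 = onproj (dot := dot) s (T w).
  rewrite /w1 /onproj Tsum [LHS]big_seq [RHS]big_seq; apply: eq_bigr => b.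
  move=> /mapP[n _ ->]; rewrite dcalc_coord (dcalc_eigen hd hE heb n hT).
  by rewrite scalerA mulrC.
have sTw1 : sq (T w1) <= eps / 4.
  rewrite Tw1 (sq_proj eb_onset)// /projsq big_map.
  apply: (@le_trans _ _ (\sum_(n <- iota 0 M) eps / (4 * M.+1%:R))).
    rewrite big_seq [leRHS]big_seq; apply: ler_sum => n.
    by rewrite mem_iota => /andP[_ nM]; exact: hxx.
  rewrite big_const_seq count_predT size_iota iter_addr addr0 invfM mulrA.
  rewrite -[X in X <= _]mulr_natr -mulrA ler_piMr//; first by rewrite divr_ge0// ltW.
  by rewrite mulrC ler_pdivrMr// mul1r ler_nat.
have -> : T w = T w1 + T w2 by rewrite /w2 (TB w w1) addrC subrK.
by apply: le_lt_trans (sqD_le _ _) _; lra.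
Qed.

(** Testing against [e n] gives [(mu n ^+ 2 - s ^+ 2) dot x (e n) = 0]. So a vector orthogonal to
    the listed ones has no eigencoordinates, [T] kills it, and [s ^+ 2] times its squared norm is
    0. *)
Lemma dcalc_singular_basis s : 0 < s ->
  orthonormal_basis dot (singular_space dot T s) [set e n | n in [set n | mu n = s]].
Proof.
move=> s0; have [on1 on2] := eb_onset.
have Te n : T (e n) = (mu n)%:C *: e n by exact: (dcalc_eigen hd hE heb n hT).
have rconj (r : R) : Num.conj (r%:C : R[i]) = r%:C.
  by apply/eqP; rewrite eq_complex/= oppr0 !eqxx.
split.
- move=> _ [n /= ns <-] y; rewrite Te dotZl ns [dot (e n) (T y)]dotC dcalc_coord.
  by rewrite rmorphM/= rconj ns -dotC mulrA -rmorphM -expr2.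
- by move=> _ [n _ <-]; apply: on1; exists n.
- by move=> _ _ [m _ <-] [n _ <-]; apply: on2; [exists m|exists n].
move=> x xs hx.
have xe n : dot x (e n) = 0.
  have [ns|ns] := pselect (mu n = s); first by apply: hx; exists n.
  have := xs (e n); rewrite Te dotZr rconj dcalc_coord mulrA -rmorphM/= => h.
  have : ((mu n * mu n - s ^+ 2)%:C : R[i]) * dot x (e n) = 0.
    by rewrite rmorphB mulrBl h subrr.
  move=> /eqP; rewrite mulf_eq0 => /orP[|/eqP//].
  rewrite eq_complex/= eqxx andbT -expr2 subr_sqr mulf_eq0 subr_eq0.
  by rewrite (gt_eqF (addr_gt0 (mu0 n) s0)) orbF => /eqP.
have Ex0 : E `]0, +oo[%classic x = 0.
  apply: (eb_complete heb); first by rewrite (pvm_idem hE).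
  move=> n; rewrite (pvm_sym hE)// (eb_apply hE heb)// indicE mem_set/=; last first.
    by rewrite in_itv/= (eb_gt0 heb).
  by rewrite scale1r.
have := xs x; rewrite (dcalc_zero hE hT Ex0) dot0l dotxx -rmorphM/=.
move=> /esym [/eqP]; rewrite mulf_eq0 sqrf_eq0 (gt_eqF s0)/= => /eqP.
exact: sq_eq0.
Qed.

(** [singular_values] is a choice, so uniqueness is at stake: the finite dimension of the singular
    spaces determines the multiplicities, and these determine a nonincreasing sequence. *)
Lemma dcalc_singular_values : singular_values dot T = mu.
Proof.
have card_mu s : ([set e n | n in [set n | mu n = s]] #= [set n | mu n = s])%card.
  by apply: inj_card_eq => m n _ _; exact: (eb_inj heb).
have hmu : is_singular_values dot T mu.
  split; first by move=> m n; exact: mu_mono.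
    by move=> n; exact: ltW.
  move=> s s0; exists [set e n | n in [set n | mu n = s]]; split.
    exact: dcalc_singular_basis.
  exact: card_mu.
have [nu_mono nu0 hnu] : is_singular_values dot T (singular_values dot T).
  by apply: (@getPex _ (is_singular_values dot T)); exists mu.
apply: monotone_seq_eq => //; first by move=> n; exact: ltW.
move=> s s0; have [B [bB cB]] := hnu s s0.
apply: card_eq_trans (card_esym cB) _; apply: card_eq_trans (card_mu s).
apply: (basis_card_eq _ bB (dcalc_singular_basis s0)).
  move=> a y z hy hz x; have Tlin := dcalc_linear hT.
  by rewrite Tlin !dotDl !dotZl hy hz mulrDr mulrCA.
apply: finite_image; have [M hM] := mu_cvg0 s0.
apply: (sub_finite_set _ (finite_II M)) => n /= ns.
by rewrite ltnNge; apply/negP => /mu_mono; rewrite ns leNgt hM.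
Qed.

End DiagonalOperator.

(** * Dixmier traces *)

(** The preimage of any set is a countable union of level sets of [M]. *)
Lemma measurable_comp_nondecreasing_nat (R : realType) (M : R -> nat) (v : nat -> R) :
  {homo M : x y / x <= y >-> (x <= y)%N} ->
  measurable_fun setT (fun x => v (M x)).
Proof.
move=> M_nd; have mM : measurable_fun setT (fun x => (M x)%:R : R).
  by apply: nondecreasing_measurable => // s t st; rewrite ler_nat M_nd.
move=> _ Y mY; rewrite setTI.
have -> : (fun x => v (M x)) @^-1` Y = \bigcup_(n in [set n | Y (v n)])
    ((fun x => (M x)%:R : R) @^-1` [set n%:R]).
  apply/seteqP; split => [t Yt|t [n Yn /= /eqP]]; first by exists (M t).
  by rewrite eqr_nat => /eqP ->.
by apply: bigcup_measurable => n _; rewrite -[X in measurable X]setTI; exact: mM.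
Qed.

Section DixmierLimit.
Context {R : realType}.
Variable u : nat -> R.
Hypothesis cu : u @ \oo --> (1 : R).

Let f (t : R) := u (Num.truncn t).

Lemma Linfty_truncn : Linfty f.
Proof.
have /cvg_seq_bounded[M [_ hM]] : cvgn u by apply/cvg_ex; exists 1.
have {}hM n : `|u n| <= M + 1 by apply: hM => //; rewrite ltrDl.
rewrite /Linfty inE; apply/andP; split; first last.
  rewrite inE/= /finite_norm Lnorm.unlock; case: ifP => // _.
  apply: (@le_lt_trans _ _ (M + 1)%:E); last exact: ltry.
  by apply/ess_supP; apply: nearW => t /=; rewrite lee_fin; exact: hM.
by rewrite inE; apply: measurable_comp_nondecreasing_nat; exact: le_truncn.
Qed.

Lemma ae_lebesgue_right (a : R) (P : R -> Prop) : (forall t, a < t -> P t) ->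
  \forall t \ae lebesgue_right a, P t.
Proof.
move=> h; exists `]-oo, a]%classic; split => //.
  rewrite /lebesgue_right/= /mrestr/= (_ : _ `&` _ = set0) ?measure0//.
  by rewrite -subset0 => t /= []; rewrite !in_itv/= andbT leNgt => /negP.
by move=> t /= nP; rewrite in_itv/= leNgt; apply/negP => /h.
Qed.

(** [dixmier_bounds] pins the value: beyond some [a] the function is within [eps] of 1, so the
    essential bounds on []a, +oo[] are too. *)
Lemma dixmier_lim_seq_cvg1 omega : dixmier_state omega ->
  dixmier_lim_seq omega u = 1.
Proof.
move=> ho; have /andP[hi hs] := dixmier_bounds ho Linfty_truncn.
have key eps : 0 < eps -> exists2 a : R, 0 < a &
    forall t, a < t -> `|f t - 1| <= eps.
  move=> e0; have /cvgrPdist_le/(_ _ e0)[m _ hm] := cu.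
  exists m.+1%:R => // t mt; rewrite /f distrC; apply: hm => /=.
  have t0 : 0 <= t by apply: le_trans (ltW mt).
  by rewrite truncn_ge_nat//; apply: le_trans (ltW mt); rewrite ler_nat.
apply/eqP; rewrite eq_le /dixmier_lim_seq; apply/andP; split.
- apply/ler_addgt0Pl => eps e0; have [a a0 ha] := key _ e0.
  rewrite -lee_fin; apply: le_trans hs _; apply: ge_ereal_inf.
  exists (ess_sup (lebesgue_right a) (EFin \o f)).
    by exists a => //=; rewrite in_itv/= a0.
  apply/ess_supP; apply: ae_lebesgue_right => t /ha /=.
  by rewrite lee_fin ler_distl => /andP[_]; rewrite addrC.
- apply/ler_addgt0Pl => eps e0; have [a a0 ha] := key _ e0.
  rewrite -lerBlDl -lee_fin; apply: le_trans hi; apply: le_ereal_sup_tmp.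
  exists (ess_inf (lebesgue_right a) (EFin \o f)).
    by exists a => //=; rewrite in_itv/= a0.
  apply/ess_infP; apply: ae_lebesgue_right => t /ha /=.
  by rewrite lee_fin ler_distl => /andP[].
Qed.

End DixmierLimit.

Section SpectralDensity.
Context {R : realType} {H : completeNormedModType R[i]}.
Context {dot : {dot H for Num.conj}}.
Hypothesis hd : hilbert_form dot.
Variable E : set R -> H -> H.
Hypothesis hE : projection_valued_measure dot E.
Variables (e : nat -> H) (lam : nat -> R) (N : R -> nat).
Hypothesis heb : eigenbasis (dot := dot) E e lam N.

Lemma cvg_partition_series (b : R) : 0 < b -> (heat_trace dot E b < +oo)%E ->
  series (fun n => expR (- (b * lam n))) @ \oo --> partition_function dot E b.
Proof.
move=> b0; pose f (l : R) := expR (- (b * l)).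
have mf : measurable_fun setT f.
  apply: measurableT_comp => //; apply: measurableT_comp => //.
have f01 l : 0 < l -> 0 <= f l <= 1.
  move=> l0; rewrite /f expR_ge0/= -[leRHS]expR0 ler_expR oppr_le0.
  by rewrite mulr_ge0 ?ltW.
have [T [A hT]] := digit_calculus_exists hd hE mf f01.
have tr : (heat_trace dot E b = \sum_(0 <= n <oo) (f (lam n))%:E)%E.
  rewrite /heat_trace (fun_calculusE hT) (trace_dcalc hd hE heb hT)// => l.
  by move=> /f01/andP[].
rewrite /partition_function tr => fin.
have f0 n : (0 <= (f (lam n))%:E)%E by rewrite lee_fin expR_ge0.
have h : (\sum_(0 <= n < m) (f (lam n))%:E)%E @[m --> \oo] -->
    (\sum_(0 <= n <oo) (f (lam n))%:E)%E.
  by apply: is_cvg_nneseries.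
have finN : (\sum_(0 <= n <oo) (f (lam n))%:E)%E \is a fin_num.
  by rewrite ge0_fin_numE//; apply: nneseries_ge0.
rewrite -(fineK finN) in h; move/fine_cvg: h.
by apply: cvg_trans; apply: near_eq_cvg; apply: nearW => m /=; rewrite sumEFin.
Qed.

Lemma counting_mono : {homo N : x y / x <= y >-> (x <= y)%N}.
Proof.
move=> x y xy; rewrite leqNgt; apply/negP => h.
have := h; rewrite (eb_count heb) => /le_trans/(_ xy).
by rewrite -(eb_count heb) ltnn.
Qed.

Lemma spectral_weight_density :
  (ln n%:R)^-1 * (\sum_(i < n) (N (lam i))%:R^-1) @[n --> \oo] --> (1 : R) ->
  spectral_density dot (spectral_weight dot E).
Proof.
pose f (l : R) : R := (N l)%:R^-1.
have Nn n : (n < N (lam n))%N by rewrite (eb_count heb).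
have mf : measurable_fun setT f.
  exact: (measurable_comp_nondecreasing_nat (fun n => n%:R^-1) counting_mono).
have f01 l : 0 < l -> 0 <= f l <= 1.
  (* Below the first eigenvalue [N l] is 0, and so is its inverse by convention. *)
  move=> _; rewrite /f invr_ge0 ler0n/=; case: (N l) => [|n]; first by rewrite invr0.
  by rewrite invf_le1// ler1n.
have [T [A hT]] := digit_calculus_exists hd hE mf f01.
have -> : spectral_weight dot E = T.
  rewrite /spectral_weight -(fun_calculusE hT); congr (fun_calculus _ _ _).
  by apply/funext => l; rewrite (counting_functionE hd hE heb).
have mu0 n : 0 < f (lam n) by rewrite invr_gt0 ltr0n (leq_ltn_trans _ (Nn n)).
have mu_mono m n : (m <= n)%N -> f (lam n) <= f (lam m).
  move=> mn; rewrite lef_pV2 ?posrE ?ltr0n ?(leq_ltn_trans _ (Nn _))// ler_nat.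
  exact/counting_mono/(eb_mono heb).
have mu_cvg0 eps : 0 < eps -> exists n, f (lam n) < eps.
  (* With this [n], [N (lam n) >= n + 1 > 1 / eps]. *)
  move=> e0; exists (Num.truncn eps^-1); set n := Num.truncn _.
  rewrite invf_plt ?posrE ?ltr0n ?(leq_ltn_trans _ (Nn _))//.
  by apply: lt_le_trans (truncnS_gt _) _; rewrite ler_nat; exact: Nn.
have sv := dcalc_singular_values hd hE heb hT mu0 mu_mono mu_cvg0.
move=> mean.
have lm : log_mean_singular dot T @ \oo --> (1 : R).
  by move: mean; rewrite /log_mean_singular sv.
have tr omega : dixmier_state omega -> dixmier_trace dot omega T = 1.
  exact: dixmier_lim_seq_cvg1.
split=> //; last by move=> o o' ho ho'; rewrite !tr.
split; first exact: (dcalc_compact hd hE heb hT mu0 mu_mono mu_cvg0).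
have /cvg_seq_bounded[M [_ hM]] : cvgn (log_mean_singular dot T).
  by apply/cvg_ex; exists 1.
exists (M + 1) => n _; apply: le_trans (ler_norm _) _.
by apply: hM => //; rewrite ltrDl.
Qed.

End SpectralDensity.

Local Close Scope complex_scope.

Theorem proposition2p10 (R : realType) (H : completeNormedModType R[i])
    (dot : {dot H for Num.conj}) (D : set H) (L : H -> H)
    (E : set R -> H -> H) :
  hilbert_form dot ->
  dense D -> linear_on D L -> self_adjoint dot D L -> nonneg_op dot D L ->
  unbounded_op D L ->
  spectral_measure_of dot D L E ->
  discrete_off_ker dot D L ->
  (forall b : R, 0 < b -> (heat_trace dot E b < +oo)%E) ->
  regularly_varying_at0 (partition_function dot E) ->
  [/\ exists2 c : R, 0 < c &
        asymp_equiv (counting_function dot E)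
          (fun x => c * partition_function dot E x^-1),
      asymptotically_continuous (counting_function dot E) &
      spectral_density dot (spectral_weight dot E)].
Proof.
move=> hd _ Llin Lsa Lpos Lunb LE _ heat [gam HR].
have [hE _ _] := LE.
have hfin x : 0 < x -> (op_trace dot (E `]0%R, x]%classic) < +oo)%E.
  by move=> x0; apply: heat_trace_finite => //; exact: heat.
have hinf := spectrum_unbounded hd hE Llin Lsa Lpos LE Lunb.
have [e [lam [N heb]]] := eigenbasis_exists hd hE hfin hinf.
have HZ b (b0 : 0 < b) := cvg_partition_series hd hE heb b0 (heat b b0).
have lam0 := eb_gt0 heb; have lamN := eb_count heb.
have -> : counting_function dot E = (fun x => (N x)%:R).
  by apply/funext => x; exact: (counting_functionE hd hE heb).
have [c c0 hF] := tauberian lam0 lamN HZ HR.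
split.
- exists c => //; have h : c^-1 * ((N x)%:R / partition_function dot E x^-1)
      @[x --> +oo] --> c^-1 * c by exact: cvgMl_tmp.
  rewrite mulVf ?lt0r_neq0// in h; apply: cvg_trans h.
  by apply: near_eq_cvg; apply: nearW => x; rewrite invfM mulrCA.
- have [phi [phic phi0 hphi]] := counting_asymp_continuous lam0 HZ c0 hF.
  exists phi; split => //; exact: continuous_subspaceT.
apply: (spectral_weight_density hd hE heb).
(* Indices start at 0, so [n < N (lam n)] compares the n-th singular value with [1 / (n + 1)]. *)
apply: (@log_mean_cvg1 _ (fun n => N (lam n))); first by move=> n; rewrite lamN.
by move=> eta e0; exact: (counting_eigen_bounds lam0 lamN HZ HR c0 e0 hF).
Qed.
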